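(* There is an integer $r_0\ge 6$ such that the following holds for every $r\ge r_0$. Let $\Omega\subset\mathbb{R}^2$ be a bounded strictly convex domain whose boundary $\partial\Omega$ is a $C^r$ closed curve of length $1$ with everywhere positive curvature, and let $\Phi:(x,l)\mapsto(x^+,l^+)$ be the billiard map of $\Omega$ written in the Lazutkin coordinates $(x,l)$, defined for $x\in\mathbb{T}$ and small $l\ge 0$. Then there exist a function $V:\mathbb{T}\times[0,+\infty)\times\mathbb{T}\to\mathbb{R}$, $(x,q,t)\mapsto V(x,q,t)$, of class $C^{r-5}$, and a number $l_0>0$ such that, for the time-periodic Hamiltonian $$H(x,l,t)=\frac{2\sqrt{2}}{3}\,l^{3/2}+l^{5/2}\,V(x,\sqrt{l},t),\qquad (x,l,t)\in\mathbb{T}\times[0,+\infty)\times\mathbb{T},$$ the time-$1$ map $\phi_H^1$ of the Hamiltonian flow satisfies $\phi_H^1(x,l)=\Phi(x,l)$ for all $x\in\mathbb{T}$ and all $0\le l\le l_0$.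
   Context: $\mathbb{T}=\mathbb{R}/\mathbb{Z}$. Billiard map: $s\in\mathbb{T}$ is the arc-length parameter on $\partial\Omega$ (total length $1$), and $v\in[0,\pi]$ is the angle between the positively oriented tangent of $\partial\Omega$ at the point with parameter $s$ and the outgoing straight-line trajectory. The billiard map $(s,v)\mapsto(s^+,v^+)$ sends a reflection point with its reflected angle to the next reflection point with its reflected angle, where at each impact the angle of incidence equals the angle of reflection. It fixes every point of $\{v=0\}$. Lazutkin coordinates: let $\rho(s)>0$ be the radius of curvature of $\partial\Omega$ at $s$ and $C_1=\big(\int_0^1\rho(\tau)^{-2/3}d\tau\big)^{-1}$. Put $$x=C_1\int_0^s\rho(\tau)^{-2/3}d\tau,\qquad y=4C_1\,\rho(s)^{1/3}\sin(v/2),\qquad l=\frac{y^2}{2}.$$ For small $v\ge 0$ (equivalently small $l\ge0$), $(x,l)$ are coordinates on the phase space. The billiard map in these coordinates is denoted $\Phi$, and it preserves $dx\wedge dl$. Hamiltonian flow: $\phi_H^t(x,l)$ is the value at time $t$ of the solution of $\dot x=\partial_lH(x,l,t)$, $\dot l=-\partial_xH(x,l,t)$ starting at $(x,l)$ at time $0$. *)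

(* Defs.v *)
(* Real analysis over Stdlib's R with Coquelicot.  The circle T = R/Z is
   represented by real numbers modulo [eqT]; functions on T are 1-periodic
   functions on R. *)
From Stdlib Require Import Reals ZArith.
From Coquelicot Require Import Coquelicot.
Open Scope R_scope.

Definition eqT (a b : R) : Prop := exists k : Z, a = b + IZR k.

(* Derivative relative to a set: one-sided at the endpoints of an interval. *)
Definition is_derive_on (D : R -> Prop) (f : R -> R) (x d : R) : Prop :=
  filterdiff f (within D (locally x)) (fun h : R => scal h d).

Definition Ck (k : nat) (f : R -> R) : Prop :=
  (forall (j : nat) (x : R), (j <= k)%nat -> ex_derive_n f j x) /\
  (forall x : R, continuous (Derive_n f k) x).

(* Class C^k on the closed half-space {(x, q, t) | 0 <= q}: all partial
   derivatives of order at most k exist (one-sided in q at q = 0) and are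
   continuous up to the boundary.  Values at q < 0 are irrelevant. *)

Definition continuous_half (f : R -> R -> R -> R) : Prop :=
  forall x q t : R, 0 <= q ->
    filterlim (fun p : R * R * R => f (fst (fst p)) (snd (fst p)) (snd p))
      (within (fun p : R * R * R => 0 <= snd (fst p)) (locally (x, q, t)))
      (locally (f x q t)).

Fixpoint Ck_half (k : nat) (f : R -> R -> R -> R) : Prop :=
  continuous_half f /\
  match k with
  | O => True
  | S j =>
      exists fx fq ft : R -> R -> R -> R,
        (forall x q t : R, 0 <= q ->
           is_derive (fun z => f z q t) x (fx x q t) /\
           is_derive_on (fun z => 0 <= z) (fun z => f x z t) q (fq x q t) /\
           is_derive (fun z => f x q z) t (ft x q t)) /\
        Ck_half j fx /\ Ck_half j fq /\ Ck_half j ft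
  end.

Definition closure (A : R * R -> Prop) (p : R * R) : Prop :=
  forall U : R * R -> Prop, locally p U -> exists q, U q /\ A q.

Definition boundary (A : R * R -> Prop) (p : R * R) : Prop :=
  closure A p /\ closure (fun q => ~ A q) p.

(* Connectedness is not listed: it follows from convexity. *)
Definition strictly_convex_domain (Omega : R * R -> Prop) : Prop :=
  open Omega /\
  (exists p, Omega p) /\
  (exists M : R, forall p, Omega p -> norm p <= M) /\
  (forall (p q : R * R) (t : R),
     closure Omega p -> closure Omega q -> p <> q -> 0 < t < 1 ->
     Omega (plus (scal (1 - t) p) (scal t q))).

Definition tangent (gamma : R -> R * R) (s : R) : R * R :=
  (Derive (fun z => fst (gamma z)) s, Derive (fun z => snd (gamma z)) s).

(* Signed curvature of a curve parametrized by arc length. *)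
Definition curvature (gamma : R -> R * R) (s : R) : R :=
  Derive (fun z => fst (gamma z)) s * Derive_n (fun z => snd (gamma z)) 2 s -
  Derive (fun z => snd (gamma z)) s * Derive_n (fun z => fst (gamma z)) 2 s.

(* [gamma] is a C^r arc-length parametrization of the boundary, which is a
   simple closed curve.  Unit speed and injectivity modulo 1 make its length
   equal to 1.  Positivity of the signed curvature says both that the curvature
   does not vanish and that [gamma] is positively oriented (Omega on its left). *)
Definition arclength_boundary (r : nat) (Omega : R * R -> Prop)
    (gamma : R -> R * R) : Prop :=
  Ck r (fun s => fst (gamma s)) /\
  Ck r (fun s => snd (gamma s)) /\
  (forall s, fst (tangent gamma s) ^ 2 + snd (tangent gamma s) ^ 2 = 1) /\
  (forall s s', gamma s = gamma s' <-> eqT s s') /\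
  (forall p, boundary Omega p <-> exists s, gamma s = p) /\
  (forall s, 0 < curvature gamma s).

(* The unit tangent at s rotated counterclockwise by the angle v. *)
Definition direction (gamma : R -> R * R) (s v : R) : R * R :=
  let e := tangent gamma s in
  (cos v * fst e - sin v * snd e, sin v * fst e + cos v * snd e).

(* Graph of the billiard map (s, v) |-> (s', v').  The trajectory leaving
   gamma s runs inside Omega until it hits the boundary at gamma s'; the law of
   reflection says that its direction is the mirror image in the tangent at
   gamma s' of the outgoing direction of angle v', i.e. has angle - v'. *)
Definition billiard (Omega : R * R -> Prop) (gamma : R -> R * R)
    (s v s' v' : R) : Prop :=
  0 <= v <= PI /\ 0 <= v' <= PI /\
  ((v = 0 /\ eqT s' s /\ v' = 0) \/
   (0 < v /\
    exists d : R,
      0 < d /\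
      (forall a, 0 < a < d ->
         Omega (plus (gamma s) (scal a (direction gamma s v)))) /\
      gamma s' = plus (gamma s) (scal d (direction gamma s v)) /\
      direction gamma s v = direction gamma s' (- v'))).

Definition rho (gamma : R -> R * R) (s : R) : R := / curvature gamma s.

Definition C1 (gamma : R -> R * R) : R :=
  / RInt (fun tau => Rpower (rho gamma tau) (- (2 / 3))) 0 1.

Definition lazutkin_x (gamma : R -> R * R) (s : R) : R :=
  C1 gamma * RInt (fun tau => Rpower (rho gamma tau) (- (2 / 3))) 0 s.

Definition lazutkin_y (gamma : R -> R * R) (s v : R) : R :=
  4 * C1 gamma * Rpower (rho gamma s) (1 / 3) * sin (v / 2).

Definition lazutkin_l (gamma : R -> R * R) (s v : R) : R :=
  lazutkin_y gamma s v ^ 2 / 2.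

(* Graph of the billiard map Phi : (x, l) |-> (x', l') in Lazutkin coordinates,
   with x and x' in T. *)
Definition Phi (Omega : R * R -> Prop) (gamma : R -> R * R)
    (x l x' l' : R) : Prop :=
  exists s v s' v' : R,
    billiard Omega gamma s v s' v' /\
    eqT x (lazutkin_x gamma s) /\ l = lazutkin_l gamma s v /\
    eqT x' (lazutkin_x gamma s') /\ l' = lazutkin_l gamma s' v'.

(* Solutions on [0, t1] of Hamilton's equations in the phase space {l >= 0};
   x is lifted from T to R. *)
Definition hamilton_solution (H : R -> R -> R -> R) (t1 : R)
    (X L : R -> R) : Prop :=
  forall t : R, 0 <= t <= t1 ->
    0 <= L t /\
    exists Hx Hl : R,
      is_derive (fun z => H z (L t) t) (X t) Hx /\
      is_derive_on (fun z => 0 <= z) (fun z => H (X t) z t) (L t) Hl /\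
      is_derive_on (fun z => 0 <= z <= t1) X t Hl /\
      is_derive_on (fun z => 0 <= z <= t1) L t (- Hx).

(* phi_H^t1 (x, l) = (x', l'): a solution starting at (x, l) exists, and every
   such solution takes the value (x', l') at time t1. *)
Definition hamilton_flow (H : R -> R -> R -> R) (t1 x l x' l' : R) : Prop :=
  (exists X L : R -> R, hamilton_solution H t1 X L /\ X 0 = x /\ L 0 = l) /\
  (forall X L : R -> R,
     hamilton_solution H t1 X L -> X 0 = x -> L 0 = l ->
     X t1 = x' /\ L t1 = l').

(* Half-integer powers of l are powers of [sqrt l], since [Rpower 0 a] is
   not 0. *)
Definition hamiltonian (V : R -> R -> R -> R) (x l t : R) : R :=
  2 * sqrt 2 / 3 * sqrt l ^ 3 + sqrt l ^ 5 * V x (sqrt l) t.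

(* Main.v *)
(* Since l dx = 4 C1^3 (1 - cos v) ds, the billiard map has the generating function
   S(x, x') = 4 C1^3 (u - chord length), where u = s' - s, that is,
   l = - d_x S and l' = d_x' S.  Lazutkin's normalization says
   S = h^3/6 + h^5 sigma(x', h) with h = x' - x, and sigma is of class C^(r-4): writing
   u^2 - chord^2 as u^4 times a weighted average of |(T(s1) - T(s2))/(s1 - s2)|^2, T being
   the unit tangent, costs two derivatives of the curve only, and Hadamard's lemma, applied
   twice, costs two more; the term of order 4 vanishes by the symmetry of S.

   Let chi(t) increase from 0 to 1, flat near both ends, and let Gamma_t be the map generated
   by h^3/6 + chi(t) h^5 sigma.  Then Gamma_0 is the time-1 map of H0 = y^3/3 and Gamma_1 is the
   billiard map, so that the isotopy phi_H0^(t-1) o Gamma_t leads from the identity to the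
   billiard map.  By the Hamilton-Jacobi equation its Hamiltonian is y^3/3 + K(x + (1-t) y, y, t)
   with K = - chi'(t) h^5 sigma(x, h), where h = h(x, y, t) solves y^2/2 = d_x' S_t.  This equation
   reads y = h sqrt(1 + h^2 B) with B of class C^(r-5), whence h and K / y^5 are of
   class C^(r-5); K is 1-periodic in time because chi' vanishes near the integers. *)

Require Import Defs.
From Stdlib Require Import Reals ZArith Lra Lia Psatz ClassicalEpsilon.
From Coquelicot Require Import Coquelicot.
Open Scope R_scope.

(** * Functions of class C^k on a strip *)

(** The functions live on two-sided strips [Rabs q < d], negative [h] and [q] included, so that
    ordinary derivatives, Hadamard quotients and inversion apply at [q = 0]; one-sidedness enters
    with the potential on [q >= 0] and the flow. Everything is padded to three variables, so that
    one class [Cs] serves curves, generating functions and potentials. Existence of solutions of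
    Hamilton's equations comes from an explicit curve, the image of [(x, y0)] under the isotopy,
    checked by differentiation; the check rests on one factor, the mixed derivative of the
    generating function, which occurs in the derivatives of both momenta. Uniqueness is a separate
    issue, because [l ^ (3/2)] is not smooth at [l = 0]: solutions are shown to stay in [l = 0] or
    in [l > 0], and in the variable [sqrt l] the equations become Lipschitz. This takes two
    derivatives of [V], whence [r - 5 >= 2] and [r0 = 7]. The sign of the sagitta of short arcs
    turns the cosines in the generating function into genuine angles in [[0, PI]], and strict
    convexity identifies the chord with the billiard trajectory. *)

Notation is_derive_const_R := (@is_derive_const R_AbsRing R_NormedModule).
Notation is_derive_id_R := (@is_derive_id R_AbsRing).
Notation is_derive_plus_R := (@is_derive_plus R_AbsRing R_NormedModule).
Notation is_derive_minus_R := (@is_derive_minus R_AbsRing R_NormedModule).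
Notation is_derive_opp_R := (@is_derive_opp R_AbsRing R_NormedModule).
Notation is_derive_mult_R := (@is_derive_mult R_AbsRing).
Notation derivable_continuous_R := (@ex_derive_continuous R_AbsRing R_NormedModule).
Notation continuous_mult_R := (@continuous_mult _ R_AbsRing).
Notation continuous_opp_R := (@continuous_opp _ R_AbsRing R_NormedModule).

Definition cont3 (f : R -> R -> R -> R) (x q t : R) : Prop :=
  continuous (fun p : R * R * R => f (fst (fst p)) (snd (fst p)) (snd p)) (x, q, t).

Definition partials (f fx fq ft : R -> R -> R -> R) (x q t : R) : Prop :=
  is_derive (fun z => f z q t) x (fx x q t) /\
  is_derive (fun z => f x z t) q (fq x q t) /\
  is_derive (fun z => f x q z) t (ft x q t).

Lemma partials_x (f fx fq ft : R -> R -> R -> R) (x q t : R) :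
  partials f fx fq ft x q t -> is_derive (fun z => f z q t) x (fx x q t).
Proof. intros [H _]; exact H. Qed.

Lemma partials_q (f fx fq ft : R -> R -> R -> R) (x q t : R) :
  partials f fx fq ft x q t -> is_derive (fun z => f x z t) q (fq x q t).
Proof. intros [_ [H _]]; exact H. Qed.

Lemma partials_t (f fx fq ft : R -> R -> R -> R) (x q t : R) :
  partials f fx fq ft x q t -> is_derive (fun z => f x q z) t (ft x q t).
Proof. intros [_ [_ H]]; exact H. Qed.

(* Class C^k on the strip [Rabs q < d], in the style of [Ck_half]. *)
Fixpoint Cs (d : R) (k : nat) (f : R -> R -> R -> R) : Prop :=
  (forall x q t, Rabs q < d -> cont3 f x q t) /\
  match k with
  | O => True
  | S j => exists fx fq ft,
      (forall x q t, Rabs q < d -> partials f fx fq ft x q t) /\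
      Cs d j fx /\ Cs d j fq /\ Cs d j ft
  end.

Ltac split_Rmin :=
  match goal with
  | H : _ < Rmin _ _ |- _ =>
      let H1 := fresh in let H2 := fresh in
      destruct (Rmin_Rgt_l _ _ _ H) as [H1 H2]; clear H;
      unfold Rgt in H1, H2
  end.

Lemma is_derive_eps (f : R -> R) (x l : R) :
  is_derive f x l <->
  (forall e, 0 < e -> exists d, 0 < d /\ forall y, Rabs (y - x) < d ->
     Rabs (f y - f x - l * (y - x)) <= e * Rabs (y - x)).
Proof.
split.
- intros [_ H] e He.
  destruct (H x (fun P HP => HP) (mkposreal e He)) as [d Hd].
  exists d; split; [apply cond_pos|]. intros y Hy.
  specialize (Hd y Hy). unfold minus, plus, opp, scal, norm in Hd; simpl in Hd.
  unfold mult, abs in Hd; simpl in Hd.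
  replace (f y - f x - l * (y - x)) with (f y + - f x + - ((y + - x) * l)) by ring.
  exact Hd.
- intros H. split. apply is_linear_scal_l.
  intros x' Hx'. rewrite <- (is_filter_lim_locally_unique x x' Hx'). clear x' Hx'.
  intros e. destruct (H e (cond_pos e)) as [d [Hd1 Hd2]].
  exists (mkposreal d Hd1). intros y Hy. specialize (Hd2 y Hy).
  unfold minus, plus, opp, scal, norm; simpl. unfold mult, abs; simpl.
  replace (f y + - f x + - ((y + - x) * l)) with (f y - f x - l * (y - x)) by ring.
  exact Hd2.
Qed.

Lemma cont3_eps (f : R -> R -> R -> R) (x q t : R) :
  cont3 f x q t <->
  (forall e, 0 < e -> exists d, 0 < d /\ forall x' q' t',
     Rabs (x' - x) < d -> Rabs (q' - q) < d -> Rabs (t' - t) < d ->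
     Rabs (f x' q' t' - f x q t) < e).
Proof.
split.
- intros H e He.
  destruct (proj1 (filterlim_locally _ _) H (mkposreal e He)) as [d Hd].
  exists d; split; [apply cond_pos|]. intros x' q' t' H1 H2 H3.
  exact (Hd (x', q', t') (conj (conj H1 H2) H3)).
- intros H. apply filterlim_locally. intros e.
  destruct (H e (cond_pos e)) as [d [Hd1 Hd2]].
  exists (mkposreal d Hd1). intros [[x' q'] t'] [[H1 H2] H3].
  exact (Hd2 x' q' t' H1 H2 H3).
Qed.

(** In effect the mean value theorem for [g z - c * z]. With [c] a partial derivative at the base
    point it gives first-order expansions, with [c = 0] Lipschitz bounds. *)
Lemma mvt_linear_bound (g g' : R -> R) (a b c e : R) :
  (forall z, Rmin a b <= z <= Rmax a b -> is_derive g z (g' z)) ->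
  (forall z, Rmin a b <= z <= Rmax a b -> Rabs (g' z - c) <= e) ->
  Rabs (g b - g a - c * (b - a)) <= e * Rabs (b - a).
Proof.
intros H1 H2.
destruct (MVT_gen g a b g') as [z [Hz E]].
- intros; apply H1; lra.
- intros z Hz. apply derivable_continuous_pt.
  exists (g' z). apply is_derive_Reals. apply H1; lra.
- rewrite E. replace (g' z * (b - a) - c * (b - a)) with ((g' z - c) * (b - a)) by ring.
  rewrite Rabs_mult. apply Rmult_le_compat_r. apply Rabs_pos. apply H2; lra.
Qed.

Lemma between_abs (a b z d : R) :
  Rmin a b <= z <= Rmax a b -> Rabs (b - a) < d -> Rabs (z - a) < d.
Proof.
unfold Rmin, Rmax, Rabs; destruct Rle_dec; repeat destruct Rcase_abs; intros; lra.
Qed.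

(** The increment is split into moves along [x], [q] and [t], each estimated by the mean value
    theorem. Partial derivatives must exist along these segments, whence the strip; their continuity
    is used at the base point. *)
Lemma differentiable3 (f fx fq ft : R -> R -> R -> R) (d x q t : R) :
  (forall x q t, Rabs q < d -> partials f fx fq ft x q t) -> Rabs q < d ->
  cont3 fx x q t -> cont3 fq x q t -> cont3 ft x q t ->
  forall e, 0 < e -> exists r, 0 < r /\ forall x' q' t',
     Rabs (x' - x) < r -> Rabs (q' - q) < r -> Rabs (t' - t) < r ->
     Rabs (f x' q' t' - f x q t
           - (fx x q t * (x' - x) + fq x q t * (q' - q) + ft x q t * (t' - t)))
       <= e * (Rabs (x' - x) + Rabs (q' - q) + Rabs (t' - t)).
Proof.
intros Hp Hq Cx Cq Ct e He.
destruct (proj1 (cont3_eps _ _ _ _) Cx e He) as [r1 [R1 K1]].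
destruct (proj1 (cont3_eps _ _ _ _) Cq e He) as [r2 [R2 K2]].
destruct (proj1 (cont3_eps _ _ _ _) Ct e He) as [r3 [R3 K3]].
set (r := Rmin (Rmin r1 r2) (Rmin r3 (d - Rabs q))).
assert (Hr : 0 < r) by (unfold r; repeat apply Rmin_pos; lra).
assert (L1 : r <= r1) by (unfold r; eapply Rle_trans; apply Rmin_l).
assert (L2 : r <= r2) by (unfold r; eapply Rle_trans; [apply Rmin_l | apply Rmin_r]).
assert (L3 : r <= r3) by (unfold r; eapply Rle_trans; [apply Rmin_r | apply Rmin_l]).
assert (L4 : r <= d - Rabs q) by (unfold r; eapply Rle_trans; apply Rmin_r).
exists r; split; [exact Hr|]. intros x' q' t' Hx' Hq' Ht'.
assert (Z : forall a, Rabs (a - a) < r) by (intro a; rewrite Rminus_diag, Rabs_R0; lra).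
assert (Q : forall z, Rabs (z - q) < r -> Rabs z < d).
{ intros z Hz. generalize (Rabs_triang (z - q) q). replace (z - q + q) with z by ring. lra. }
assert (B1 : Rabs (f x' q' t' - f x q' t' - fx x q t * (x' - x)) <= e * Rabs (x' - x)).
{ apply mvt_linear_bound with (g := fun z => f z q' t') (g' := fun z => fx z q' t').
  - intros; refine (partials_x _ _ _ _ _ _ _ (Hp _ _ _ _)); auto.
  - intros z Hz. apply (between_abs _ _ _ r) in Hz; auto.
    left; apply K1; lra. }
assert (B2 : Rabs (f x q' t' - f x q t' - fq x q t * (q' - q)) <= e * Rabs (q' - q)).
{ apply mvt_linear_bound with (g := fun z => f x z t') (g' := fun z => fq x z t').
  - intros z Hz. refine (partials_q _ _ _ _ _ _ _ (Hp _ _ _ _)). apply (between_abs _ _ _ r) in Hz; auto.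
  - intros z Hz. apply (between_abs _ _ _ r) in Hz; auto. specialize (Z x).
    left; apply K2; lra. }
assert (B3 : Rabs (f x q t' - f x q t - ft x q t * (t' - t)) <= e * Rabs (t' - t)).
{ apply mvt_linear_bound with (g := fun z => f x q z) (g' := fun z => ft x q z).
  - intros; refine (partials_t _ _ _ _ _ _ _ (Hp _ _ _ _)); auto.
  - intros z Hz. apply (between_abs _ _ _ r) in Hz; auto. pose proof (Z x). specialize (Z q).
    left; apply K3; lra. }
replace (f x' q' t' - f x q t - (fx x q t * (x' - x) + fq x q t * (q' - q) + ft x q t * (t' - t)))
  with ((f x' q' t' - f x q' t' - fx x q t * (x' - x)) +
        (f x q' t' - f x q t' - fq x q t * (q' - q)) +
        (f x q t' - f x q t - ft x q t * (t' - t))) by ring.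
eapply Rle_trans; [apply Rabs_triang|].
eapply Rle_trans; [apply Rplus_le_compat_r; apply Rabs_triang|]. lra.
Qed.

Lemma is_derive_lip (f : R -> R) (x l : R) :
  is_derive f x l -> exists d, 0 < d /\ forall y, Rabs (y - x) < d ->
    Rabs (f y - f x) <= (Rabs l + 1) * Rabs (y - x).
Proof.
intros H. destruct (proj1 (is_derive_eps _ _ _) H 1 Rlt_0_1) as [d [Hd K]].
exists d; split; [exact Hd|]. intros y Hy. specialize (K y Hy).
replace (f y - f x) with ((f y - f x - l * (y - x)) + l * (y - x)) by ring.
eapply Rle_trans; [apply Rabs_triang|]. rewrite (Rabs_mult l). lra.
Qed.

Lemma is_derive_comp3 (f fx fq ft : R -> R -> R -> R) (d : R) (g1 g2 g3 : R -> R)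
    (z l1 l2 l3 : R) :
  (forall x q t, Rabs q < d -> partials f fx fq ft x q t) -> Rabs (g2 z) < d ->
  cont3 fx (g1 z) (g2 z) (g3 z) -> cont3 fq (g1 z) (g2 z) (g3 z) ->
  cont3 ft (g1 z) (g2 z) (g3 z) ->
  is_derive g1 z l1 -> is_derive g2 z l2 -> is_derive g3 z l3 ->
  is_derive (fun w => f (g1 w) (g2 w) (g3 w)) z
    (fx (g1 z) (g2 z) (g3 z) * l1 + fq (g1 z) (g2 z) (g3 z) * l2
     + ft (g1 z) (g2 z) (g3 z) * l3).
Proof.
intros Hp Hq Cx Cq Ct D1 D2 D3.
set (a1 := fx (g1 z) (g2 z) (g3 z)). set (a2 := fq (g1 z) (g2 z) (g3 z)).
set (a3 := ft (g1 z) (g2 z) (g3 z)).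
apply is_derive_eps. intros e He.
(* [M * Rabs (y - z)] bounds the sum of the three inner increments, and [A] exceeds the sum of the
   outer partials; the error [e] is shared equally between the expansion of [f] and those of the
   [gi]. *)
set (M := Rabs l1 + Rabs l2 + Rabs l3 + 3).
assert (HM : 0 < M) by (unfold M; generalize (Rabs_pos l1) (Rabs_pos l2) (Rabs_pos l3); lra).
set (A := Rabs a1 + Rabs a2 + Rabs a3 + 1).
assert (HA : 0 < A) by (unfold A; generalize (Rabs_pos a1) (Rabs_pos a2) (Rabs_pos a3); lra).
assert (He1 : 0 < e / 2 / M) by (apply Rdiv_lt_0_compat; lra).
assert (He2 : 0 < e / 2 / A) by (apply Rdiv_lt_0_compat; lra).
destruct (differentiable3 f fx fq ft d _ _ _ Hp Hq Cx Cq Ct _ He1) as [r [Hr K]].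
destruct (is_derive_lip _ _ _ D1) as [r1 [R1 L1]].
destruct (is_derive_lip _ _ _ D2) as [r2 [R2 L2]].
destruct (is_derive_lip _ _ _ D3) as [r3 [R3 L3]].
destruct (proj1 (is_derive_eps _ _ _) D1 _ He2) as [s1 [S1 E1]].
destruct (proj1 (is_derive_eps _ _ _) D2 _ He2) as [s2 [S2 E2]].
destruct (proj1 (is_derive_eps _ _ _) D3 _ He2) as [s3 [S3 E3]].
set (p := Rmin (Rmin (Rmin r1 r2) r3) (Rmin (Rmin (Rmin s1 s2) s3) (r / M))).
exists p. split.
{ unfold p; repeat apply Rmin_pos; auto. apply Rdiv_lt_0_compat; lra. }
intros y Hy.
assert (Hy' : Rabs (y - z) < r1 /\ Rabs (y - z) < r2 /\ Rabs (y - z) < r3 /\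
  Rabs (y - z) < s1 /\ Rabs (y - z) < s2 /\ Rabs (y - z) < s3 /\ Rabs (y - z) < r / M).
{ unfold p in Hy. repeat split_Rmin. repeat split; assumption. }
destruct Hy' as (Y1 & Y2 & Y3 & Y4 & Y5 & Y6 & Y7).
specialize (L1 y Y1). specialize (L2 y Y2). specialize (L3 y Y3).
specialize (E1 y Y4). specialize (E2 y Y5). specialize (E3 y Y6).
assert (Y8 : M * Rabs (y - z) < r).
{ apply Rmult_lt_compat_l with (r := M) in Y7; auto.
  replace (M * (r / M)) with r in Y7 by (field; lra). exact Y7. }
pose proof (Rabs_pos (y - z)) as P0.
pose proof (Rabs_pos l1). pose proof (Rabs_pos l2). pose proof (Rabs_pos l3).
assert (N1 : Rabs (g1 y - g1 z) < r) by (unfold M in Y8; nra).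
assert (N2 : Rabs (g2 y - g2 z) < r) by (unfold M in Y8; nra).
assert (N3 : Rabs (g3 y - g3 z) < r) by (unfold M in Y8; nra).
specialize (K _ _ _ N1 N2 N3). fold a1 a2 a3 in K.
replace (f (g1 y) (g2 y) (g3 y) - f (g1 z) (g2 z) (g3 z) -
   (a1 * l1 + a2 * l2 + a3 * l3) * (y - z))
  with ((f (g1 y) (g2 y) (g3 y) - f (g1 z) (g2 z) (g3 z) -
     (a1 * (g1 y - g1 z) + a2 * (g2 y - g2 z) + a3 * (g3 y - g3 z)))
   + a1 * (g1 y - g1 z - l1 * (y - z)) + a2 * (g2 y - g2 z - l2 * (y - z))
   + a3 * (g3 y - g3 z - l3 * (y - z))) by ring.
eapply Rle_trans; [apply Rabs_triang|].
eapply Rle_trans; [apply Rplus_le_compat_r; apply Rabs_triang|].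
eapply Rle_trans; [apply Rplus_le_compat_r; apply Rplus_le_compat_r; apply Rabs_triang|].
rewrite (Rabs_mult a1), (Rabs_mult a2), (Rabs_mult a3).
pose proof (Rabs_pos a1). pose proof (Rabs_pos a2). pose proof (Rabs_pos a3).
apply Rmult_le_compat_l with (r := Rabs a1) in E1; auto.
apply Rmult_le_compat_l with (r := Rabs a2) in E2; auto.
apply Rmult_le_compat_l with (r := Rabs a3) in E3; auto.
assert (Rabs a1 * (e / 2 / A * Rabs (y - z)) + Rabs a2 * (e / 2 / A * Rabs (y - z))
   + Rabs a3 * (e / 2 / A * Rabs (y - z)) <= e / 2 * Rabs (y - z)).
{ replace (e / 2 * Rabs (y - z)) with (A * (e / 2 / A * Rabs (y - z))) by (field; lra).
  assert (0 <= e / 2 / A * Rabs (y - z)) by (apply Rmult_le_pos; lra). unfold A at 4. nra. }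
assert (e / 2 / M * (Rabs (g1 y - g1 z) + Rabs (g2 y - g2 z) + Rabs (g3 y - g3 z))
  <= e / 2 * Rabs (y - z)).
{ replace (e / 2 * Rabs (y - z)) with (e / 2 / M * (M * Rabs (y - z))) by (field; lra).
  apply Rmult_le_compat_l; [lra|]. unfold M; lra. }
lra.
Qed.

Lemma cont3_comp (f g1 g2 g3 : R -> R -> R -> R) (x q t : R) :
  cont3 f (g1 x q t) (g2 x q t) (g3 x q t) ->
  cont3 g1 x q t -> cont3 g2 x q t -> cont3 g3 x q t ->
  cont3 (fun x q t => f (g1 x q t) (g2 x q t) (g3 x q t)) x q t.
Proof.
intros Hf H1 H2 H3. apply cont3_eps. intros e He.
destruct (proj1 (cont3_eps _ _ _ _) Hf e He) as [d [Hd K]].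
destruct (proj1 (cont3_eps _ _ _ _) H1 d Hd) as [r1 [R1 K1]].
destruct (proj1 (cont3_eps _ _ _ _) H2 d Hd) as [r2 [R2 K2]].
destruct (proj1 (cont3_eps _ _ _ _) H3 d Hd) as [r3 [R3 K3]].
exists (Rmin (Rmin r1 r2) r3). split; [repeat apply Rmin_pos; auto|].
intros x' q' t' A B C. repeat split_Rmin. apply K; auto.
Qed.

Lemma cont3_comp1 (f : R -> R) (g : R -> R -> R -> R) (x q t : R) :
  continuous f (g x q t) -> cont3 g x q t ->
  cont3 (fun x q t => f (g x q t)) x q t.
Proof.
intros Hf Hg.
apply (continuous_comp (fun p : R * R * R => g (fst (fst p)) (snd (fst p)) (snd p)) f); auto.
Qed.

Lemma cont3_plus (f g : R -> R -> R -> R) (x q t : R) :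
  cont3 f x q t -> cont3 g x q t -> cont3 (fun x q t => f x q t + g x q t) x q t.
Proof. apply (@continuous_plus _ _ R_NormedModule). Qed.

Lemma cont3_mult (f g : R -> R -> R -> R) (x q t : R) :
  cont3 f x q t -> cont3 g x q t -> cont3 (fun x q t => f x q t * g x q t) x q t.
Proof. apply continuous_mult_R. Qed.

Lemma cont3_const (c x q t : R) : cont3 (fun _ _ _ => c) x q t.
Proof. apply continuous_const. Qed.

Lemma cont3_x (x q t : R) : cont3 (fun x _ _ => x) x q t.
Proof. apply cont3_eps; intros e He; exists e; auto. Qed.

Lemma cont3_q (x q t : R) : cont3 (fun _ q _ => q) x q t.
Proof. apply cont3_eps; intros e He; exists e; auto. Qed.

Lemma cont3_t (x q t : R) : cont3 (fun _ _ t => t) x q t.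
Proof. apply cont3_eps; intros e He; exists e; auto. Qed.

Lemma cont3_ext_loc (f g : R -> R -> R -> R) (d x q t : R) :
  (forall x q t, Rabs q < d -> f x q t = g x q t) -> Rabs q < d ->
  cont3 f x q t -> cont3 g x q t.
Proof.
intros E Hq H. apply cont3_eps. intros e He.
destruct (proj1 (cont3_eps _ _ _ _) H e He) as [r [Hr K]].
exists (Rmin r (d - Rabs q)). split; [apply Rmin_pos; lra|].
intros x' q' t' A B C. repeat split_Rmin.
rewrite <- !E; auto.
generalize (Rabs_triang (q' - q) q). replace (q' - q + q) with q' by ring. lra.
Qed.

Lemma cont3_slice (f : R -> R -> R -> R) (g1 g2 g3 : R -> R) (z : R) :
  cont3 f (g1 z) (g2 z) (g3 z) -> continuous g1 z -> continuous g2 z -> continuous g3 z ->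
  continuous (fun w => f (g1 w) (g2 w) (g3 w)) z.
Proof.
intros H C1 C2 C3.
apply (filterlim_comp _ _ _ (fun w => (g1 w, g2 w, g3 w))
  (fun p : R * R * R => f (fst (fst p)) (snd (fst p)) (snd p)) _
  (locally (g1 z, g2 z, g3 z)) _); [|exact H].
intros P [e He].
destruct (proj1 (filterlim_locally _ _) C1 e) as [r1 K1].
destruct (proj1 (filterlim_locally _ _) C2 e) as [r2 K2].
destruct (proj1 (filterlim_locally _ _) C3 e) as [r3 K3].
exists (mkposreal _ (Rmin_pos _ _ (Rmin_pos _ _ (cond_pos r1) (cond_pos r2)) (cond_pos r3))).
intros w Hw. apply He. unfold ball in Hw; simpl in Hw. unfold AbsRing_ball in Hw.
repeat split_Rmin. repeat split; [apply K1 | apply K2 | apply K3]; assumption.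
Qed.

Lemma Cs_cont (d : R) (k : nat) (f : R -> R -> R -> R) (x q t : R) :
  Cs d k f -> Rabs q < d -> cont3 f x q t.
Proof. destruct k; intros [H _]; auto. Qed.

Lemma Cs_pred (d : R) (k : nat) (f : R -> R -> R -> R) : Cs d (S k) f -> Cs d k f.
Proof.
revert f; induction k; intros f [H [fx [fq [ft [P [A [B C]]]]]]].
- split; auto.
- split; auto. exists fx, fq, ft. auto.
Qed.

Lemma Cs_le (d : R) (j k : nat) (f : R -> R -> R -> R) :
  (j <= k)%nat -> Cs d k f -> Cs d j f.
Proof. induction 1; auto. intros H1. apply IHle, Cs_pred, H1. Qed.

Lemma Cs_sub (d d' : R) (k : nat) (f : R -> R -> R -> R) :
  d' <= d -> Cs d k f -> Cs d' k f.
Proof.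
intros Hd; revert f; induction k; intros f.
- intros [H _]; split; auto. intros; apply H; lra.
- intros [H [fx [fq [ft [P [A [B C]]]]]]]. split. intros; apply H; lra.
  exists fx, fq, ft. split; auto. intros; apply P; lra.
Qed.

Lemma Rabs_lt_locally (d q : R) : Rabs q < d -> locally q (fun z => Rabs z < d).
Proof.
intros H. exists (mkposreal (d - Rabs q) (proj2 (Rlt_0_minus _ _) H)). intros z Hz.
change (Rabs (z - q) < d - Rabs q) in Hz. generalize (Rabs_triang (z - q) q). replace (z - q + q) with (z : R) by (unfold Rminus; rewrite Rplus_assoc, Rplus_opp_l; apply eq_sym, Rplus_0_r). lra.
Qed.

Lemma partials_ext (f g fx fq ft : R -> R -> R -> R) (d x q t : R) :
  (forall x q t, Rabs q < d -> f x q t = g x q t) -> Rabs q < d ->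
  partials f fx fq ft x q t -> partials g fx fq ft x q t.
Proof.
intros E Hq (A & B & C). split; [|split].
- eapply is_derive_ext; [|exact A]. intros; simpl; auto.
- eapply is_derive_ext_loc; [|exact B].
  generalize (Rabs_lt_locally d q Hq). apply filter_imp. auto.
- eapply is_derive_ext; [|exact C]. intros; simpl; auto.
Qed.

Lemma Cs_ext (d : R) (k : nat) (f g : R -> R -> R -> R) :
  (forall x q t, Rabs q < d -> f x q t = g x q t) -> Cs d k f -> Cs d k g.
Proof.
intros E H. destruct k.
- destruct H as [H _]; split; auto. intros; eapply cont3_ext_loc; eauto.
- destruct H as [H [fx [fq [ft [P [A [B C]]]]]]]. split.
  + intros; eapply cont3_ext_loc; eauto.
  + exists fx, fq, ft. split; auto. intros; eapply partials_ext; eauto.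
Qed.

Definition Dx (f : R -> R -> R -> R) x q t := Derive (fun z => f z q t) x.
Definition Dq (f : R -> R -> R -> R) x q t := Derive (fun z => f x z t) q.
Definition Dt (f : R -> R -> R -> R) x q t := Derive (fun z => f x q z) t.

Lemma partials_D (f fx fq ft : R -> R -> R -> R) (x q t : R) :
  partials f fx fq ft x q t ->
  fx x q t = Dx f x q t /\ fq x q t = Dq f x q t /\ ft x q t = Dt f x q t.
Proof.
intros (A & B & C).
(split; [|split]); symmetry; apply is_derive_unique; assumption.
Qed.

(** Replaces the existential partial derivatives of [Cs] by the canonical functions [Dx f], [Dq f],
    [Dt f], which can then be named and combined. *)
Lemma Cs_D (d : R) (k : nat) (f : R -> R -> R -> R) :
  Cs d (S k) f ->
  (forall x q t, Rabs q < d -> partials f (Dx f) (Dq f) (Dt f) x q t) /\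
  Cs d k (Dx f) /\ Cs d k (Dq f) /\ Cs d k (Dt f).
Proof.
intros [H [fx [fq [ft [P [A [B C]]]]]]]. split; [|split; [|split]].
- intros x q t Hq. destruct (partials_D _ _ _ _ _ _ _ (P x q t Hq)) as (E1 & E2 & E3).
  destruct (P x q t Hq) as (P1 & P2 & P3). (split; [|split]); congruence.
- eapply Cs_ext; [|exact A]; intros; apply (partials_D _ _ _ _ _ _ _ (P _ _ _ H0)).
- eapply Cs_ext; [|exact B]; intros; apply (partials_D _ _ _ _ _ _ _ (P _ _ _ H0)).
- eapply Cs_ext; [|exact C]; intros; apply (partials_D _ _ _ _ _ _ _ (P _ _ _ H0)).
Qed.

(** Differentiability with continuous partials gives continuity of [f], so later constructions have
    to supply only the partial derivatives. *)
Lemma Cs_S (d : R) (k : nat) (f fx fq ft : R -> R -> R -> R) :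
  (forall x q t, Rabs q < d -> partials f fx fq ft x q t) ->
  Cs d k fx -> Cs d k fq -> Cs d k ft -> Cs d (S k) f.
Proof.
intros P A B C. split; [|exists fx, fq, ft; auto].
intros x q t Hq.
assert (Ka := Cs_cont _ _ _ x q t A Hq). assert (Kb := Cs_cont _ _ _ x q t B Hq).
assert (Kc := Cs_cont _ _ _ x q t C Hq).
apply cont3_eps. intros e He.
destruct (differentiable3 f fx fq ft d x q t P Hq Ka Kb Kc 1 Rlt_0_1) as [r [Hr K]].
set (M := 3 + Rabs (fx x q t) + Rabs (fq x q t) + Rabs (ft x q t)).
pose proof (Rabs_pos (fx x q t)) as N1. pose proof (Rabs_pos (fq x q t)) as N2.
pose proof (Rabs_pos (ft x q t)) as N3.
assert (HM : 0 < M) by (unfold M; lra).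
exists (Rmin r (e / M)). split; [apply Rmin_pos; auto; apply Rdiv_lt_0_compat; lra|].
intros x' q' t' X Q T. repeat split_Rmin.
specialize (K x' q' t'). 
assert (K' := K ltac:(assumption) ltac:(assumption) ltac:(assumption)). clear K.
pose proof (Rabs_pos (x' - x)). pose proof (Rabs_pos (q' - q)). pose proof (Rabs_pos (t' - t)).
replace (f x' q' t' - f x q t) with
 ((f x' q' t' - f x q t - (fx x q t * (x' - x) + fq x q t * (q' - q) + ft x q t * (t' - t)))
  + fx x q t * (x' - x) + fq x q t * (q' - q) + ft x q t * (t' - t)) by ring.
eapply Rle_lt_trans; [apply Rabs_triang|].
eapply Rle_lt_trans; [apply Rplus_le_compat_r; apply Rabs_triang|].
eapply Rle_lt_trans; [apply Rplus_le_compat_r; apply Rplus_le_compat_r; apply Rabs_triang|].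
rewrite (Rabs_mult (fx x q t)), (Rabs_mult (fq x q t)), (Rabs_mult (ft x q t)).
set (m := Rmax (Rabs (x' - x)) (Rmax (Rabs (q' - q)) (Rabs (t' - t)))).
assert (M1 : Rabs (x' - x) <= m) by apply Rmax_l.
assert (M2 : Rabs (q' - q) <= m) by (unfold m; eapply Rle_trans; [|apply Rmax_r]; apply Rmax_l).
assert (M3 : Rabs (t' - t) <= m) by (unfold m; eapply Rle_trans; [|apply Rmax_r]; apply Rmax_r).
assert (M4 : m < e / M) by (unfold m; repeat apply Rmax_lub_lt; assumption).
apply Rle_lt_trans with (M * m).
- unfold M. nra.
- apply Rmult_lt_compat_l with (r := M) in M4; auto.
  replace (M * (e / M)) with e in M4 by (field; lra). exact M4.
Qed.

Lemma Cs_const (d : R) (k : nat) (c : R) : Cs d k (fun _ _ _ => c).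
Proof.
revert c; induction k; intros c.
- split; auto. intros; apply cont3_const.
- eapply Cs_S; [|apply (IHk 0)|apply (IHk 0)|apply (IHk 0)].
  intros; (split; [|split]); apply is_derive_const_R.
Qed.

Lemma Cs_x (d : R) (k : nat) : Cs d k (fun x _ _ => x).
Proof.
destruct k.
- split; auto. intros; apply cont3_x.
- eapply Cs_S; [|apply (Cs_const d k 1)|apply (Cs_const d k 0)|apply (Cs_const d k 0)].
  intros; (split; [|split]); solve [apply is_derive_const_R | apply is_derive_id_R].
Qed.

Lemma Cs_q (d : R) (k : nat) : Cs d k (fun _ q _ => q).
Proof.
destruct k.
- split; auto. intros; apply cont3_q.
- eapply Cs_S; [|apply (Cs_const d k 0)|apply (Cs_const d k 1)|apply (Cs_const d k 0)].
  intros; (split; [|split]); solve [apply is_derive_const_R | apply is_derive_id_R].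
Qed.

Lemma Cs_t (d : R) (k : nat) : Cs d k (fun _ _ t => t).
Proof.
destruct k.
- split; auto. intros; apply cont3_t.
- eapply Cs_S; [|apply (Cs_const d k 0)|apply (Cs_const d k 0)|apply (Cs_const d k 1)].
  intros; (split; [|split]); solve [apply is_derive_const_R | apply is_derive_id_R].
Qed.

Lemma Cs_plus (d : R) (k : nat) (f g : R -> R -> R -> R) :
  Cs d k f -> Cs d k g -> Cs d k (fun x q t => f x q t + g x q t).
Proof.
revert f g; induction k; intros f g.
- intros [H _] [H' _]; split; auto. intros; apply cont3_plus; auto.
- intros F G. apply Cs_D in F. apply Cs_D in G.
  destruct F as (P & A & B & C). destruct G as (P' & A' & B' & C').
  eapply Cs_S; [| apply (IHk _ _ A A') | apply (IHk _ _ B B') | apply (IHk _ _ C C')].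
  intros x q t Hq. destruct (P x q t Hq) as (X & Q & T).
  destruct (P' x q t Hq) as (X' & Q' & T').
  split; [|split].
  + apply (is_derive_plus_R (fun z => f z q t) (fun z => g z q t)); auto.
  + apply (is_derive_plus_R (fun z => f x z t) (fun z => g x z t)); auto.
  + apply (is_derive_plus_R (fun z => f x q z) (fun z => g x q z)); auto.
Qed.

Lemma Cs_mult (d : R) (k : nat) (f g : R -> R -> R -> R) :
  Cs d k f -> Cs d k g -> Cs d k (fun x q t => f x q t * g x q t).
Proof.
revert f g; induction k; intros f g.
- intros [H _] [H' _]; split; auto. intros; apply cont3_mult; auto.
- intros F G. assert (F0 := Cs_pred _ _ _ F). assert (G0 := Cs_pred _ _ _ G).
  apply Cs_D in F. apply Cs_D in G.
  destruct F as (P & A & B & C). destruct G as (P' & A' & B' & C').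
  eapply Cs_S; [| apply (Cs_plus _ _ _ _ (IHk _ _ A G0) (IHk _ _ F0 A'))
   | apply (Cs_plus _ _ _ _ (IHk _ _ B G0) (IHk _ _ F0 B'))
   | apply (Cs_plus _ _ _ _ (IHk _ _ C G0) (IHk _ _ F0 C'))].
  intros x q t Hq. destruct (P x q t Hq) as (X & Q & T).
  destruct (P' x q t Hq) as (X' & Q' & T').
  split; [|split].
  + apply (is_derive_mult_R (fun z => f z q t) (fun z => g z q t)); auto; apply Rmult_comm.
  + apply (is_derive_mult_R (fun z => f x z t) (fun z => g x z t)); auto; apply Rmult_comm.
  + apply (is_derive_mult_R (fun z => f x q z) (fun z => g x q z)); auto; apply Rmult_comm.
Qed.

Lemma Cs_scal (d : R) (k : nat) (c : R) (f : R -> R -> R -> R) :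
  Cs d k f -> Cs d k (fun x q t => c * f x q t).
Proof. intros; apply Cs_mult; auto. apply Cs_const. Qed.

Lemma Cs_opp (d : R) (k : nat) (f : R -> R -> R -> R) :
  Cs d k f -> Cs d k (fun x q t => - f x q t).
Proof.
intros H; apply (Cs_scal _ _ (-1)) in H. eapply Cs_ext; [|exact H]. intros; simpl; ring.
Qed.

Lemma Cs_minus (d : R) (k : nat) (f g : R -> R -> R -> R) :
  Cs d k f -> Cs d k g -> Cs d k (fun x q t => f x q t - g x q t).
Proof. intros; apply Cs_plus; auto. apply Cs_opp; auto. Qed.

Lemma Cs_pow (d : R) (k n : nat) (f : R -> R -> R -> R) :
  Cs d k f -> Cs d k (fun x q t => f x q t ^ n).
Proof.
intros H; induction n.
- apply (Cs_const d k 1).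
- apply (Cs_mult _ _ _ _ H IHn).
Qed.

Lemma Cs_inv (d : R) (k : nat) (f : R -> R -> R -> R) :
  (forall x q t, Rabs q < d -> f x q t <> 0) ->
  Cs d k f -> Cs d k (fun x q t => / f x q t).
Proof.
intros N; induction k.
- intros [H _]; split; auto. intros. apply (cont3_comp1 Rinv); auto.
  apply derivable_continuous_R. auto_derive. auto.
- intros F. assert (G := IHk (Cs_pred _ _ _ F)). apply Cs_D in F.
  destruct F as (P & A & B & C).
  assert (L : forall h, Cs d k h -> Cs d k (fun x q t => - (h x q t * (/ f x q t * / f x q t)))).
  { intros; apply Cs_opp; repeat apply Cs_mult; auto. }
  eapply Cs_S; [| apply (L _ A) | apply (L _ B) | apply (L _ C)].
  intros x q t Hq. destruct (P x q t Hq) as (X & Q & T). specialize (N x q t Hq).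
  assert (S : forall g z l, g z = f x q t -> is_derive g z l ->
      is_derive (fun w => / g w) z (- (l * (/ f x q t * / f x q t)))).
  { intros g z l E HD.
    replace (- (l * (/ f x q t * / f x q t))) with (- l / (g z) ^ 2).
    apply is_derive_inv; auto; congruence. rewrite E; field; auto. }
  split; [|split]; [apply (S (fun z => f z q t)) | apply (S (fun z => f x z t)) | apply (S (fun z => f x q z))]; auto.
Qed.

Lemma Cs_div (d : R) (k : nat) (f g : R -> R -> R -> R) :
  (forall x q t, Rabs q < d -> g x q t <> 0) ->
  Cs d k f -> Cs d k g -> Cs d k (fun x q t => f x q t / g x q t).
Proof. intros N A B; apply Cs_mult; auto. apply Cs_inv; auto. Qed.

Lemma is_derive_Rpower (g : R -> R) (z l a : R) :
  0 < g z -> is_derive g z l ->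
  is_derive (fun w => Rpower (g w) a) z (a * Rpower (g z) (a - 1) * l).
Proof.
intros P H. rewrite Rmult_comm.
apply (is_derive_comp (fun y => Rpower y a) g z); auto.
apply is_derive_Reals. apply derivable_pt_lim_power. exact P.
Qed.

(** The induction carries all exponents at once, because differentiation replaces [a] by [a - 1]. *)
Lemma Cs_Rpower (d : R) (k : nat) (f : R -> R -> R -> R) (a : R) :
  (forall x q t, Rabs q < d -> 0 < f x q t) ->
  Cs d k f -> Cs d k (fun x q t => Rpower (f x q t) a).
Proof.
intros N; revert a; induction k; intros a.
- intros [H _]; split; auto. intros. apply (cont3_comp1 (fun y => Rpower y a)); auto.
  apply derivable_continuous_R.
  eexists. apply (is_derive_Rpower (fun y => y)). auto. apply is_derive_id_R.
- intros F. assert (G := fun b => IHk b (Cs_pred _ _ _ F)). apply Cs_D in F.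
  destruct F as (P & A & B & C).
  assert (L : forall h, Cs d k h -> Cs d k (fun x q t => a * Rpower (f x q t) (a - 1) * h x q t)).
  { intros; apply Cs_mult; auto; apply Cs_scal; auto. }
  eapply Cs_S; [| apply (L _ A) | apply (L _ B) | apply (L _ C)].
  intros x q t Hq. destruct (P x q t Hq) as (X & Q & T). specialize (N x q t Hq).
  split; [|split].
  + apply (is_derive_Rpower (fun z => f z q t)); auto.
  + apply (is_derive_Rpower (fun z => f x z t)); auto.
  + apply (is_derive_Rpower (fun z => f x q z)); auto.
Qed.

Lemma Cs_sqrt (d : R) (k : nat) (f : R -> R -> R -> R) :
  (forall x q t, Rabs q < d -> 0 < f x q t) ->
  Cs d k f -> Cs d k (fun x q t => sqrt (f x q t)).
Proof.
intros N H. apply (Cs_Rpower _ _ _ (/ 2)) in H; auto.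
eapply Cs_ext; [|exact H]. intros; simpl; apply Rpower_sqrt; auto.
Qed.

Lemma Cs_comp (d d' : R) (k : nat) (f g1 g2 g3 : R -> R -> R -> R) :
  (forall x q t, Rabs q < d -> Rabs (g2 x q t) < d') ->
  Cs d' k f -> Cs d k g1 -> Cs d k g2 -> Cs d k g3 ->
  Cs d k (fun x q t => f (g1 x q t) (g2 x q t) (g3 x q t)).
Proof.
intros N; revert f; induction k; intros f.
- intros [F _] [G1 _] [G2 _] [G3 _]; split; auto. intros; apply cont3_comp; auto.
- intros F G1 G2 G3.
  assert (H1 := Cs_pred _ _ _ G1). assert (H2 := Cs_pred _ _ _ G2).
  assert (H3 := Cs_pred _ _ _ G3).
  apply Cs_D in F. apply Cs_D in G1. apply Cs_D in G2. apply Cs_D in G3.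
  destruct F as (P & A & B & C). destruct G1 as (P1 & A1 & B1 & C1).
  destruct G2 as (P2 & A2 & B2 & C2). destruct G3 as (P3 & A3 & B3 & C3).
  assert (L : forall h1 h2 h3, Cs d k h1 -> Cs d k h2 -> Cs d k h3 -> Cs d k (fun x q t =>
    Dx f (g1 x q t) (g2 x q t) (g3 x q t) * h1 x q t + Dq f (g1 x q t) (g2 x q t) (g3 x q t) * h2 x q t
    + Dt f (g1 x q t) (g2 x q t) (g3 x q t) * h3 x q t)).
  { intros. apply Cs_plus; [apply Cs_plus|]; apply Cs_mult; auto. }
  eapply Cs_S; [| apply (L _ _ _ A1 A2 A3) | apply (L _ _ _ B1 B2 B3) | apply (L _ _ _ C1 C2 C3)].
  intros x q t Hq. destruct (P1 x q t Hq) as (X1 & Q1 & T1).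
  destruct (P2 x q t Hq) as (X2 & Q2 & T2). destruct (P3 x q t Hq) as (X3 & Q3 & T3).
  specialize (N x q t Hq).
  assert (Ka := Cs_cont _ _ _ (g1 x q t) (g2 x q t) (g3 x q t) A N).
  assert (Kb := Cs_cont _ _ _ (g1 x q t) (g2 x q t) (g3 x q t) B N).
  assert (Kc := Cs_cont _ _ _ (g1 x q t) (g2 x q t) (g3 x q t) C N).
  split; [|split].
  + apply (is_derive_comp3 f (Dx f) (Dq f) (Dt f) d' (fun z => g1 z q t) (fun z => g2 z q t) (fun z => g3 z q t)); auto.
  + apply (is_derive_comp3 f (Dx f) (Dq f) (Dt f) d' (fun z => g1 x z t) (fun z => g2 x z t) (fun z => g3 x z t)); auto.
  + apply (is_derive_comp3 f (Dx f) (Dq f) (Dt f) d' (fun z => g1 x q z) (fun z => g2 x q z) (fun z => g3 x q z)); auto.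
Qed.

Lemma Ck_Derive (k : nat) (f : R -> R) :
  Ck (S k) f -> (forall x, is_derive f x (Derive f x)) /\ Ck k (Derive f).
Proof.
intros [A B].
assert (E : forall j x, Derive_n (Derive f) j x = Derive_n f (S j) x).
{ intros j x. replace (S j) with (j + 1)%nat by lia. rewrite <- (Derive_n_comp f j 1 x).
  apply Derive_n_ext. reflexivity. }
split; [|split].
- intros x. apply Derive_correct. apply (A 1%nat). lia.
- intros j x Hj. destruct j. exact I.
  assert (H := A (S (S j)) x ltac:(lia)).
  simpl in H |- *. eapply ex_derive_ext; [|exact H]. intros; symmetry; apply E.
- intros x. eapply continuous_ext; [|apply B]. intros; symmetry; apply E.
Qed.

Lemma Cs_lift (d : R) (k : nat) (f : R -> R) : Ck k f -> Cs d k (fun x _ _ => f x).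
Proof.
revert f; induction k; intros f H.
- split; auto. intros. apply (cont3_comp1 f). apply H. apply cont3_x.
- apply Ck_Derive in H. destruct H as [A B].
  eapply Cs_S; [|apply (IHk _ B)|apply (Cs_const d k 0)|apply (Cs_const d k 0)].
  intros; (split; [|split]); auto; apply is_derive_const_R.
Qed.

(** [g] is assumed only continuous, and its differentiability is a conclusion. The free inner
    functions [a], [c] and right-hand side [r] let one statement yield all three partial derivatives
    of an inverse function. *)
Lemma is_derive_implicit (f fx fq ft : R -> R -> R -> R) (d : R) (a g c r : R -> R)
    (z la lc lr : R) :
  (forall x q t, Rabs q < d -> partials f fx fq ft x q t) -> Rabs (g z) < d ->
  cont3 fx (a z) (g z) (c z) -> cont3 fq (a z) (g z) (c z) ->
  cont3 ft (a z) (g z) (c z) -> fq (a z) (g z) (c z) <> 0 ->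
  is_derive a z la -> is_derive c z lc -> is_derive r z lr -> continuous g z ->
  locally z (fun w => f (a w) (g w) (c w) = r w) ->
  is_derive g z ((lr - fx (a z) (g z) (c z) * la - ft (a z) (g z) (c z) * lc)
                 / fq (a z) (g z) (c z)).
Proof.
intros Hp Hg Cx Cq Ct Nz Da Dc Dr Cg Eq.
set (f2 := fq (a z) (g z) (c z)) in *.
set (n := lr - fx (a z) (g z) (c z) * la - ft (a z) (g z) (c z) * lc).
set (rho := fun w => r w - f (a w) (g z) (c w)).
assert (Dg := @is_derive_const R_AbsRing R_NormedModule (g z) z).
assert (Drho : is_derive rho z n).
{ replace n with (lr - (fx (a z) (g z) (c z) * la + f2 * 0 + ft (a z) (g z) (c z) * lc))
    by (unfold n; ring).
  apply is_derive_minus_R; auto.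
  exact (is_derive_comp3 f fx fq ft d a (fun _ => g z) c z la 0 lc Hp Hg Cx Cq Ct Da Dg Dc). }
assert (Hf2 : 0 < Rabs f2) by (apply Rabs_pos_lt; exact Nz).
assert (Hn := Rabs_pos n).
(* By the mean value theorem, [rho w = fq (a w) m (c w) * (g w - g z)] for some [m]
   between [g z] and [g w]. *)
assert (MV : forall e, 0 < e -> locally z (fun w =>
    Rabs (rho w - f2 * (g w - g z)) <= e * Rabs (g w - g z))).
{ intros e He. destruct (proj1 (cont3_eps _ _ _ _) Cq e He) as [p [Hp0 K]].
  assert (Hp1 : 0 < Rmin p (d - Rabs (g z))) by (apply Rmin_pos; lra).
  generalize (filter_and _ _ Eq (filter_and _ _
    (proj1 (filterlim_locally _ _) Cg (mkposreal _ Hp1))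
    (filter_and _ _
      (proj1 (filterlim_locally _ _) (ex_derive_continuous _ _ (ex_intro _ la Da)) (mkposreal _ Hp0))
      (proj1 (filterlim_locally _ _) (ex_derive_continuous _ _ (ex_intro _ lc Dc)) (mkposreal _ Hp0))))).
  apply filter_imp. intros w (E & Bg & Ba & Bc).
  change (Rabs (g w - g z) < Rmin p (d - Rabs (g z))) in Bg. split_Rmin.
  unfold rho. rewrite <- E.
  apply (mvt_linear_bound (fun y => f (a w) y (c w)) (fun y => fq (a w) y (c w))).
  - intros y Hy. refine (partials_q _ _ _ _ _ _ _ (Hp _ _ _ _)).
    apply (between_abs _ _ _ (d - Rabs (g z))) in Hy; auto.
    generalize (Rabs_triang (y - g z) (g z)). replace (y - g z + g z) with y by ring. lra.
  - intros y Hy. apply (between_abs _ _ _ p) in Hy; auto. left. apply K; auto. }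
apply is_derive_eps. intros e He.
(* [k] is a Lipschitz constant of [g] at [z]: half of [Rabs f2 * Rabs dg] is absorbed on the left.
   The total error [e * Rabs f2] is shared between [e2] and [e1 * k]. *)
set (k := 2 * (Rabs n + 1) / Rabs f2).
assert (Hk : 0 < k) by (apply Rdiv_lt_0_compat; lra).
set (e1 := e * Rabs f2 / (2 * k)). set (e2 := e * Rabs f2 / 2).
assert (He1 : 0 < Rmin (Rabs f2 / 2) e1).
{ apply Rmin_pos; [lra|]. apply Rdiv_lt_0_compat; [apply Rmult_lt_0_compat|]; lra. }
assert (He2 : 0 < e2) by (apply Rdiv_lt_0_compat; [apply Rmult_lt_0_compat|]; lra).
destruct (MV _ He1) as [p1 M1]. destruct (is_derive_lip _ _ _ Drho) as [p2 [P2 M2]].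
destruct (proj1 (is_derive_eps _ _ _) Drho _ He2) as [p3 [P3 M3]].
exists (Rmin p1 (Rmin p2 p3)). split; [repeat apply Rmin_pos; auto using cond_pos|].
intros w Hw. repeat split_Rmin.
specialize (M1 w ltac:(assumption)). specialize (M2 w ltac:(assumption)).
specialize (M3 w ltac:(assumption)).
replace (rho z) with 0 in M2, M3 by (unfold rho; rewrite <- (locally_singleton _ _ Eq); ring).
rewrite Rminus_0_r in M2, M3.
set (dg := g w - g z) in *. set (dz := w - z) in *.
pose proof (Rabs_pos dg). pose proof (Rabs_pos dz).
assert (T := Rabs_triang (rho w) (- (rho w - f2 * dg))). rewrite Rabs_Ropp in T.
replace (rho w + - (rho w - f2 * dg)) with (f2 * dg) in T by ring. rewrite Rabs_mult in T.
assert (A1 : Rmin (Rabs f2 / 2) e1 * Rabs dg <= Rabs f2 / 2 * Rabs dg)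
  by (apply Rmult_le_compat_r; [assumption|apply Rmin_l]).
assert (A2 : Rmin (Rabs f2 / 2) e1 * Rabs dg <= e1 * Rabs dg)
  by (apply Rmult_le_compat_r; [assumption|apply Rmin_r]).
assert (Bg : Rabs dg <= k * Rabs dz).
{ apply Rmult_le_reg_l with (Rabs f2 / 2); [lra|].
  replace (Rabs f2 / 2 * (k * Rabs dz)) with ((Rabs n + 1) * Rabs dz) by (unfold k; field; lra). lra. }
assert (A3 : e1 * Rabs dg <= e2 * Rabs dz).
{ replace (e2 * Rabs dz) with (e1 * (k * Rabs dz)) by (unfold e1, e2; field; lra).
  apply Rmult_le_compat_l; auto. unfold e1. left. apply Rdiv_lt_0_compat; [apply Rmult_lt_0_compat|]; lra. }
apply Rmult_le_reg_l with (Rabs f2); auto. rewrite <- Rabs_mult.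
replace (f2 * (dg - n / f2 * dz)) with ((rho w - n * dz) + - (rho w - f2 * dg)) by (field; exact Nz).
eapply Rle_trans; [apply Rabs_triang|]. rewrite Rabs_Ropp. unfold e2 in *. lra.
Qed.

(** Compactness of a box in gauge form: a radius [r] with [P x y z r] is chosen at each point,
    finitely many of these neighbourhoods cover the box, and [d] is a lower bound of their radii. *)
Lemma compact_box3 (P : R -> R -> R -> posreal -> Prop) (a1 b1 a2 b2 a3 b3 : R) :
  (forall x y z, a1 <= x <= b1 -> a2 <= y <= b2 -> a3 <= z <= b3 -> exists r, P x y z r) ->
  exists d : posreal, forall x' y' z',
    a1 <= x' <= b1 -> a2 <= y' <= b2 -> a3 <= z' <= b3 ->
    exists x y z r, P x y z r /\ Rabs (x' - x) < r /\ Rabs (y' - y) < r /\ Rabs (z' - z) < r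
      /\ d <= r.
Proof.
intros H.
assert (H' : forall p : R * (R * (R * unit)), exists r : posreal,
  a1 <= fst p <= b1 -> a2 <= fst (snd p) <= b2 -> a3 <= fst (snd (snd p)) <= b3 ->
  P (fst p) (fst (snd p)) (fst (snd (snd p))) r).
{ intros p.
  destruct (classic (a1 <= fst p <= b1 /\ a2 <= fst (snd p) <= b2 /\
     a3 <= fst (snd (snd p)) <= b3)) as [(A & B & C)|N].
  - destruct (H _ _ _ A B C) as [r Hr]. exists r; auto.
  - exists (mkposreal 1 Rlt_0_1). intros; exfalso; auto. }
set (delta := fun p => proj1_sig (constructive_indefinite_description _ (H' p))).
assert (Hd : forall p, a1 <= fst p <= b1 -> a2 <= fst (snd p) <= b2 ->
  a3 <= fst (snd (snd p)) <= b3 -> P (fst p) (fst (snd p)) (fst (snd (snd p))) (delta p)).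
{ intros p. unfold delta. destruct constructive_indefinite_description. auto. }
destruct (compactness_value 3 (a1, (a2, (a3, tt))) (b1, (b2, (b3, tt))) delta) as [d K].
exists d. intros x' y' z' X Y Z.
destruct (NNPP _ (K (x', (y', (z', tt))) (conj X (conj Y (conj Z I)))))
  as [[x [y [z u]]] [(B1 & B2 & B3 & _) [(C1 & C2 & C3 & _) D]]].
exists x, y, z, (delta (x, (y, (z, u)))). split; [|auto].
apply (Hd (x, (y, (z, u)))); assumption.
Qed.

Lemma cont3_bounded_box (f : R -> R -> R -> R) (a1 b1 a2 b2 a3 b3 : R) :
  (forall x y z, a1 <= x <= b1 -> a2 <= y <= b2 -> a3 <= z <= b3 -> cont3 f x y z) ->
  exists K, 0 < K /\ forall x y z, a1 <= x <= b1 -> a2 <= y <= b2 -> a3 <= z <= b3 ->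
    Rabs (f x y z) <= K.
Proof.
intros H.
(* Shrinking the gauge to at most [/ (Rabs f + 1)] turns the uniform bound [d <= r] into the bound
   [/ d] on [f]. *)
destruct (compact_box3 (fun x y z r => r <= / (Rabs (f x y z) + 1) /\ forall x' y' z',
   Rabs (x' - x) < r -> Rabs (y' - y) < r -> Rabs (z' - z) < r ->
   Rabs (f x' y' z' - f x y z) < 1) a1 b1 a2 b2 a3 b3) as [d K].
- intros x y z X Y Z.
  destruct (proj1 (cont3_eps _ _ _ _) (H x y z X Y Z) 1 Rlt_0_1) as [r [Hr L]].
  pose proof (Rabs_pos (f x y z)).
  assert (Hr' : 0 < Rmin r (/ (Rabs (f x y z) + 1))).
  { apply Rmin_pos; auto. apply Rinv_0_lt_compat; lra. }
  exists (mkposreal _ Hr'); simpl. split. apply Rmin_r.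
  intros; repeat split_Rmin; apply L; auto.
- exists (/ d). split. apply Rinv_0_lt_compat, cond_pos.
  intros x' y' z' X Y Z.
  destruct (K x' y' z' X Y Z) as (x & y & z & r & (R1 & R2) & A & B & C & D).
  specialize (R2 x' y' z' A B C). pose proof (Rabs_pos (f x y z)).
  apply Rle_trans with (Rabs (f x y z) + 1).
  + generalize (Rabs_triang (f x' y' z' - f x y z) (f x y z)).
    replace (f x' y' z' - f x y z + f x y z) with (f x' y' z') by ring. lra.
  + rewrite <- (Rinv_inv (Rabs (f x y z) + 1)). apply Rinv_le_contravar.
    apply cond_pos. lra.
Qed.


(** * Weighted averages and Hadamard's lemma *)

(** Weighted mean of [f] along the segment from [0] to [q]: [q ^ S m] times it is the integral of
    [z ^ m * f x z t] from [0] to [q]. Used in place of a quotient by [q ^ S m], it is regular at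
    [q = 0]. *)
Definition avg (m : nat) (f : R -> R -> R -> R) (x q t : R) : R :=
  RInt (fun s => s ^ m * f x (s * q) t) 0 1.

Lemma pow_unit (s : R) (m : nat) : 0 <= s <= 1 -> 0 <= s ^ m <= 1.
Proof.
intros H; induction m; simpl; [lra|]. split; [apply Rmult_le_pos; lra|].
rewrite <- (Rmult_1_l 1). apply Rmult_le_compat; lra.
Qed.

Lemma Rabs_scale_lt (s q d : R) : 0 <= s <= 1 -> Rabs q < d -> Rabs (s * q) < d.
Proof.
intros Hs Hq. rewrite Rabs_mult, (Rabs_pos_eq s) by lra.
generalize (Rabs_pos q); intros. nra.
Qed.

Lemma avg_ex_RInt (m : nat) (f : R -> R -> R -> R) (d x q t : R) :
  (forall x q t, Rabs q < d -> cont3 f x q t) -> Rabs q < d ->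
  ex_RInt (fun s => s ^ m * f x (s * q) t) 0 1.
Proof.
intros C Hq. apply (@ex_RInt_continuous R_CompleteNormedModule). intros z Hz.
rewrite Rmin_left, Rmax_right in Hz by lra.
apply continuous_mult_R.
- apply derivable_continuous_R. auto_derive. auto.
- apply (cont3_slice f (fun _ => x) (fun s => s * q) (fun _ => t)).
  apply C, Rabs_scale_lt; auto.
  apply continuous_const.
  apply derivable_continuous_R. auto_derive. auto.
  apply continuous_const.
Qed.

Lemma avg_cont3 (m : nat) (f : R -> R -> R -> R) (d x q t : R) :
  (forall x q t, Rabs q < d -> cont3 f x q t) -> Rabs q < d -> cont3 (avg m f) x q t.
Proof.
intros C Hq. apply cont3_eps. intros e He.
assert (He2 : 0 < e / 4) by lra.
(* Compactness is applied in [s] alone, the other two sides of the box being points. It makes the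
   neighbourhood uniform over the interval of integration. *)
destruct (compact_box3 (fun s _ _ r => forall s' x' q' t', 0 <= s' <= 1 ->
   Rabs (s' - s) < r -> Rabs (x' - x) < r -> Rabs (q' - q) < r -> Rabs (t' - t) < r ->
   Rabs (f x' (s' * q') t' - f x (s * q) t) < e / 4) 0 1 0 0 0 0) as [r K].
- intros s _ _ Hs _ _.
  destruct (proj1 (cont3_eps _ _ _ _) (C x (s * q) t (Rabs_scale_lt _ _ _ Hs Hq)) _ He2)
    as [r [Hr L]].
  pose proof (Rabs_pos q).
  assert (Hr' : 0 < r / (Rabs q + 1)) by (apply Rdiv_lt_0_compat; lra).
  (* The radius [w = r / (Rabs q + 1) / 2] gives [Rabs (s' * q' - s * q) <= w + w * Rabs q = r /
     2]. *)
  exists (mkposreal _ (Rmin_pos _ _ Hr (Rdiv_lt_0_compat _ 2 Hr' ltac:(lra)))); simpl.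
  intros s' x' q' t' Hs' A1 A2 A3 A4.
  split_Rmin. split_Rmin. split_Rmin. split_Rmin. apply L; auto.
  replace (s' * q' - s * q) with (s' * (q' - q) + (s' - s) * q) by ring.
  eapply Rle_lt_trans; [apply Rabs_triang|]. rewrite !Rabs_mult, (Rabs_pos_eq s') by lra.
  set (w := r / (Rabs q + 1) / 2) in *.
  assert (W : w * (Rabs q + 1) = r / 2) by (unfold w; field; lra).
  assert (s' * Rabs (q' - q) <= 1 * w).
  { apply Rmult_le_compat; try lra. apply Rabs_pos. }
  assert (Rabs (s' - s) * Rabs q <= w * Rabs q) by (apply Rmult_le_compat_r; lra).
  lra.
- exists (Rmin r (d - Rabs q)). split.
  { apply Rmin_pos. apply cond_pos. lra. }
  intros x' q' t' A B D. repeat split_Rmin.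
  assert (Hq' : Rabs q' < d).
  { generalize (Rabs_triang (q' - q) q). replace (q' - q + q) with q' by ring. lra. }
  unfold avg.
  rewrite <- (RInt_minus (V := R_CompleteNormedModule) (fun s => s ^ m * f x' (s * q') t') (fun s => s ^ m * f x (s * q) t))
    by (eapply avg_ex_RInt; eauto).
  apply Rle_lt_trans with ((1 - 0) * (e / 2)); [|lra].
  apply abs_RInt_le_const. lra.
  + apply (@ex_RInt_minus R_NormedModule); eapply avg_ex_RInt; eauto.
  + intros s Hs. unfold minus, plus, opp; simpl.
    destruct (K s 0 0 Hs) as (s0 & _ & _ & r0 & P & S & _ & _ & R0); try lra.
    assert (Z : forall a, Rabs (a - a) < r0).
    { intros a; rewrite Rminus_diag, Rabs_R0; apply cond_pos. }
    assert (P1 := P s x' q' t' Hs S ltac:(lra) ltac:(lra) ltac:(lra)).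
    assert (P2 := P s x q t Hs S (Z x) (Z q) (Z t)).
    replace (s ^ m * f x' (s * q') t' + - (s ^ m * f x (s * q) t)) with
      (s ^ m * ((f x' (s * q') t' - f x (s0 * q) t) - (f x (s * q) t - f x (s0 * q) t))) by ring.
    rewrite Rabs_mult. destruct (pow_unit s m Hs). rewrite (Rabs_pos_eq (s ^ m)) by lra.
    replace (e / 2) with (1 * (e / 2)) by ring. apply Rmult_le_compat; try lra. apply Rabs_pos.
    eapply Rle_trans; [apply Rabs_triang|]. rewrite Rabs_Ropp. lra.
Qed.

Lemma continuity_2d_pt_cont3 (f : R -> R -> R -> R) (u v : R) :
  cont3 f u v 0 -> continuity_2d_pt (fun u v => f u v 0) u v.
Proof.
intros C e. destruct (proj1 (cont3_eps _ _ _ _) C e (cond_pos e)) as [d [Hd K]].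
exists (mkposreal d Hd). intros; apply K; auto. rewrite Rminus_diag, Rabs_R0; auto.
Qed.

(** Differentiation under the integral sign. The curve [(g1, g2, g3)] is arbitrary, so that each of
    the three partial derivatives is an instance. *)
Lemma avg_derive (m : nat) (f df : R -> R -> R -> R) (d : R) (g1 g2 g3 : R -> R) (z : R) :
  (forall x q t, Rabs q < d -> cont3 f x q t) -> Rabs (g2 z) < d -> continuous g2 z ->
  (forall s w, Rabs (s * g2 w) < d ->
    is_derive (fun w => f (g1 w) (s * g2 w) (g3 w)) w (df w s 0)) ->
  (forall s, 0 <= s <= 1 -> cont3 df z s 0) ->
  is_derive (fun w => avg m f (g1 w) (g2 w) (g3 w)) z (RInt (fun s => s ^ m * df z s 0) 0 1).
Proof.
intros C L0 Cg H K.
assert (L : locally z (fun w => Rabs (g2 w) < d)) by exact (Cg _ (Rabs_lt_locally d _ L0)).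
replace (RInt (fun s => s ^ m * df z s 0) 0 1) with
  (RInt (fun s => Derive (fun w => s ^ m * f (g1 w) (s * g2 w) (g3 w)) z) 0 1).
- apply (is_derive_RInt_param (fun w s => s ^ m * f (g1 w) (s * g2 w) (g3 w))).
  + revert L; apply filter_imp. intros w Hw s Hs.
    rewrite Rmin_left, Rmax_right in Hs by lra.
    apply ex_derive_scal. exists (df w s 0). apply H, Rabs_scale_lt; auto.
  + intros s Hs. rewrite Rmin_left, Rmax_right in Hs by lra.
    apply continuity_2d_pt_ext with
      (fun w s => s ^ m * Derive (fun z => f (g1 z) (s * g2 z) (g3 z)) w).
    { intros; symmetry; apply Derive_scal. }
    apply continuity_2d_pt_mult.
    * apply (continuity_1d_2d_pt_comp (fun s => s ^ m) (fun w s => s)).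
      apply derivable_continuous_pt. apply ex_derive_Reals_0. auto_derive; auto.
      apply continuity_2d_pt_id2.
    * apply continuity_2d_pt_ext_loc with (fun w s => df w s 0).
      2: apply continuity_2d_pt_cont3; auto.
      assert (Cs : cont3 (fun w s _ => s * g2 w) z s 0).
      { apply cont3_mult. apply cont3_q. apply (cont3_comp1 g2 (fun w _ _ => w)); auto.
        apply cont3_x. }
      assert (Hs' := Rabs_scale_lt s (g2 z) d Hs L0).
      destruct (proj1 (cont3_eps _ _ _ _) Cs (d - Rabs (s * g2 z)) ltac:(lra)) as [r [Hr J]].
      exists (mkposreal r Hr). intros u v Hu Hv. symmetry. apply is_derive_unique, H.
      specialize (J u v 0 Hu Hv ltac:(rewrite Rminus_diag, Rabs_R0; auto)).
      generalize (Rabs_triang (v * g2 u - s * g2 z) (s * g2 z)).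
      replace (v * g2 u - s * g2 z + s * g2 z) with (v * g2 u) by ring. lra.
  + revert L; apply filter_imp. intros w Hw. eapply avg_ex_RInt; eauto.
- apply RInt_ext. intros s Hs. rewrite Rmin_left, Rmax_right in Hs by lra.
  rewrite Derive_scal. f_equal. apply is_derive_unique. apply H, Rabs_scale_lt; auto. lra.
Qed.

(** Differentiating [f x (s * q) t] in [q] releases a factor [s], which raises the weight from [m]
    to [S m]. *)
Lemma avg_partials (m : nat) (f fx fq ft : R -> R -> R -> R) (d : R) :
  (forall x q t, Rabs q < d -> partials f fx fq ft x q t) ->
  (forall x q t, Rabs q < d -> cont3 f x q t) ->
  (forall x q t, Rabs q < d -> cont3 fx x q t) ->
  (forall x q t, Rabs q < d -> cont3 fq x q t) ->
  (forall x q t, Rabs q < d -> cont3 ft x q t) ->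
  forall x q t, Rabs q < d -> partials (avg m f) (avg m fx) (avg (S m) fq) (avg m ft) x q t.
Proof.
intros P C Cx Cq Ct x q t Hq.
assert (M : forall w s c, cont3 (fun _ s _ => s * c) w s 0).
{ intros; apply cont3_mult. apply cont3_q. apply cont3_const. }
split; [|split].
- apply (avg_derive m f (fun w s _ => fx w (s * q) t) d (fun w => w) (fun _ => q) (fun _ => t));
    auto using continuous_const.
  + intros s w Hw. exact (partials_x _ _ _ _ _ _ _ (P w _ t Hw)).
  + intros s Hs. apply (cont3_comp fx (fun w _ _ => w) (fun _ s _ => s * q) (fun _ _ _ => t));
      auto using cont3_x, cont3_const, Rabs_scale_lt.
- replace (avg (S m) fq x q t) with (RInt (fun s => s ^ m * (s * fq x (s * q) t)) 0 1).
  2:{ apply RInt_ext; intros; simpl; ring. }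
  apply (avg_derive m f (fun w s _ => s * fq x (s * w) t) d (fun _ => x) (fun w => w) (fun _ => t));
    auto using continuous_id.
  + intros s w Hw. apply (is_derive_comp (fun y => f x y t) (fun w => s * w)).
    exact (partials_q _ _ _ _ _ _ _ (P x _ t Hw)). auto_derive; auto. ring.
  + intros s Hs. apply cont3_mult. apply cont3_q.
    apply (cont3_comp fq (fun _ _ _ => x) (fun w s _ => s * w) (fun _ _ _ => t));
      auto using cont3_const, Rabs_scale_lt.
    apply cont3_mult. apply cont3_q. apply cont3_x.
- apply (avg_derive m f (fun w s _ => ft x (s * q) w) d (fun _ => x) (fun _ => q) (fun w => w));
    auto using continuous_const.
  + intros s w Hw. exact (partials_t _ _ _ _ _ _ _ (P x _ w Hw)).
  + intros s Hs. apply (cont3_comp ft (fun _ _ _ => x) (fun _ s _ => s * q) (fun w _ _ => w));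
      auto using cont3_x, cont3_const, Rabs_scale_lt.
Qed.

Lemma Cs_avg (d : R) (k m : nat) (f : R -> R -> R -> R) : Cs d k f -> Cs d k (avg m f).
Proof.
revert m f; induction k; intros m f H.
- destruct H as [H _]. split; auto. intros; eapply avg_cont3; eauto.
- assert (H0 := Cs_pred _ _ _ H).
  apply Cs_D in H. destruct H as (P & A & B & C).
  eapply Cs_S; [|apply (IHk m _ A)|apply (IHk (S m) _ B)|apply (IHk m _ C)].
  apply avg_partials; auto; intros; eapply Cs_cont; eauto.
Qed.

(** The substitution [z = s * q] in the fundamental theorem of calculus on the segment from [0] to
    [q]. *)
Lemma avg_integrate (m : nat) (F Y : R -> R -> R -> R) (d x q t : R) :
  (forall x q t, Rabs q < d -> cont3 Y x q t) -> Rabs q < d ->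
  (forall z, Rabs z < d -> is_derive (fun z => F x z t) z (z ^ m * Y x z t)) ->
  F x 0 t = 0 -> F x q t = q ^ S m * avg m Y x q t.
Proof.
intros C Hq H H0.
assert (E : is_RInt (fun s => q * ((s * q) ^ m * Y x (s * q) t)) 0 1
   (minus (F x (1 * q) t) (F x (0 * q) t))).
{ apply (is_RInt_derive (fun s => F x (s * q) t)).
  - intros s Hs. rewrite Rmin_left, Rmax_right in Hs by lra.
    apply (is_derive_comp (fun y => F x y t) (fun s => s * q)).
    apply H, Rabs_scale_lt; auto. auto_derive; auto. ring.
  - intros s Hs. rewrite Rmin_left, Rmax_right in Hs by lra.
    apply continuous_mult_R. apply continuous_const.
    apply continuous_mult_R.
    + apply derivable_continuous_R. auto_derive. auto.
    + apply (cont3_slice Y (fun _ => x) (fun s => s * q) (fun _ => t)).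
      apply C, Rabs_scale_lt; auto. apply continuous_const.
      apply derivable_continuous_R. auto_derive. auto.
      apply continuous_const. }
apply (is_RInt_unique (V := R_CompleteNormedModule)) in E. rewrite Rmult_0_l, Rmult_1_l, H0 in E.
unfold minus, plus, opp in E; simpl in E. rewrite Ropp_0, Rplus_0_r in E. rewrite <- E.
unfold avg.
transitivity (scal (q ^ S m) (RInt (V := R_CompleteNormedModule) (fun s => s ^ m * Y x (s * q) t) 0 1)); [|reflexivity].
rewrite <- (RInt_scal (V := R_CompleteNormedModule) (fun s => s ^ m * Y x (s * q) t) 0 1 (q ^ S m)).
2: eapply avg_ex_RInt; eauto.
apply RInt_ext. intros s _. unfold scal; simpl; unfold mult; simpl.
rewrite Rpow_mult_distr. ring.
Qed.

Lemma avg_0 (m : nat) (f : R -> R -> R -> R) (x t : R) :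
  avg m f x 0 t = f x 0 t / INR (S m).
Proof.
unfold avg.
assert (N : INR (S m) <> 0) by (apply not_0_INR; lia).
apply (is_RInt_unique (V := R_CompleteNormedModule)).
replace (f x 0 t / INR (S m)) with
  (minus (1 ^ S m * (f x 0 t / INR (S m))) (0 ^ S m * (f x 0 t / INR (S m)))).
2:{ unfold minus, plus, opp; simpl. rewrite pow1. ring. }
apply (is_RInt_derive (fun s => s ^ S m * (f x 0 t / INR (S m)))).
- intros s _. rewrite Rmult_0_r. auto_derive; auto.
  change (Nat.pred (S m)) with m. field; exact N.
- intros s _. apply derivable_continuous_R.
  apply (ex_derive_ext (fun s => s ^ m * f x 0 t)).
  intros; rewrite Rmult_0_r; auto. auto_derive. auto.
Qed.

(** The quotient is the mean [avg 0 (Dq f)], hence the loss of one class. Its value at [q = 0] and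
    its periodicity are recorded because a second division must follow. *)
Lemma Hadamard (d : R) (k : nat) (f : R -> R -> R -> R) :
  Cs d (S k) f -> (forall x t, f x 0 t = 0) ->
  exists g, Cs d k g /\ (forall x q t, Rabs q < d -> f x q t = q * g x q t) /\
    (forall x t, g x 0 t = Dq f x 0 t) /\
    (forall x t, (forall q, f (x + 1) q t = f x q t) -> forall q, g (x + 1) q t = g x q t).
Proof.
intros H H0. apply Cs_D in H. destruct H as (P & A & B & C).
exists (avg 0 (Dq f)). split; [|split; [|split]].
- apply Cs_avg; auto.
- intros x q t Hq. rewrite (avg_integrate 0 f (Dq f) d); auto. ring.
  intros; eapply Cs_cont; eauto.
  intros z Hz. simpl. rewrite Rmult_1_l. exact (partials_q _ _ _ _ _ _ _ (P x z t Hz)).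
- intros x t. rewrite avg_0. simpl. field.
- intros x t Px q. apply RInt_ext. intros z _. f_equal. apply Derive_ext. exact Px.
Qed.


(** * Inverse functions *)

Lemma slope_ge (f f' : R -> R) (a b c : R) :
  a <= b -> (forall z, a <= z <= b -> is_derive f z (f' z)) ->
  (forall z, a <= z <= b -> c <= f' z) -> c * (b - a) <= f b - f a.
Proof.
intros Hab H1 H2. destruct (MVT_gen f a b f') as [z [Hz E]];
  rewrite ?Rmin_left, ?Rmax_right in * by lra.
- intros; apply H1; lra.
- intros z Hz. apply derivable_continuous_pt.
  exists (f' z). apply is_derive_Reals. apply H1; lra.
- rewrite E. apply Rmult_le_compat_r. lra. auto.
Qed.

Section Inverse.

Variables (e : R) (k : nat) (F : R -> R -> R -> R).
Hypothesis He : 0 < e.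
Hypothesis HF : Cs e (S k) F.
Hypothesis F0 : forall x t, F x 0 t = 0.
Hypothesis HD : forall x h t, Rabs h < e -> / 2 <= Dq F x h t.

Lemma inverse_slope (x a b t : R) :
  Rabs a < e -> Rabs b < e -> a <= b -> / 2 * (b - a) <= F x b t - F x a t.
Proof.
destruct (Cs_D _ _ _ HF) as (P & _). intros Ha Hb Hab. apply Rabs_def2 in Ha, Hb.
apply (slope_ge (fun h => F x h t) (fun h => Dq F x h t)); auto.
- intros z Hz. refine (partials_q _ _ _ _ _ _ _ (P x z t _)). apply Rabs_def1; lra.
- intros z Hz. apply HD. apply Rabs_def1; lra.
Qed.

Lemma inverse_lip (x h h' t : R) :
  Rabs h < e -> Rabs h' < e -> Rabs (h' - h) <= 2 * Rabs (F x h' t - F x h t).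
Proof.
assert (G := fun a b => inverse_slope x a b t).
intros A B. destruct (Rle_dec h h') as [L|L].
- specialize (G h h' A B L). rewrite !Rabs_pos_eq; lra.
- specialize (G h' h B A ltac:(lra)). rewrite (Rabs_left1 (h' - h)), Rabs_left1; lra.
Qed.

(** Slope at least one half and [F x 0 t = 0] put the values at [- (e / 2)] and [e / 2] beyond
    [- (e / 4)] and [e / 4]; this fixes the strip [e / 4] of the inverse. *)
Lemma inverse_exists (x y t : R) :
  Rabs y < e / 4 -> exists h, Rabs h < e / 2 /\ F x h t = y.
Proof.
intros Hy. apply Rabs_def2 in Hy.
assert (C : forall h, Rabs h < e -> continuity_pt (fun h => F x h t) h).
{ intros h Hh. apply continuity_pt_filterlim.
  apply (cont3_slice F (fun _ => x) (fun h => h) (fun _ => t)).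
  eapply Cs_cont; eauto. apply continuous_const. apply continuous_id. apply continuous_const. }
destruct (IVT_Rbar_incr (fun h => F x h t) (- (e / 2)) (e / 2) (F x (- (e / 2)) t) (F x (e / 2) t) y)
  as [h [A [B E]]].
- apply (is_lim_continuity (fun h => F x h t) (- (e / 2))), C. rewrite Rabs_Ropp, Rabs_pos_eq; lra.
- apply (is_lim_continuity (fun h => F x h t) (e / 2)), C. rewrite Rabs_pos_eq; lra.
- intros h A B. simpl in A, B. apply C. apply Rabs_def1; lra.
- simpl; lra.
- assert (G := fun a b => inverse_slope x a b t).
  assert (Z : Rabs 0 < e) by (rewrite Rabs_R0; lra).
  assert (G1 := G (- (e / 2)) 0 ltac:(rewrite Rabs_Ropp, Rabs_pos_eq; lra) Z ltac:(lra)).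
  assert (G2 := G 0 (e / 2) Z ltac:(rewrite Rabs_pos_eq; lra) ltac:(lra)).
  rewrite F0 in G1, G2. simpl. lra.
- simpl in A, B. exists h. split; auto. apply Rabs_def1; lra.
Qed.

Lemma Cs_inverse : exists g : R -> R -> R -> R,
  (forall x y t, Rabs y < e / 4 -> Rabs (g x y t) < e / 2 /\ F x (g x y t) t = y) /\
  Cs (e / 4) (S k) g.
Proof.
assert (Ch : forall x y t, exists h, Rabs y < e / 4 -> Rabs h < e / 2 /\ F x h t = y).
{ intros x y t. destruct (classic (Rabs y < e / 4)) as [A|A].
  - destruct (inverse_exists x y t A) as [h Hh]. exists h; auto.
  - exists 0; tauto. }
set (g := fun x y t => proj1_sig (constructive_indefinite_description _ (Ch x y t))).
assert (Hg : forall x y t, Rabs y < e / 4 -> Rabs (g x y t) < e / 2 /\ F x (g x y t) t = y).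
{ intros x y t. unfold g. destruct constructive_indefinite_description. auto. }
exists g. split; auto. clearbody g.
assert (Hge : forall x y t, Rabs y < e / 4 -> Rabs (g x y t) < e).
{ intros x y t Hy. destruct (Hg x y t Hy); lra. }
(* By [inverse_lip], [g] varies at most twice as much as [F x' (g x y t) t' - y'], a continuous
   function in which the old value of [g] is frozen. *)
assert (Cg : forall x y t, Rabs y < e / 4 -> cont3 g x y t).
{ intros x y t Hy. apply cont3_eps. intros eps Heps.
  assert (CF : cont3 (fun x' y' t' => F x' (g x y t) t' - y') x y t).
  { apply cont3_plus.
    - apply (cont3_comp F (fun x _ _ => x) (fun _ _ _ => g x y t) (fun _ _ t => t)).
      eapply Cs_cont; eauto. apply cont3_x. apply cont3_const. apply cont3_t.
    - apply (cont3_comp1 Ropp). apply continuous_opp_R, continuous_id.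
      apply cont3_q. }
  destruct (proj1 (cont3_eps _ _ _ _) CF (eps / 2) ltac:(lra)) as [r [Hr K]].
  exists (Rmin r (e / 4 - Rabs y)). split; [apply Rmin_pos; lra|].
  intros x' y' t' X Y T. repeat split_Rmin.
  specialize (K x' y' t' ltac:(auto) ltac:(auto) ltac:(auto)).
  destruct (Hg x y t Hy) as [_ E]. rewrite E in K.
  assert (Hy' : Rabs y' < e / 4).
  { generalize (Rabs_triang (y' - y) y). replace (y' - y + y) with y' by ring. lra. }
  destruct (Hg x' y' t' Hy') as [_ E'].
  assert (L := inverse_lip x' (g x y t) (g x' y' t') t' (Hge _ _ _ Hy) (Hge _ _ _ Hy')).
  rewrite E' in L. rewrite (Rabs_minus_sym y') in L.
  replace (F x' (g x y t) t' - y' - (y - y)) with (F x' (g x y t) t' - y') in K by ring. lra. }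
(* Bootstrap: the implicit formulas express the partials of [g] through those of [F] at [g], so
   class [j] of [g] gives class [j] of its partials, up to the class [S k] of [F]. *)
assert (Step : forall j, (j <= S k)%nat -> Cs (e / 4) j g).
2:{ auto. }
induction j; intros Hj.
- split; auto.
- assert (IH := IHj ltac:(lia)). clear IHj.
  destruct (Cs_D _ _ _ HF) as (P & A & B & C).
  apply (Cs_le _ j) in A; [|lia]. apply (Cs_le _ j) in B; [|lia]. apply (Cs_le _ j) in C; [|lia].
  assert (CC : forall f, Cs e j f -> Cs (e / 4) j (fun x y t => f x (g x y t) t)).
  { intros f Hf. apply (Cs_comp _ e j f (fun x _ _ => x) g (fun _ _ t => t)); auto.
    apply Cs_x. apply Cs_t. }
  assert (N : forall x y t, Rabs y < e / 4 -> Dq F x (g x y t) t <> 0).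
  { intros x y t Hy. generalize (HD x (g x y t) t (Hge _ _ _ Hy)). lra. }
  assert (Kx := fun x y t Hy => Cs_cont _ _ _ x (g x y t) t A (Hge x y t Hy)).
  assert (Kq := fun x y t Hy => Cs_cont _ _ _ x (g x y t) t B (Hge x y t Hy)).
  assert (Kt := fun x y t Hy => Cs_cont _ _ _ x (g x y t) t C (Hge x y t Hy)).
  assert (Id : forall z, is_derive (fun w : R => w) z 1).
  { intros; apply is_derive_id_R. }
  assert (Cst : forall c z, is_derive (fun w : R => c) z 0).
  { intros; apply is_derive_const_R. }
  apply (Cs_S _ _ g (fun x y t => (0 - Dx F x (g x y t) t * 1 - Dt F x (g x y t) t * 0) / Dq F x (g x y t) t)
    (fun x y t => (1 - Dx F x (g x y t) t * 0 - Dt F x (g x y t) t * 0) / Dq F x (g x y t) t)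
    (fun x y t => (0 - Dx F x (g x y t) t * 0 - Dt F x (g x y t) t * 1) / Dq F x (g x y t) t)).
  + intros x y t Hy. split; [|split].
    * apply (is_derive_implicit F (Dx F) (Dq F) (Dt F) e (fun z => z) (fun z => g z y t) (fun _ => t) (fun _ => y) x); auto.
      apply (cont3_slice g (fun z => z) (fun _ => y) (fun _ => t)); auto;
        first [apply continuous_const | apply continuous_id].
      apply filter_forall. intros z. apply Hg; auto.
    * apply (is_derive_implicit F (Dx F) (Dq F) (Dt F) e (fun _ => x) (fun z => g x z t) (fun _ => t) (fun z => z) y); auto.
      apply (cont3_slice g (fun _ => x) (fun z => z) (fun _ => t)); auto;
        first [apply continuous_const | apply continuous_id].
      generalize (Rabs_lt_locally _ _ Hy). apply filter_imp. intros z Hz. apply Hg; auto.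
    * apply (is_derive_implicit F (Dx F) (Dq F) (Dt F) e (fun _ => x) (fun z => g x y z) (fun z => z) (fun _ => y) t); auto.
      apply (cont3_slice g (fun _ => x) (fun _ => y) (fun z => z)); auto;
        first [apply continuous_const | apply continuous_id].
      apply filter_forall. intros z. apply Hg; auto.
  + apply Cs_div; [exact N| |apply CC; auto].
    repeat apply Cs_minus; try apply Cs_mult; try apply CC; auto; apply Cs_const.
  + apply Cs_div; [exact N| |apply CC; auto].
    repeat apply Cs_minus; try apply Cs_mult; try apply CC; auto; apply Cs_const.
  + apply Cs_div; [exact N| |apply CC; auto].
    repeat apply Cs_minus; try apply Cs_mult; try apply CC; auto; apply Cs_const.
Qed.

End Inverse.

(** Inverts the square-root form of [y ^ 2 / 2 = h ^ 2 / 2 + h ^ 4 * B]. Taking the root turns an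
    equation degenerate at [h = 0] into one of slope [1] there. *)
Lemma sqrt_normal_inverse (e K : R) (k : nat) (B : R -> R -> R -> R) :
  0 < e -> Cs e (S k) B ->
  (forall x h t, Rabs h < e -> Rabs (B x h t) <= K /\ Rabs (Dq B x h t) <= K) ->
  exists (e' : R) (g : R -> R -> R -> R), 0 < e' <= e /\
   (forall x h t, Rabs h < e' -> / 2 <= 1 + 2 * h ^ 2 * B x h t /\
       / 2 <= sqrt (1 + 2 * h ^ 2 * B x h t) <= 2) /\
   (forall x h h' t, Rabs h < e' -> Rabs h' < e' ->
      h * sqrt (1 + 2 * h ^ 2 * B x h t) = h' * sqrt (1 + 2 * h' ^ 2 * B x h' t) -> h = h') /\
   (forall x y t, Rabs y < e' / 4 -> Rabs (g x y t) < e' / 2 /\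
      g x y t * sqrt (1 + 2 * g x y t ^ 2 * B x (g x y t) t) = y) /\
   Cs (e' / 4) (S k) g.
Proof.
intros He HB HK.
assert (K0 : 0 <= K).
{ destruct (HK 0 0 0) as [H _]. rewrite Rabs_R0; auto. generalize (Rabs_pos (B 0 0 0)); lra. }
(* This makes [e' <= / 4] and [e' * K <= / 4]; then the radicand is within [1 / 8] of [1], and the
   slope of [F] is at least [7 / 8 - 3 / 8]. *)
set (e' := Rmin e (/ (4 * (K + 1)))).
assert (He' : 0 < e') by (apply Rmin_pos; auto; apply Rinv_0_lt_compat; lra).
assert (L1 : e' <= e) by apply Rmin_l.
assert (L2 : e' * (4 * (K + 1)) <= 1).
{ apply Rle_trans with (/ (4 * (K + 1)) * (4 * (K + 1))).
  apply Rmult_le_compat_r. lra. apply Rmin_r. right; field; lra. }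
assert (L3 : e' <= / 4) by nra.
assert (L4 : e' * K <= / 4) by nra.
assert (BB : forall x h t, Rabs h < e' ->
   Rabs (h * B x h t) <= / 4 /\ Rabs (h * Dq B x h t) <= / 4).
{ intros x h t Hh. destruct (HK x h t ltac:(lra)) as [A A'].
  rewrite !Rabs_mult. split; (eapply Rle_trans; [|exact L4]);
  apply Rmult_le_compat; auto using Rabs_pos; lra. }
assert (GB : forall x h t, Rabs h < e' -> 7 / 8 <= 1 + 2 * h ^ 2 * B x h t <= 9 / 8).
{ intros x h t Hh. destruct (BB x h t Hh) as [A _].
  assert (Q : Rabs (h * (h * B x h t)) <= / 4 * / 4).
  { rewrite Rabs_mult. apply Rmult_le_compat; auto using Rabs_pos; lra. }
  apply Rabs_le_between in Q. simpl. lra. }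
assert (SB : forall x h t, Rabs h < e' -> 7 / 8 <= sqrt (1 + 2 * h ^ 2 * B x h t) <= 2).
{ intros x h t Hh. specialize (GB x h t Hh). split.
  - replace (7 / 8) with (sqrt ((7 / 8) ^ 2)) by (rewrite sqrt_pow2; lra).
    apply sqrt_le_1_alt. lra.
  - apply Rle_trans with (sqrt (2 ^ 2)).
    apply sqrt_le_1_alt; lra. rewrite sqrt_pow2; lra. }
set (F := fun x h t => h * sqrt (1 + 2 * h ^ 2 * B x h t)).
assert (HB' := Cs_sub _ _ _ _ L1 HB).
assert (HF : Cs e' (S k) F).
{ apply Cs_mult. apply Cs_q. apply Cs_sqrt.
  intros x h t Hh; specialize (GB x h t Hh); lra.
  apply Cs_plus. apply Cs_const. apply Cs_mult; auto. apply Cs_scal. apply Cs_pow. apply Cs_q. }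
assert (HD : forall x h t, Rabs h < e' -> / 2 <= Dq F x h t).
{ intros x h t Hh. specialize (GB x h t Hh). specialize (SB x h t Hh).
  set (s := sqrt (1 + 2 * h ^ 2 * B x h t)) in *.
  destruct (Cs_D _ _ _ HB') as (P & _). destruct (P x h t Hh) as (_ & PB & _).
  assert (E : is_derive (fun h => F x h t) h
     (s + h * ((4 * h * B x h t + 2 * h ^ 2 * Dq B x h t) / (2 * s)))).
  { unfold F.
    assert (PG : is_derive (fun h => 1 + 2 * h ^ 2 * B x h t) h (4 * h * B x h t + 2 * h ^ 2 * Dq B x h t)).
    { auto_derive. exists (Dq B x h t); exact PB.
      replace (Derive _ h) with (Dq B x h t) by reflexivity. simpl; ring. }
    eapply (@eq_rect R _ (fun l => is_derive (fun h => h * sqrt (1 + 2 * h ^ 2 * B x h t)) h l)).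
    apply (is_derive_mult_R (fun h => h) (fun h => sqrt (1 + 2 * h ^ 2 * B x h t)) h 1).
    apply is_derive_id_R. apply (is_derive_sqrt _ _ _ PG). lra. apply Rmult_comm.
    unfold plus, mult; simpl. unfold s. simpl. ring. }
  replace (Dq F x h t) with (s + h * ((4 * h * B x h t + 2 * h ^ 2 * Dq B x h t) / (2 * s)))
    by (symmetry; exact (is_derive_unique _ _ _ E)).
  destruct (BB x h t Hh) as [A A'].
  assert (Q : Rabs (h * (4 * h * B x h t + 2 * h ^ 2 * Dq B x h t)) <= 3 / 8).
  { replace (h * (4 * h * B x h t + 2 * h ^ 2 * Dq B x h t)) with
     (4 * (h * (h * B x h t)) + 2 * (h * (h * (h * Dq B x h t)))) by ring.
    eapply Rle_trans; [apply Rabs_triang|]. rewrite !(Rabs_mult 4), !(Rabs_mult 2).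
    rewrite !(Rabs_mult h (h * _)).
    rewrite (Rabs_pos_eq 4), (Rabs_pos_eq 2) by lra.
    pose proof (Rabs_pos h). pose proof (Rabs_pos (h * B x h t)). pose proof (Rabs_pos (h * Dq B x h t)).
    assert (Rabs h * Rabs (h * B x h t) <= / 4 * / 4) by (apply Rmult_le_compat; lra).
    assert (Rabs h * Rabs (h * Dq B x h t) <= / 4 * / 4) by (apply Rmult_le_compat; lra).
    assert (0 <= Rabs h * Rabs (h * Dq B x h t)) by (apply Rmult_le_pos; lra).
    assert (Rabs h * (Rabs h * Rabs (h * Dq B x h t)) <= / 4 * (/ 4 * / 4)) by (apply Rmult_le_compat; lra).
    lra. }
  apply Rabs_le_between in Q.
  set (w := h * (4 * h * B x h t + 2 * h ^ 2 * Dq B x h t)) in *.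
  replace (h * ((4 * h * B x h t + 2 * h ^ 2 * Dq B x h t) / (2 * s))) with (w / (2 * s)) by (unfold w; field; lra).
  assert (- (3 / 8) <= w / (2 * s)); [|lra].
  apply Rmult_le_reg_r with (2 * s); [lra|]. replace (w / (2 * s) * (2 * s)) with w by (field; lra). lra. }
assert (F0 : forall x t, F x 0 t = 0) by (intros; unfold F; ring).
destruct (Cs_inverse e' k F He' HF F0 HD) as [g [Hg Cg]].
exists e', g. split; [lra|]. split; [|split; [|split]]; auto.
- intros x h t Hh. specialize (GB x h t Hh). specialize (SB x h t Hh). lra.
- intros x h h' t Hh Hh' E.
  assert (L := inverse_lip e' k F HF HD x h h' t Hh Hh'). unfold F in L at 1 2.
  rewrite E, Rminus_diag, Rabs_R0 in L. generalize (Rabs_pos (h' - h)). intros.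
  assert (Z : Rabs (h' - h) = 0) by lra. apply Rabs_eq_0 in Z. lra.
Qed.


(** * One-sided derivatives, cut-offs and periodization *)

Lemma is_derive_on_eps (D : R -> Prop) (f : R -> R) (x l : R) :
  D x ->
  (is_derive_on D f x l <->
  (forall e, 0 < e -> exists d, 0 < d /\ forall y, D y -> Rabs (y - x) < d ->
     Rabs (f y - f x - l * (y - x)) <= e * Rabs (y - x))).
Proof.
intros Dx. split.
- intros [_ H] e He.
  assert (L : is_filter_lim (within D (locally x)) x).
  { intros P HP. unfold within. apply (filter_imp P); auto. }
  destruct (H x L (mkposreal e He)) as [d Hd].
  exists d; split; [apply cond_pos|]. intros y Dy Hy.
  specialize (Hd y Hy Dy). unfold minus, plus, opp, scal, norm in Hd; simpl in Hd.
  unfold mult, abs in Hd; simpl in Hd.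
  replace (f y - f x - l * (y - x)) with (f y + - f x + - ((y + - x) * l)) by ring.
  exact Hd.
- intros H. split. exact (@is_linear_scal_l R_AbsRing R_NormedModule l).
  intros x' Hx'.
  (* [filterdiff] speaks about every limit point of the filter; since [D x] holds, the only one of
     [within D (locally x)] is [x]. *)
  assert (E : x' = x).
  { destruct (Req_dec x' x) as [E|N]; auto. exfalso.
    assert (P : 0 < Rabs (x' - x)) by (apply Rabs_pos_lt; lra).
    assert (B := Hx' (fun y => Rabs (y - x') < Rabs (x' - x)) (locally_ball x' (mkposreal _ P))).
    apply locally_singleton in B. specialize (B Dx). rewrite Rabs_minus_sym in B. lra. }
  subst x'. clear Hx'.
  intros e. destruct (H e (cond_pos e)) as [d [Hd1 Hd2]].
  exists (mkposreal d Hd1). intros y Hy Dy. specialize (Hd2 y Dy Hy).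
  unfold minus, plus, opp, scal, norm; simpl. unfold mult, abs; simpl.
  replace (f y + - f x + - ((y + - x) * l)) with (f y - f x - l * (y - x)) by ring.
  exact Hd2.
Qed.

Lemma is_derive_on_of_is_derive (D : R -> Prop) (f : R -> R) (x l : R) :
  D x -> is_derive f x l -> is_derive_on D f x l.
Proof.
intros Dx H. apply is_derive_on_eps; auto. intros e He.
destruct (proj1 (is_derive_eps _ _ _) H e He) as [d [Hd K]]. exists d; split; auto.
Qed.

Lemma is_derive_of_is_derive_on (D : R -> Prop) (f : R -> R) (x l : R) :
  locally x D -> is_derive_on D f x l -> is_derive f x l.
Proof.
intros L H. assert (Dx := locally_singleton _ _ L). destruct L as [r Hr].
apply is_derive_eps; intros e He.
destruct (proj1 (is_derive_on_eps _ _ _ _ Dx) H e He) as [d [Hd K]].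
exists (Rmin d r). split. { apply Rmin_pos; auto using cond_pos. }
intros y Hy. split_Rmin. apply K; auto. 
Qed.

Lemma cont3_const_loc (f : R -> R -> R -> R) (c r x q t : R) :
  0 < r -> (forall x' q' t', Rabs (q' - q) < r -> f x' q' t' = c) -> cont3 f x q t.
Proof.
intros Hr H. apply cont3_eps. intros e He. exists r; split; auto.
intros. rewrite !H; auto; rewrite ?Rminus_diag, ?Rabs_R0; auto.
Qed.

Lemma continuous_half_cont3 (f : R -> R -> R -> R) :
  (forall x q t, 0 <= q -> cont3 f x q t) -> continuous_half f.
Proof.
intros H x q t Hq. apply filterlim_within_ext with (fun p : R * R * R => f (fst (fst p)) (snd (fst p)) (snd p)). auto.
intros P HP. specialize (H x q t Hq P HP). revert H. unfold filtermap, within.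
apply filter_imp. auto.
Qed.

(* A function supported in [1/4 <= t <= 3/4] and [q <= d/2] becomes 1-periodic in [t]
   and global in [q >= 0]. *)
Definition periodize (d : R) (f : R -> R -> R -> R) (x q t : R) : R :=
  if Rlt_dec q d then f x q (frac_part t) else 0.

(** [frac_part] jumps at the integers, but [f] vanishes on both sides of the jump; hence near every
    [t] the periodization is a translate of [f] by a fixed integer. *)
Lemma periodize_local (d : R) (f : R -> R -> R -> R) (t : R) :
  (forall x q t, Rabs q < d -> t < / 4 -> f x q t = 0) ->
  (forall x q t, Rabs q < d -> 3 / 4 < t -> f x q t = 0) ->
  forall x q' t', Rabs q' < d -> Rabs (t' - t) < / 4 ->
    periodize d f x q' t' = f x q' (t' - IZR (Int_part t)).
Proof.
intros Z1 Z2 x q' t' Hq Ht. unfold periodize.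
destruct Rlt_dec as [_|N]. 2:{ exfalso; apply Rabs_def2 in Hq; lra. }
unfold frac_part. apply Rabs_def2 in Ht.
destruct (base_Int_part t) as [A1 A2]. destruct (base_Int_part t') as [B1 B2].
set (n := Int_part t) in *. set (n' := Int_part t') in *.
assert (C1 : (n' <= n + 1)%Z).
{ apply Z.lt_succ_r. apply lt_IZR. rewrite succ_IZR, plus_IZR. lra. }
assert (C2 : (n - 1 <= n')%Z).
{ apply Z.lt_succ_r. apply lt_IZR. rewrite succ_IZR, minus_IZR. lra. }
(* Crossing an integer in either direction puts both arguments into the zones where [f] is zero. *)
assert (C : (n' = n - 1 \/ n' = n \/ n' = n + 1)%Z) by lia.
destruct C as [C|[C|C]]; rewrite C in *.
- rewrite minus_IZR in *. rewrite Z2, Z1; auto; lra.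
- reflexivity.
- rewrite plus_IZR in *. rewrite Z1, Z2; auto; lra.
Qed.

(** The induction closes because the vanishing conditions hold on open sets and so pass to every
    partial derivative. The margin between [d / 2] and [d] makes the extension by zero regular
    across [q = d]. *)
Lemma Ck_half_periodize (d : R) (k : nat) (f : R -> R -> R -> R) :
  0 < d -> Cs d k f ->
  (forall x q t, d / 2 < q < d -> f x q t = 0) ->
  (forall x q t, Rabs q < d -> t < / 4 -> f x q t = 0) ->
  (forall x q t, Rabs q < d -> 3 / 4 < t -> f x q t = 0) ->
  Ck_half k (periodize d f).
Proof.
intros Hd. revert f. induction k; intros f.
all: intros HC Z0 Z1 Z2.
all: assert (Far : forall x q t, d / 2 < q -> periodize d f x q t = 0) by
  (intros x q t Hq; unfold periodize; destruct Rlt_dec; auto).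
all: assert (C0 : continuous_half (periodize d f)).
1,3: apply continuous_half_cont3; intros x q t Hq;
  destruct (Rle_lt_dec d q) as [L|L];
  [ apply (cont3_const_loc _ 0 (d / 2)); [lra|]; intros x' q' t' Hq'; apply Far;
    apply Rabs_def2 in Hq'; lra
  | assert (Hq' : Rabs q < d) by (rewrite Rabs_pos_eq; lra);
    apply cont3_eps; intros e He;
    destruct (proj1 (cont3_eps _ _ _ _) (Cs_cont _ _ _ x q (t - IZR (Int_part t)) HC Hq') e He) as [r [Hr K]];
    exists (Rmin (Rmin r (d - q)) (/ 4)); split; [repeat apply Rmin_pos; lra|];
    intros x' q' t' X Q T; repeat split_Rmin;
    assert (Hq'' : Rabs q' < d) by
     (generalize (Rabs_triang (q' - q) q); replace (q' - q + q) with q' by ring;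
      rewrite (Rabs_pos_eq q); lra);
    rewrite !(periodize_local d f t Z1 Z2); auto; rewrite ?Rminus_diag, ?Rabs_R0; try lra;
    apply K; auto;
    replace (t' - IZR (Int_part t) - (t - IZR (Int_part t))) with (t' - t) by ring; auto ].
- split; auto.
- split; auto.
  destruct (Cs_D _ _ _ HC) as (P & A & B & C).
  exists (periodize d (Dx f)), (periodize d (Dq f)), (periodize d (Dt f)).
  split; [|split; [|split]].
  + intros x q t Hq. destruct (Rlt_le_dec q d) as [L|L].
    * assert (Hq' : Rabs q < d) by (rewrite Rabs_pos_eq; lra).
      set (n := IZR (Int_part t)).
      assert (E : forall f, periodize d f x q t = f x q (t - n)).
      { intros h. unfold periodize. destruct Rlt_dec; [|lra]. reflexivity. }
      rewrite !E. destruct (P x q (t - n) Hq') as (PX & PQ & PT).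
      assert (Loc := periodize_local d f t Z1 Z2).
      assert (T0 : Rabs (t - t) < / 4) by (rewrite Rminus_diag, Rabs_R0; lra).
      split; [|split].
      -- eapply is_derive_ext; [|exact PX]. intros z; simpl. rewrite Loc; auto.
      -- apply is_derive_on_of_is_derive; [exact Hq|].
         eapply is_derive_ext_loc; [|exact PQ].
         generalize (Rabs_lt_locally d q Hq'). apply filter_imp.
         intros z Hz; rewrite Loc; auto.
      -- assert (PT' : is_derive (fun z => f x q (z - n)) t (Dt f x q (t - n))).
         { replace (Dt f x q (t - n)) with (1 * Dt f x q (t - n)) by ring.
           apply (is_derive_comp (fun y => f x q y) (fun z => z - n) t); auto.
           auto_derive; [auto|ring]. }
         eapply is_derive_ext_loc; [|exact PT'].
         exists (mkposreal (/ 4) ltac:(lra)). intros z Hz. symmetry. apply Loc; auto.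
    * assert (E : forall f, periodize d f x q t = 0).
      { intros h. unfold periodize. destruct Rlt_dec; [lra|]. reflexivity. }
      rewrite !E. 
      split; [|split].
      -- eapply is_derive_ext; [|apply (is_derive_const_R 0)].
         intros; simpl; rewrite Far; lra.
      -- apply is_derive_on_of_is_derive; auto.
         eapply is_derive_ext_loc; [|apply (is_derive_const_R 0)].
         exists (mkposreal (d / 2) ltac:(lra)). intros z Hz.
         change (Rabs (z - q) < d / 2) in Hz. apply Rabs_def2 in Hz.
         simpl; rewrite Far; lra.
      -- eapply is_derive_ext; [|apply (is_derive_const_R 0)].
         intros; simpl; rewrite Far; lra.
  + apply IHk; auto; intros x q t; intros; unfold Dx; 
      (rewrite (Derive_ext _ (fun _ => 0)); [apply Derive_const|]; intros; auto).
  + apply IHk; auto; intros x q t; intros; unfold Dq.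
    * rewrite (Derive_ext_loc _ (fun _ => 0)); [apply Derive_const|].
      apply (locally_interval _ q (d / 2) d); simpl; try lra. intros; apply Z0; auto.
    * rewrite (Derive_ext_loc _ (fun _ => 0)); [apply Derive_const|].
      generalize (Rabs_lt_locally d q H). apply filter_imp. auto.
    * rewrite (Derive_ext_loc _ (fun _ => 0)); [apply Derive_const|].
      generalize (Rabs_lt_locally d q H). apply filter_imp. auto.
  + apply IHk; auto; intros x q t; intros; unfold Dt.
    * rewrite (Derive_ext _ (fun _ => 0)); [apply Derive_const|]. auto.
    * rewrite (Derive_ext_loc _ (fun _ => 0)); [apply Derive_const|].
      apply (locally_interval _ t m_infty (/ 4)); simpl; auto.
    * rewrite (Derive_ext_loc _ (fun _ => 0)); [apply Derive_const|].
      apply (locally_interval _ t (3 / 4) p_infty); simpl; auto.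
Qed.

Lemma periodize_periodic (d : R) (f : R -> R -> R -> R) (x q t : R) :
  periodize d f x q (t + 1) = periodize d f x q t.
Proof.
unfold periodize. destruct Rlt_dec; auto. f_equal.
destruct (base_Int_part t) as [A1 A2]. destruct (base_Int_part (t + 1)) as [B1 B2].
unfold frac_part.
assert (E : (Int_part (t + 1) = Int_part t + 1)%Z).
{ apply Z.le_antisymm; apply Z.lt_succ_r; apply lt_IZR; rewrite succ_IZR, ?plus_IZR; lra. }
rewrite E, plus_IZR. ring.
Qed.

(** The truncated power of exponent [S n], of class C^n; it serves in place of a flat exponential,
    since only finite smoothness is asked for. *)
Definition ramp (n : nat) (x : R) : R := x ^ n * Rmax 0 x.

Lemma Rmax_0_le_abs (y : R) : 0 <= Rmax 0 y <= Rabs y.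
Proof.
split. apply Rmax_l. apply Rmax_lub. apply Rabs_pos. apply Rle_abs.
Qed.

Lemma ramp_derive (n : nat) (x : R) :
  is_derive (ramp (S n)) x (INR (S (S n)) * ramp n x).
Proof.
unfold ramp. destruct (Rtotal_order x 0) as [L|[E|G]].
- rewrite Rmax_left by lra. rewrite !Rmult_0_r.
  eapply is_derive_ext_loc; [|apply (is_derive_const_R 0)].
  apply (locally_interval _ x m_infty 0); simpl; auto.
  intros y _ Hy. rewrite Rmax_left by lra. symmetry; apply Rmult_0_r.
- subst x. rewrite Rmax_left by lra. rewrite !Rmult_0_r.
  apply is_derive_eps. intros e He. exists (Rmin 1 e). split; [apply Rmin_pos; lra|].
  intros y Hy. split_Rmin. rewrite Rminus_0_r in *.
  rewrite (Rmax_left 0 0), Rmult_0_r, Rmult_0_l, !Rminus_0_r by lra.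
  rewrite Rabs_mult. destruct (Rmax_0_le_abs y) as [A B]. rewrite (Rabs_pos_eq (Rmax 0 y)) by auto.
  apply Rmult_le_compat; auto using Rabs_pos.
  simpl. rewrite Rabs_mult, <- RPow_abs.
  destruct (pow_unit (Rabs y) n). split; auto using Rabs_pos; lra.
  pose proof (Rabs_pos y). nra.
- rewrite Rmax_right by lra.
  apply (is_derive_ext_loc (fun x => x ^ (S (S n)))).
  + apply (locally_interval _ x 0 p_infty); simpl; auto.
    intros y Hy _. rewrite Rmax_right by lra. ring.
  + auto_derive; auto. change (Nat.pred (S (S n))) with (S n).
    rewrite S_INR. simpl. ring.
Qed.

Lemma Cs_ramp (d : R) (k n : nat) (f : R -> R -> R -> R) :
  (k <= n)%nat -> Cs d k f -> Cs d k (fun x q t => ramp n (f x q t)).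
Proof.
revert n; induction k; intros n Hn H.
- destruct H as [H _]. split; auto. intros. apply (cont3_comp1 (ramp n)); auto.
  destruct n.
  + apply continuous_ext with (fun y => (y + Rabs y) / 2).
    { intros y. unfold ramp, Rmax, Rabs. destruct Rle_dec, Rcase_abs; simpl; lra. }
    apply continuous_mult_R. 2: apply continuous_const.
    apply (@continuous_plus _ _ R_NormedModule). apply continuous_id.
    apply continuous_Rabs.
  + apply derivable_continuous_R. eexists; apply ramp_derive.
- destruct n; [lia|].
  assert (G := IHk n ltac:(lia) (Cs_pred _ _ _ H)). apply Cs_D in H.
  destruct H as (P & A & B & C).
  assert (L : forall h, Cs d k h -> Cs d k (fun x q t => h x q t * (INR (S (S n)) * ramp n (f x q t)))).
  { intros; apply Cs_mult; auto; apply Cs_scal; auto. }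
  eapply Cs_S; [| apply (L _ A) | apply (L _ B) | apply (L _ C)].
  intros x q t Hq. destruct (P x q t Hq) as (X & Q & T). split; [|split].
  + apply (is_derive_comp (ramp (S n)) (fun z => f z q t)); auto. apply ramp_derive.
  + apply (is_derive_comp (ramp (S n)) (fun z => f x z t)); auto. apply ramp_derive.
  + apply (is_derive_comp (ramp (S n)) (fun z => f x q z)); auto. apply ramp_derive.
Qed.

Definition step (n : nat) (a b x : R) : R :=
  ramp n (x - a) / (ramp n (x - a) + ramp n (b - x)).

Lemma ramp_pos (n : nat) (x : R) : 0 < x -> 0 < ramp n x.
Proof.
intros H. unfold ramp. rewrite Rmax_right by lra. apply Rmult_lt_0_compat; auto.
apply pow_lt; auto.
Qed.

Lemma ramp_0 (n : nat) (x : R) : x <= 0 -> ramp n x = 0.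
Proof. intros H. unfold ramp. rewrite Rmax_left by lra. ring. Qed.

Lemma ramp_nonneg (n : nat) (x : R) : 0 <= ramp n x.
Proof.
destruct (Rlt_le_dec 0 x). left; apply ramp_pos; auto. rewrite ramp_0; lra.
Qed.

Lemma step_denom (n : nat) (a b x : R) : a < b -> 0 < ramp n (x - a) + ramp n (b - x).
Proof.
intros H. generalize (ramp_nonneg n (x - a)) (ramp_nonneg n (b - x)). intros.
destruct (Rlt_le_dec a x). generalize (ramp_pos n (x - a)); lra.
generalize (ramp_pos n (b - x)); lra.
Qed.

Lemma step_bounds (n : nat) (a b x : R) : a < b -> 0 <= step n a b x <= 1.
Proof.
intros H. generalize (step_denom n a b x H) (ramp_nonneg n (x - a)) (ramp_nonneg n (b - x)).
intros. unfold step. split. apply Rdiv_le_0_compat; auto.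
apply Rmult_le_reg_r with (ramp n (x - a) + ramp n (b - x)); auto.
replace (ramp n (x - a) / (ramp n (x - a) + ramp n (b - x)) * (ramp n (x - a) + ramp n (b - x)))
  with (ramp n (x - a)) by (field; lra). lra.
Qed.

Lemma step_0 (n : nat) (a b x : R) : x <= a -> step n a b x = 0.
Proof. intros H. unfold step. rewrite (ramp_0 n (x - a)) by lra. apply Rmult_0_l. Qed.

Lemma step_1 (n : nat) (a b x : R) : a < b -> b <= x -> step n a b x = 1.
Proof.
intros H H'. unfold step. rewrite (ramp_0 n (b - x)) by lra.
generalize (ramp_pos n (x - a)). intros. field. lra.
Qed.

Lemma Cs_step (d a b : R) (k n : nat) (f : R -> R -> R -> R) :
  a < b -> (k <= n)%nat -> Cs d k f -> Cs d k (fun x q t => step n a b (f x q t)).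
Proof.
intros Hab Hn H. apply Cs_div.
- intros x q t _. generalize (step_denom n a b (f x q t) Hab). lra.
- apply Cs_ramp; auto. apply Cs_minus; auto. apply Cs_const.
- apply Cs_plus; apply Cs_ramp; auto; apply Cs_minus; auto; apply Cs_const.
Qed.

Lemma periodic_IZR (f : R -> R) (n : Z) (x : R) :
  (forall x, f (x + 1) = f x) -> f (x + IZR n) = f x.
Proof.
intros H. revert n x.
assert (P : forall n x, f (x + INR n) = f x).
{ induction n; intros x. rewrite Rplus_0_r; auto.
  rewrite S_INR, <- Rplus_assoc, H. auto. }
intros n x. destruct (Z_le_dec 0 n) as [L|L].
- rewrite <- (Z2Nat.id n L), <- INR_IZR_INZ. apply P.
- rewrite <- (P (Z.to_nat (- n)) (x + IZR n)), INR_IZR_INZ, Z2Nat.id, opp_IZR by lia.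
  f_equal. ring.
Qed.

Lemma periodic_bounded (d d' : R) (f : R -> R -> R -> R) :
  0 < d' < d -> (forall x q t, Rabs q < d -> cont3 f x q t) ->
  (forall x q t, Rabs q < d -> f (x + 1) q t = f x q t) ->
  exists K, 0 < K /\ forall x q, Rabs q <= d' -> Rabs (f x q 0) <= K.
Proof.
intros Hd C P.
destruct (cont3_bounded_box f 0 1 (- d') d' 0 0) as [K [K0 HK]].
- intros x q t _ Hq _. apply C. apply Rabs_def1; lra.
- exists K. split; auto. intros x q Hq.
  assert (Hq' : Rabs q < d) by lra.
  replace x with (frac_part x + IZR (Int_part x)) by (unfold frac_part; ring).
  rewrite (periodic_IZR (fun x => f x q 0)); auto.
  destruct (base_fp x). apply Rabs_le_between in Hq. apply HK; lra.
Qed.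


(** * Uniqueness for Hamilton's equations *)

Lemma is_derive_on_unique (D : R -> Prop) (f : R -> R) (x l l' : R) :
  D x -> (forall d, 0 < d -> exists y, D y /\ 0 < Rabs (y - x) < d) ->
  is_derive_on D f x l -> is_derive_on D f x l' -> l = l'.
Proof.
intros Dx Acc H H'. apply Rminus_diag_uniq.
destruct (Req_dec (l - l') 0) as [E|N]; auto. exfalso.
assert (P := Rabs_pos_lt _ N). set (e := Rabs (l - l') / 4). assert (He : 0 < e) by (unfold e; lra).
destruct (proj1 (is_derive_on_eps _ _ _ _ Dx) H e He) as [d [Hd K]].
destruct (proj1 (is_derive_on_eps _ _ _ _ Dx) H' e He) as [d' [Hd' K']].
destruct (Acc (Rmin d d') (Rmin_pos _ _ Hd Hd')) as (y & Dy & Y1 & Y2). split_Rmin.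
specialize (K y Dy ltac:(auto)). specialize (K' y Dy ltac:(auto)).
assert (B : Rabs ((l - l') * (y - x)) <= 2 * e * Rabs (y - x)).
{ replace ((l - l') * (y - x)) with
   ((f y - f x - l' * (y - x)) - (f y - f x - l * (y - x))) by ring.
  eapply Rle_trans; [apply Rabs_triang|]. rewrite Rabs_Ropp. lra. }
rewrite Rabs_mult in B. apply Rmult_le_reg_r in B; auto. unfold e in B. lra.
Qed.

(** Retraction onto the unit interval. Precomposition with it turns continuity on the closed
    interval, one-sided at the ends, into two-sided continuity, as the mean value theorem
    demands. *)
Definition clamp (t : R) : R := Rmax 0 (Rmin t 1).

Lemma clamp_id (t : R) : 0 <= t <= 1 -> clamp t = t.
Proof. intros H. unfold clamp. rewrite Rmin_left, Rmax_right; lra. Qed.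

Lemma clamp_bounds (t : R) : 0 <= clamp t <= 1.
Proof. unfold clamp, Rmax, Rmin. repeat destruct Rle_dec; lra. Qed.

Lemma clamp_lip (s t : R) : Rabs (clamp s - clamp t) <= Rabs (s - t).
Proof.
unfold clamp, Rmax, Rmin, Rabs. repeat destruct Rle_dec; repeat destruct Rcase_abs; lra.
Qed.

Definition unit_interval (t : R) : Prop := 0 <= t <= 1.

Lemma clamp_continuous (u u' : R -> R) :
  (forall t, 0 <= t <= 1 -> is_derive_on unit_interval u t (u' t)) ->
  forall s, continuous (fun t => u (clamp t)) s.
Proof.
intros H s. apply filterlim_locally. intros e.
set (t := clamp s). assert (Ht := clamp_bounds s). fold t in Ht.
destruct (proj1 (is_derive_on_eps _ _ _ _ Ht) (H t Ht) 1 Rlt_0_1) as [d [Hd K]].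
set (M := Rabs (u' t) + 1). assert (HM : 0 < M) by (unfold M; generalize (Rabs_pos (u' t)); lra).
assert (Hr : 0 < Rmin d (e / M)).
{ apply Rmin_pos; auto. apply Rdiv_lt_0_compat; auto. apply cond_pos. }
exists (mkposreal _ Hr). intros y Hy. change (Rabs (y - s) < Rmin d (e / M)) in Hy. split_Rmin.
assert (L := clamp_lip y s). fold t in L.
specialize (K (clamp y) (clamp_bounds y) ltac:(lra)).
change (Rabs (u (clamp y) - u t) < e).
replace (u (clamp y) - u t) with ((u (clamp y) - u t - u' t * (clamp y - t)) + u' t * (clamp y - t)) by ring.
eapply Rle_lt_trans; [apply Rabs_triang|]. rewrite (Rabs_mult (u' t)).
apply Rle_lt_trans with (M * Rabs (y - s)).
- unfold M. pose proof (Rabs_pos (u' t)).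
  apply Rmult_le_compat_l with (r := Rabs (u' t)) in L as L'; lra.
- apply Rmult_lt_reg_r with (/ M). apply Rinv_0_lt_compat; auto.
  replace (M * Rabs (y - s) * / M) with (Rabs (y - s)) by (field; lra). auto.
Qed.

Lemma locally_unit (t : R) : 0 < t < 1 -> locally t unit_interval.
Proof.
intros H. apply (locally_interval _ t 0 1); simpl; try lra. intros; unfold unit_interval; lra.
Qed.

Lemma nonincreasing_clamp (u u' : R -> R) :
  (forall s, continuous (fun t => u (clamp t)) s) ->
  (forall t, 0 < t < 1 -> is_derive u t (u' t) /\ u' t <= 0) ->
  forall t, 0 <= t <= 1 -> u t <= u 0.
Proof.
intros C H t Ht. destruct (Req_dec t 0) as [->|N]; [lra|].
(* The intermediate point may be an end of the interval, where no derivative is assumed; the value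
   [0] there keeps the derivative nonpositive. *)
destruct (MVT_gen (fun s => u (clamp s)) 0 t (fun s => if Rlt_dec 0 s then if Rlt_dec s 1 then u' s else 0 else 0)) as [z [Hz E]];
  rewrite ?Rmin_left, ?Rmax_right in * by lra.
- intros s Hs. destruct Rlt_dec; [|lra]. destruct Rlt_dec; [|lra].
  eapply is_derive_ext_loc; [|apply H; lra].
  generalize (locally_unit s ltac:(lra)). apply filter_imp. intros y Hy. rewrite clamp_id; auto.
- intros s _. apply continuity_pt_filterlim, C.
- rewrite !clamp_id in E by lra.
  assert (u' z <= 0 \/ ~ (0 < z /\ z < 1)).
  { destruct (classic (0 < z /\ z < 1)); auto. left. apply H. lra. }
  destruct (Rlt_dec 0 z); [destruct (Rlt_dec z 1)|]; [|lra|lra].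
  assert (u' z * (t - 0) <= 0); [|lra].
  destruct H0 as [A|A]; [|lra]. nra.
Qed.

(** Boundedness is included so that products stay in the class. The condition [0 < q] keeps segments
    in the open half-space, where one-sided derivatives in [q] are ordinary ones. *)
Definition LipB (N M : R) (f : R -> R -> R -> R) : Prop :=
  exists K, 0 < K /\
    (forall x q t, Rabs x <= N -> 0 < q <= M -> 0 <= t <= 1 -> Rabs (f x q t) <= K) /\
    (forall x1 q1 x2 q2 t, Rabs x1 <= N -> 0 < q1 <= M -> Rabs x2 <= N -> 0 < q2 <= M ->
       0 <= t <= 1 -> Rabs (f x1 q1 t - f x2 q2 t) <= K * (Rabs (x1 - x2) + Rabs (q1 - q2))).

Lemma half_bounded (f : R -> R -> R -> R) (N M : R) :
  continuous_half f ->
  exists K, 0 < K /\ forall x q t, Rabs x <= N -> 0 <= q <= M -> 0 <= t <= 1 ->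
    Rabs (f x q t) <= K.
Proof.
intros C.
(* Freezing [q] at [0] for negative values gives a function continuous in the full sense, to which
   compactness applies. *)
destruct (cont3_bounded_box (fun x q t => f x (Rmax 0 q) t) (- N) N 0 M 0 1) as [K [K0 HK]].
- intros x q t Hx Hq Ht. apply cont3_eps. intros e He.
  destruct (proj1 (filterlim_locally _ _) (C x q t (proj1 Hq)) (mkposreal e He)) as [d Hd].
  exists d; split; [apply cond_pos|]. intros x' q' t' A B D.
  rewrite (Rmax_right 0 q) by lra.
  apply (Hd (x', Rmax 0 q', t')).
  + split; [split|]; auto. change (Rabs (Rmax 0 q' - q) < d).
    eapply Rle_lt_trans; [|exact B].
    unfold Rmax, Rabs. destruct Rle_dec; repeat destruct Rcase_abs; lra.
  + apply Rmax_l.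
- exists K. split; auto. intros x q t Hx Hq Ht.
  rewrite <- (Rmax_right 0 q) by lra. apply HK; auto. apply Rabs_le_between; auto.
Qed.

Lemma locally_pos (q : R) : 0 < q -> locally q (fun z => 0 <= z).
Proof.
intros H. apply (locally_interval _ q 0 p_infty); simpl; auto. intros; lra.
Qed.

Lemma LipB_Ck_half (N M : R) (f : R -> R -> R -> R) : Ck_half 1 f -> LipB N M f.
Proof.
intros [C [fx [fq [ft [P [[Cx _] [[Cq _] _]]]]]]].
destruct (half_bounded f N M C) as [K1 [P1 B1]].
destruct (half_bounded fx N M Cx) as [K2 [P2 B2]].
destruct (half_bounded fq N M Cq) as [K3 [P3 B3]].
exists (K1 + K2 + K3). split; [lra|]. split.
- intros x q t Hx Hq Ht. specialize (B1 x q t Hx ltac:(lra) Ht). lra.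
- intros x1 q1 x2 q2 t X1 Q1 X2 Q2 Ht.
  assert (E1 : Rabs (f x1 q1 t - f x2 q1 t - 0 * (x1 - x2)) <= K2 * Rabs (x1 - x2)).
  { apply (mvt_linear_bound (fun z => f z q1 t) (fun z => fx z q1 t)).
    - intros z _. destruct (P z q1 t ltac:(lra)) as (A & _). exact A.
    - intros z Hz. rewrite Rminus_0_r. apply B2; auto; try lra.
      apply Rabs_le_between in X1, X2. apply Rabs_le_between.
      unfold Rmin, Rmax in Hz; destruct Rle_dec; lra. }
  assert (E2 : Rabs (f x2 q1 t - f x2 q2 t - 0 * (q1 - q2)) <= K3 * Rabs (q1 - q2)).
  { apply (mvt_linear_bound (fun z => f x2 z t) (fun z => fq x2 z t)).
    - intros z Hz. assert (Z : 0 < z) by (unfold Rmin, Rmax in Hz; destruct Rle_dec; lra).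
      destruct (P x2 z t ltac:(lra)) as (_ & A & _).
      exact (is_derive_of_is_derive_on _ _ _ _ (locally_pos z Z) A).
    - intros z Hz. rewrite Rminus_0_r. apply B3; auto; try lra.
      unfold Rmin, Rmax in Hz; destruct Rle_dec; lra. }
  replace (f x1 q1 t - f x2 q2 t) with
   ((f x1 q1 t - f x2 q1 t - 0 * (x1 - x2)) + (f x2 q1 t - f x2 q2 t - 0 * (q1 - q2))) by ring.
  eapply Rle_trans; [apply Rabs_triang|].
  pose proof (Rabs_pos (x1 - x2)). pose proof (Rabs_pos (q1 - q2)).
  assert (K2 * Rabs (x1 - x2) <= (K1 + K2 + K3) * Rabs (x1 - x2)) by (apply Rmult_le_compat_r; lra).
  assert (K3 * Rabs (q1 - q2) <= (K1 + K2 + K3) * Rabs (q1 - q2)) by (apply Rmult_le_compat_r; lra).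
  lra.
Qed.

Lemma LipB_plus (N M : R) (f g : R -> R -> R -> R) :
  LipB N M f -> LipB N M g -> LipB N M (fun x q t => f x q t + g x q t).
Proof.
intros [K [P [A B]]] [K' [P' [A' B']]]. exists (K + K'). split; [lra|]. split.
- intros x q t Hx Hq Ht. eapply Rle_trans; [apply Rabs_triang|].
  specialize (A x q t Hx Hq Ht). specialize (A' x q t Hx Hq Ht). lra.
- intros x1 q1 x2 q2 t X1 Q1 X2 Q2 Ht.
  specialize (B x1 q1 x2 q2 t X1 Q1 X2 Q2 Ht). specialize (B' x1 q1 x2 q2 t X1 Q1 X2 Q2 Ht).
  replace (f x1 q1 t + g x1 q1 t - (f x2 q2 t + g x2 q2 t)) with
   ((f x1 q1 t - f x2 q2 t) + (g x1 q1 t - g x2 q2 t)) by ring.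
  eapply Rle_trans; [apply Rabs_triang|]. lra.
Qed.

Lemma LipB_mult (N M : R) (f g : R -> R -> R -> R) :
  LipB N M f -> LipB N M g -> LipB N M (fun x q t => f x q t * g x q t).
Proof.
intros [K [P [A B]]] [K' [P' [A' B']]].
assert (PP : 0 < K * K') by (apply Rmult_lt_0_compat; auto).
exists (2 * (K * K')). split; [lra|]. split.
- intros x q t Hx Hq Ht. rewrite Rabs_mult.
  specialize (A x q t Hx Hq Ht). specialize (A' x q t Hx Hq Ht).
  assert (Rabs (f x q t) * Rabs (g x q t) <= K * K') by (apply Rmult_le_compat; auto using Rabs_pos). lra.
- intros x1 q1 x2 q2 t X1 Q1 X2 Q2 Ht.
  specialize (B x1 q1 x2 q2 t X1 Q1 X2 Q2 Ht). specialize (B' x1 q1 x2 q2 t X1 Q1 X2 Q2 Ht).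
  specialize (A x1 q1 t X1 Q1 Ht). specialize (A' x2 q2 t X2 Q2 Ht).
  replace (f x1 q1 t * g x1 q1 t - f x2 q2 t * g x2 q2 t) with
   (f x1 q1 t * (g x1 q1 t - g x2 q2 t) + (f x1 q1 t - f x2 q2 t) * g x2 q2 t) by ring.
  eapply Rle_trans; [apply Rabs_triang|]. rewrite !Rabs_mult.
  set (n := Rabs (x1 - x2) + Rabs (q1 - q2)) in *.
  assert (Rabs (f x1 q1 t) * Rabs (g x1 q1 t - g x2 q2 t) <= K * (K' * n)) by (apply Rmult_le_compat; auto using Rabs_pos).
  assert (Rabs (f x1 q1 t - f x2 q2 t) * Rabs (g x2 q2 t) <= K * n * K') by (apply Rmult_le_compat; auto using Rabs_pos).
  lra.
Qed.

Lemma LipB_const (N M c : R) : LipB N M (fun _ _ _ => c).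
Proof.
pose proof (Rabs_pos c). exists (Rabs c + 1). split; [lra|]. split.
- intros; lra.
- intros. rewrite Rminus_diag, Rabs_R0.
  apply Rmult_le_pos; [lra|]. generalize (Rabs_pos (x1 - x2)) (Rabs_pos (q1 - q2)); lra.
Qed.

Lemma LipB_q (N M : R) : LipB N M (fun _ q _ => q).
Proof.
pose proof (Rabs_pos M). exists (Rabs M + 1). split; [lra|]. split.
- intros x q t _ Hq _. rewrite Rabs_pos_eq by lra. generalize (Rle_abs M); lra.
- intros x1 q1 x2 q2 t _ _ _ _ _. generalize (Rabs_pos (x1 - x2)) (Rabs_pos (q1 - q2)); intros.
  nra.
Qed.

Lemma LipB_pow (N M : R) (n : nat) : LipB N M (fun _ q _ => q ^ n).
Proof.
induction n; simpl. apply LipB_const. apply (LipB_mult N M (fun _ q _ => q)); auto. apply LipB_q.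
Qed.

(** The derivative of [hamiltonian] in [l], written in [q = sqrt l]: the factor
    [dq / dl = 1 / (2 q)] is absorbed by the powers of [q], so the formula extends to [q = 0]. *)
Definition ham_dl (V Vq : R -> R -> R -> R) (x q t : R) : R :=
  sqrt 2 * q + 5 / 2 * q ^ 3 * V x q t + / 2 * q ^ 4 * Vq x q t.

Lemma hamiltonian_dx (V : R -> R -> R -> R) (x l t v : R) :
  is_derive (fun z => V z (sqrt l) t) x v ->
  is_derive (fun z => hamiltonian V z l t) x (sqrt l ^ 5 * v).
Proof.
intros H. unfold hamiltonian. rewrite <- (Rplus_0_l (sqrt l ^ 5 * v)).
apply is_derive_plus_R.
apply is_derive_const_R.
apply (is_derive_scal (fun z => V z (sqrt l) t)); auto.
Qed.

Lemma hamiltonian_dl (V Vq : R -> R -> R -> R) (x l t : R) :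
  0 <= l -> continuous_half V ->
  is_derive_on (fun z => 0 <= z) (fun z => V x z t) (sqrt l) (Vq x (sqrt l) t) ->
  is_derive_on (fun z => 0 <= z) (fun z => hamiltonian V x z t) l (ham_dl V Vq x (sqrt l) t).
Proof.
intros Hl C HV. destruct Hl as [Hl|<-].
- assert (S : 0 < sqrt l) by (apply sqrt_lt_R0; auto).
  apply is_derive_on_of_is_derive; [lra|].
  assert (HV' := is_derive_of_is_derive_on _ _ _ _ (locally_pos _ S) HV).
  assert (HS := is_derive_sqrt (fun z => z) l 1 (is_derive_id_R l) Hl).
  simpl in HS.
  assert (G : is_derive (fun s => 2 * sqrt 2 / 3 * s ^ 3 + s ^ 5 * V x s t) (sqrt l)
     (2 * sqrt 2 * sqrt l ^ 2 + (5 * sqrt l ^ 4 * V x (sqrt l) t + sqrt l ^ 5 * Vq x (sqrt l) t))).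
  { apply is_derive_plus_R.
    - auto_derive; auto. field.
    - apply (is_derive_mult_R (fun s => s ^ 5) (fun s => V x s t)); auto.
      auto_derive; auto. ring. apply Rmult_comm. }
  assert (R := is_derive_comp _ sqrt l _ _ G HS).
  unfold hamiltonian, ham_dl. revert R. unfold scal; simpl; unfold mult; simpl.
  intros R. replace (sqrt 2 * sqrt l + 5 / 2 * (sqrt l * (sqrt l * (sqrt l * 1))) * V x (sqrt l) t +
    / 2 * (sqrt l * (sqrt l * (sqrt l * (sqrt l * 1)))) * Vq x (sqrt l) t) with
    (1 / (2 * sqrt l) *
      (2 * sqrt 2 * (sqrt l * (sqrt l * 1)) +
       (5 * (sqrt l * (sqrt l * (sqrt l * (sqrt l * 1)))) * V x (sqrt l) t +
        sqrt l * (sqrt l * (sqrt l * (sqrt l * (sqrt l * 1)))) * Vq x (sqrt l) t)))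
    by (field; lra). exact R.
(* At [l = 0] the square root has no derivative, but near [0] the Hamiltonian is bounded by
   [A * sqrt l ^ 3], hence is [o(l)]; the radius [(e / A) ^ 2] makes [A * sqrt y <= e]. *)
- rewrite sqrt_0. replace (ham_dl V Vq x 0 t) with 0 by (unfold ham_dl; ring).
  apply is_derive_on_eps; [lra|]. intros e He.
  destruct (half_bounded (fun _ q _ => V x q t) 0 1) as [K [K0 HK]].
  { intros x' q t' Hq.
    intros P HP. destruct (C x q t Hq P HP) as [r Hr]. exists r.
    intros [[a b] c] [[B1 B2] B3] B4. apply (Hr (x, b, t)); auto.
    split; [split|]; auto using ball_center. }
  set (A := 2 * sqrt 2 / 3 + K).
  assert (S2 : 0 < sqrt 2) by (apply sqrt_lt_R0; lra).
  assert (HA : 0 < A) by (unfold A; lra).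
  exists (Rmin 1 ((e / A) ^ 2)). split.
  { apply Rmin_pos; [lra|]. apply pow_lt. apply Rdiv_lt_0_compat; auto. }
  intros y Hy Hd. split_Rmin. rewrite Rminus_0_r in *. rewrite Rabs_pos_eq in * by auto.
  unfold hamiltonian. rewrite sqrt_0.
  set (s := sqrt y). assert (Hs : 0 <= s) by apply sqrt_pos.
  assert (Y : y = s ^ 2) by (unfold s; rewrite pow2_sqrt; auto).
  assert (S1 : s <= 1). { unfold s. rewrite <- sqrt_1. apply sqrt_le_1_alt; lra. }
  assert (S3 : A * s <= e).
  { assert (s < e / A).
    { unfold s. rewrite <- (sqrt_pow2 (e / A)). apply sqrt_lt_1_alt; lra.
      left; apply Rdiv_lt_0_compat; auto. }
    left. replace e with (A * (e / A)) by (field; lra). apply Rmult_lt_compat_l; auto. }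
  specialize (HK 0 s 0 ltac:(rewrite Rabs_R0; lra) ltac:(lra) ltac:(lra)).
  rewrite Y.
  replace (2 * sqrt 2 / 3 * s ^ 3 + s ^ 5 * V x s t - (2 * sqrt 2 / 3 * 0 ^ 3 + 0 ^ 5 * V x 0 t) - 0 * s ^ 2)
    with ((2 * sqrt 2 / 3 * s + s ^ 3 * V x s t) * s ^ 2) by ring.
  rewrite Rabs_mult, (Rabs_pos_eq (s ^ 2)) by (apply pow2_ge_0).
  apply Rmult_le_compat_r; [apply pow2_ge_0|].
  eapply Rle_trans; [|exact S3].
  eapply Rle_trans; [apply Rabs_triang|]. rewrite (Rabs_mult (s ^ 3)).
  rewrite (Rabs_pos_eq (2 * sqrt 2 / 3 * s)), (Rabs_pos_eq (s ^ 3)) by (try apply pow_le; try apply Rmult_le_pos; lra).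
  unfold A. rewrite Rmult_plus_distr_r. apply Rplus_le_compat_l.
  rewrite (Rmult_comm K). apply Rmult_le_compat; auto using Rabs_pos. apply pow_le; auto.
  simpl. rewrite Rmult_1_r. rewrite <- (Rmult_1_r s) at 4.
  apply Rmult_le_compat_l; auto. nra.
Qed.

Section Flow.

Variables (V Vx Vq : R -> R -> R -> R).
Hypothesis CV : Ck_half 1 V.
Hypothesis CVx : Ck_half 1 Vx.
Hypothesis CVq : Ck_half 1 Vq.
Hypothesis DV : forall x q t, 0 <= q ->
  is_derive (fun z => V z q t) x (Vx x q t) /\
  is_derive_on (fun z => 0 <= z) (fun z => V x z t) q (Vq x q t).

(** Uniqueness of derivatives identifies the existential [Hx] and [Hl] with explicit functions of
    [sqrt l], turning Hamilton's equations into an ordinary system. *)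
Lemma hamilton_solution_iff (X L : R -> R) :
  hamilton_solution (hamiltonian V) 1 X L <->
  forall t, 0 <= t <= 1 -> 0 <= L t /\
    is_derive_on unit_interval X t (ham_dl V Vq (X t) (sqrt (L t)) t) /\
    is_derive_on unit_interval L t (- (sqrt (L t) ^ 5 * Vx (X t) (sqrt (L t)) t)).
Proof.
assert (HX : forall x l t, is_derive (fun z => hamiltonian V z l t) x (sqrt l ^ 5 * Vx x (sqrt l) t)).
{ intros. apply hamiltonian_dx. apply DV. apply sqrt_pos. }
assert (HL : forall x l t, 0 <= l -> is_derive_on (fun z => 0 <= z) (fun z => hamiltonian V x z t) l (ham_dl V Vq x (sqrt l) t)).
{ intros. apply hamiltonian_dl; auto. apply CV. apply DV. apply sqrt_pos. }
split.
- intros H t Ht. destruct (H t Ht) as (L0 & Hx & Hl & A & B & C & D). split; auto.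
  assert (E1 : Hx = sqrt (L t) ^ 5 * Vx (X t) (sqrt (L t)) t).
  { rewrite <- (is_derive_unique _ _ _ A). apply is_derive_unique, HX. }
  assert (E2 : Hl = ham_dl V Vq (X t) (sqrt (L t)) t).
  { eapply (is_derive_on_unique (fun z => 0 <= z)); [exact L0| |exact B|apply HL; auto].
    intros d Hd. exists (L t + d / 2). split. lra.
    replace (L t + d / 2 - L t) with (d / 2) by ring. rewrite Rabs_pos_eq; lra. }
  rewrite <- E1, <- E2. auto.
- intros H t Ht. destruct (H t Ht) as (L0 & A & B). split; auto.
  exists (sqrt (L t) ^ 5 * Vx (X t) (sqrt (L t)) t), (ham_dl V Vq (X t) (sqrt (L t)) t).
  split; [|split; [|split]]; auto.
Qed.

Lemma solution_bounded (u u' : R -> R) :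
  (forall t, 0 <= t <= 1 -> is_derive_on unit_interval u t (u' t)) ->
  exists K, 0 < K /\ forall t, 0 <= t <= 1 -> Rabs (u t) <= K.
Proof.
intros H. assert (C := clamp_continuous u u' H).
destruct (cont3_bounded_box (fun x _ _ => u (clamp x)) 0 1 0 0 0 0) as [K [K0 HK]].
- intros x y z _ _ _. apply (cont3_comp1 (fun t => u (clamp t))). apply C. apply cont3_x.
- exists K; split; auto. intros t Ht. rewrite <- (clamp_id t Ht). apply (HK t 0 0); lra.
Qed.

Lemma exp_continuous (c s : R) : continuous (fun t => exp (c * clamp t)) s.
Proof.
apply (continuous_comp (fun t => c * clamp t) exp).
- apply continuous_mult_R. apply continuous_const.
  apply filterlim_locally. intros e. exists e. intros y Hy.
  eapply Rle_lt_trans; [apply clamp_lip|exact Hy].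
- apply derivable_continuous_R. auto_derive. auto.
Qed.

(** The force contains [sqrt l ^ 5], so the derivative of [L] is bounded by [C * L] along a
    solution; monotonicity of [L * exp (- C * t)] and of [L * exp (C * t)] then excludes both
    leaving and reaching [l = 0]. *)
Lemma solution_L_sign (X L : R -> R) :
  hamilton_solution (hamiltonian V) 1 X L ->
  (L 0 = 0 -> forall t, 0 <= t <= 1 -> L t = 0) /\
  (0 < L 0 -> forall t, 0 <= t <= 1 -> 0 < L t).
Proof.
intros H. rewrite hamilton_solution_iff in H.
destruct (solution_bounded X _ (fun t Ht => proj1 (proj2 (H t Ht)))) as [N [_ BX]].
destruct (solution_bounded L _ (fun t Ht => proj2 (proj2 (H t Ht)))) as [M [M0 BL]].
destruct (half_bounded Vx N (sqrt M) (proj1 CVx)) as [K [K0 BK]].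
set (C := sqrt M ^ 3 * K).
assert (C0 : 0 <= C) by (apply Rmult_le_pos; [apply pow_le, sqrt_pos | lra]).
assert (B : forall t, 0 <= t <= 1 -> Rabs (sqrt (L t) ^ 5 * Vx (X t) (sqrt (L t)) t) <= C * L t).
{ intros t Ht. destruct (H t Ht) as [L0 _].
  assert (BLt := BL t Ht). rewrite Rabs_pos_eq in BLt by auto.
  assert (S : sqrt (L t) <= sqrt M) by (apply sqrt_le_1_alt; auto).
  assert (S0 := sqrt_pos (L t)).
  specialize (BK (X t) (sqrt (L t)) t (BX t Ht) ltac:(lra) Ht).
  replace (sqrt (L t) ^ 5) with (sqrt (L t) ^ 3 * L t) by (rewrite <- (pow2_sqrt (L t)) at 2; auto; ring).
  rewrite !Rabs_mult, (Rabs_pos_eq (L t)), (Rabs_pos_eq (sqrt (L t) ^ 3)) by (auto; apply pow_le; auto).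
  replace (sqrt (L t) ^ 3 * L t * Rabs (Vx (X t) (sqrt (L t)) t)) with
    (sqrt (L t) ^ 3 * Rabs (Vx (X t) (sqrt (L t)) t) * L t) by ring.
  apply Rmult_le_compat_r; auto. apply Rmult_le_compat; auto using Rabs_pos.
  apply pow_le; auto. apply pow_incr; auto. }
assert (CL := clamp_continuous L _ (fun t Ht => proj2 (proj2 (H t Ht)))).
assert (DL : forall t, 0 < t < 1 -> is_derive L t (- (sqrt (L t) ^ 5 * Vx (X t) (sqrt (L t)) t))).
{ intros t Ht. apply (is_derive_of_is_derive_on unit_interval). apply locally_unit; auto.
  apply H; lra. }
assert (DE : forall c t, 0 < t < 1 -> is_derive (fun t => L t * exp (c * t)) t
   ((- (sqrt (L t) ^ 5 * Vx (X t) (sqrt (L t)) t) + c * L t) * exp (c * t))).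
{ intros c t Ht.
  replace ((- (sqrt (L t) ^ 5 * Vx (X t) (sqrt (L t)) t) + c * L t) * exp (c * t)) with
   (- (sqrt (L t) ^ 5 * Vx (X t) (sqrt (L t)) t) * exp (c * t) + L t * (c * exp (c * t))) by ring.
  apply (is_derive_mult_R L (fun t => exp (c * t))); auto.
  auto_derive; auto. ring. apply Rmult_comm. }
assert (CE : forall c s, continuous (fun t => L (clamp t) * exp (c * clamp t)) s).
{ intros c s. apply continuous_mult_R; auto. apply exp_continuous. }
split.
- intros E t Ht. destruct (H t Ht) as [L0 _]. apply Rle_antisym; auto.
  assert (Mo : L t * exp (- C * t) <= L 0 * exp (- C * 0)).
  { apply (nonincreasing_clamp (fun t => L t * exp (- C * t))
      (fun t => (- (sqrt (L t) ^ 5 * Vx (X t) (sqrt (L t)) t) + - C * L t) * exp (- C * t)));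
      auto.
    intros s Hs. split; [apply DE; auto|].
    specialize (B s ltac:(lra)). apply Rabs_le_between in B.
    generalize (exp_pos (- C * s)). intros.
    assert (0 <= (sqrt (L s) ^ 5 * Vx (X s) (sqrt (L s)) s + C * L s) * exp (- C * s)); [|lra].
    apply Rmult_le_pos; lra. }
  rewrite E, Rmult_0_l in Mo.
  apply Rmult_le_reg_r with (exp (- C * t)). apply exp_pos. lra.
- intros P t Ht.
  assert (CE' : forall s, continuous (fun t => - (L (clamp t) * exp (C * clamp t))) s).
  { intros. apply continuous_opp_R. auto. }
  assert (Mo := nonincreasing_clamp (fun t => - (L t * exp (C * t)))
    (fun t => - ((- (sqrt (L t) ^ 5 * Vx (X t) (sqrt (L t)) t) + C * L t) * exp (C * t))) CE').
  assert (Mo1 : - (L t * exp (C * t)) <= - (L 0 * exp (C * 0))).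
  { apply Mo; auto. intros s Hs. split.
    - apply is_derive_opp_R. apply DE; auto.
    - specialize (B s ltac:(lra)). apply Rabs_le_between in B.
      generalize (exp_pos (C * s)). intros.
      assert (0 <= (- (sqrt (L s) ^ 5 * Vx (X s) (sqrt (L s)) s) + C * L s) * exp (C * s)); [|lra].
      apply Rmult_le_pos; lra. }
  rewrite Rmult_0_r, exp_0 in Mo1.
  apply Rmult_lt_reg_r with (exp (C * t)). apply exp_pos. lra.
Qed.

Lemma LipB_ham_dl (N M : R) : LipB N M (ham_dl V Vq).
Proof.
unfold ham_dl. apply LipB_plus; [apply LipB_plus|].
- apply (LipB_mult N M (fun _ _ _ => sqrt 2) (fun _ q _ => q)). apply LipB_const. apply LipB_q.
- apply (LipB_mult N M (fun _ q _ => 5 / 2 * q ^ 3) V). 2: apply LipB_Ck_half; auto.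
  apply (LipB_mult N M (fun _ _ _ => 5 / 2) (fun _ q _ => q ^ 3)). apply LipB_const. apply LipB_pow.
- apply (LipB_mult N M (fun _ q _ => / 2 * q ^ 4) Vq). 2: apply LipB_Ck_half; auto.
  apply (LipB_mult N M (fun _ _ _ => / 2) (fun _ q _ => q ^ 4)). apply LipB_const. apply LipB_pow.
Qed.

Let velocity (X L : R -> R) (t : R) := ham_dl V Vq (X t) (sqrt (L t)) t.
Let force (X L : R -> R) (t : R) := (- / 2 * sqrt (L t) ^ 4) * Vx (X t) (sqrt (L t)) t.

(* In the variable [sqrt l], Hamilton's equations have a Lipschitz right-hand side. *)
Lemma positive_solution (X L : R -> R) :
  hamilton_solution (hamiltonian V) 1 X L -> 0 < L 0 -> exists K, 0 < K /\
    (forall t, 0 <= t <= 1 -> 0 < L t /\ Rabs (X t) <= K /\ 0 < sqrt (L t) <= K) /\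
    (forall t, 0 < t < 1 -> is_derive X t (velocity X L t) /\
       is_derive (fun t => sqrt (L t)) t (force X L t)) /\
    (forall s, continuous (fun t => X (clamp t)) s) /\
    (forall s, continuous (fun t => sqrt (L (clamp t))) s).
Proof.
intros H P. destruct (solution_L_sign _ _ H) as [_ S]. specialize (S P).
rewrite hamilton_solution_iff in H.
destruct (solution_bounded X _ (fun t Ht => proj1 (proj2 (H t Ht)))) as [N [N0 BX]].
destruct (solution_bounded L _ (fun t Ht => proj2 (proj2 (H t Ht)))) as [M [M0 BL]].
assert (M1 := sqrt_pos M).
exists (N + sqrt M). split; [lra|]. split; [|split; [|split]].
- intros t Ht. specialize (S t Ht). specialize (BX t Ht). specialize (BL t Ht).
  rewrite Rabs_pos_eq in BL by lra. apply sqrt_le_1_alt in BL. apply sqrt_lt_R0 in S as S'. lra.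
- intros t Ht. destruct (H t ltac:(lra)) as (_ & DX & DL). specialize (S t ltac:(lra)).
  apply (is_derive_of_is_derive_on _ _ _ _ (locally_unit t Ht)) in DX, DL.
  split; [exact DX|]. assert (0 < sqrt (L t)) by (apply sqrt_lt_R0; auto).
  replace (force X L t) with (- (sqrt (L t) ^ 5 * Vx (X t) (sqrt (L t)) t) / (2 * sqrt (L t)))
    by (unfold force; field; lra).
  apply is_derive_sqrt; auto.
- exact (clamp_continuous X _ (fun t Ht => proj1 (proj2 (H t Ht)))).
- intros s. apply (continuous_comp (fun t => L (clamp t)) sqrt).
  apply (clamp_continuous L _ (fun t Ht => proj2 (proj2 (H t Ht)))). apply continuous_sqrt.
Qed.

(** On the boundary [l = 0] the velocity vanishes, so the position is constant. *)
Lemma zero_solution (X L : R -> R) :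
  hamilton_solution (hamiltonian V) 1 X L -> L 0 = 0 -> X 1 = X 0 /\ L 1 = 0.
Proof.
intros H E. destruct (solution_L_sign _ _ H) as [S _]. specialize (S E).
rewrite hamilton_solution_iff in H. split; [|apply S; lra].
assert (C := clamp_continuous X _ (fun t Ht => proj1 (proj2 (H t Ht)))).
assert (DX : forall t, 0 < t < 1 -> is_derive X t 0).
{ intros t Ht. apply (is_derive_of_is_derive_on unit_interval). apply locally_unit; auto.
  destruct (H t ltac:(lra)) as (_ & A & _). rewrite S, sqrt_0 in A by lra.
  replace (ham_dl V Vq (X t) 0 t) with 0 in A by (unfold ham_dl; ring). exact A. }
apply Rle_antisym.
- apply (nonincreasing_clamp X (fun _ => 0)); auto; [|lra].
  intros; split; [apply DX; auto|lra].
- apply Ropp_le_cancel. apply (nonincreasing_clamp (fun t => - X t) (fun _ => - 0)); [| |lra].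
  + intros; apply continuous_opp_R; auto.
  + intros; split; [apply is_derive_opp_R; apply DX; auto|lra].
Qed.

Lemma LipB_force (N M : R) : LipB N M (fun x q t => (- / 2 * q ^ 4) * Vx x q t).
Proof.
apply (LipB_mult N M (fun _ q _ => - / 2 * q ^ 4) Vx). 2: apply LipB_Ck_half; auto.
apply (LipB_mult N M (fun _ _ _ => - / 2) (fun _ q _ => q ^ 4)). apply LipB_const. apply LipB_pow.
Qed.

Lemma difference_sqr_derive (u v : R -> R) (u' v' t : R) :
  is_derive u t u' -> is_derive v t v' ->
  is_derive (fun t => (u t - v t) ^ 2) t (2 * (u t - v t) * (u' - v')).
Proof.
intros Hu Hv.
replace (2 * (u t - v t) * (u' - v')) with (INR 2 * (u' - v') * (u t - v t) ^ 1) by (simpl; ring).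
apply (is_derive_pow (fun t => u t - v t) 2). apply is_derive_minus_R; auto.
Qed.

Lemma difference_sqr_continuous (u v : R -> R) (s : R) :
  continuous u s -> continuous v s -> continuous (fun t => (u t - v t) ^ 2) s.
Proof.
intros Cu Cv. apply (continuous_comp (fun t => u t - v t) (fun y => y ^ 2)).
apply (@continuous_minus _ R_AbsRing R_NormedModule); auto.
apply derivable_continuous_R. auto_derive. auto.
Qed.

(** Gronwall for the squared distance [D] in the coordinates [x] and [sqrt l]: [D' <= 4 * K * D] and
    [D 0 = 0]. Solutions starting on [l = 0], where [sqrt l] is not smooth, are treated
    separately. *)
Lemma solution_unique (X1 L1 X2 L2 : R -> R) :
  hamilton_solution (hamiltonian V) 1 X1 L1 -> hamilton_solution (hamiltonian V) 1 X2 L2 ->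
  X1 0 = X2 0 -> L1 0 = L2 0 -> X1 1 = X2 1 /\ L1 1 = L2 1.
Proof.
intros H1 H2 EX EL.
assert (P0 := proj1 (proj1 (hamilton_solution_iff _ _) H1 0 ltac:(lra))).
destruct P0 as [P|E].
2:{ destruct (zero_solution _ _ H1 (eq_sym E)) as [-> ->].
    destruct (zero_solution _ _ H2 (eq_trans (eq_sym EL) (eq_sym E))) as [-> ->]. auto. }
destruct (positive_solution _ _ H1 P) as (K1 & K10 & B1 & D1 & CX1 & CQ1).
rewrite EL in P. destruct (positive_solution _ _ H2 P) as (K2 & K20 & B2 & D2 & CX2 & CQ2).
destruct (LipB_ham_dl (K1 + K2) (K1 + K2)) as [Ka [Ka0 [_ La]]].
destruct (LipB_force (K1 + K2) (K1 + K2)) as [Kb [Kb0 [_ Lb]]].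
set (K := Ka + Kb).
set (q1 := fun t => sqrt (L1 t)) in *. set (q2 := fun t => sqrt (L2 t)) in *.
set (D := fun t => (X1 t - X2 t) ^ 2 + (q1 t - q2 t) ^ 2).
set (D' := fun t => 2 * (X1 t - X2 t) * (velocity X1 L1 t - velocity X2 L2 t) +
                    2 * (q1 t - q2 t) * (force X1 L1 t - force X2 L2 t)).
assert (DD : forall t, 0 < t < 1 -> is_derive D t (D' t)).
{ intros t Ht. destruct (D1 t Ht), (D2 t Ht).
  apply (is_derive_plus_R (fun t => (X1 t - X2 t) ^ 2) (fun t => (q1 t - q2 t) ^ 2));
  apply difference_sqr_derive; auto. }
assert (BD : forall t, 0 <= t <= 1 -> D' t <= 4 * K * D t).
{ intros t Ht. destruct (B1 t Ht) as (_ & BX1 & Q1). destruct (B2 t Ht) as (_ & BX2 & Q2).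
  assert (A := La (X1 t) (q1 t) (X2 t) (q2 t) t ltac:(lra) ltac:(unfold q1; lra) ltac:(lra) ltac:(unfold q2; lra) Ht).
  assert (B := Lb (X1 t) (q1 t) (X2 t) (q2 t) t ltac:(lra) ltac:(unfold q1; lra) ltac:(lra) ltac:(unfold q2; lra) Ht).
  cbv beta in B. unfold D', D.
  set (da := velocity X1 L1 t - velocity X2 L2 t).
  set (db := force X1 L1 t - force X2 L2 t).
  change (Rabs da <= Ka * (Rabs (X1 t - X2 t) + Rabs (q1 t - q2 t))) in A.
  change (Rabs db <= Kb * (Rabs (X1 t - X2 t) + Rabs (q1 t - q2 t))) in B.
  set (u := X1 t - X2 t) in *. set (v := q1 t - q2 t) in *.
  pose proof (Rabs_pos u). pose proof (Rabs_pos v).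
  assert (u * da <= Rabs u * (Ka * (Rabs u + Rabs v))).
  { eapply Rle_trans; [apply Rle_abs|]. rewrite Rabs_mult. apply Rmult_le_compat_l; auto. }
  assert (v * db <= Rabs v * (Kb * (Rabs u + Rabs v))).
  { eapply Rle_trans; [apply Rle_abs|]. rewrite Rabs_mult. apply Rmult_le_compat_l; auto. }
  rewrite <- (pow2_abs u), <- (pow2_abs v).
  assert (Sq := pow2_ge_0 (Rabs u - Rabs v)).
  assert (Ka * (Rabs u * (Rabs u + Rabs v)) <= Ka * (2 * (Rabs u ^ 2 + Rabs v ^ 2)))
    by (apply Rmult_le_compat_l; nra).
  assert (Kb * (Rabs v * (Rabs u + Rabs v)) <= Kb * (2 * (Rabs u ^ 2 + Rabs v ^ 2)))
    by (apply Rmult_le_compat_l; nra).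
  unfold K. lra. }
assert (Fin : D 1 * exp (- (4 * K) * 1) <= D 0 * exp (- (4 * K) * 0)).
{ apply (nonincreasing_clamp (fun t => D t * exp (- (4 * K) * t))
    (fun t => (D' t - 4 * K * D t) * exp (- (4 * K) * t))); [| |lra].
  - intros s. apply continuous_mult_R. 2: apply exp_continuous.
    apply (@continuous_plus _ _ R_NormedModule).
    apply (difference_sqr_continuous (fun t => X1 (clamp t)) (fun t => X2 (clamp t))); auto.
    apply (difference_sqr_continuous (fun t => q1 (clamp t)) (fun t => q2 (clamp t))); auto.
  - intros t Ht. split.
    + replace ((D' t - 4 * K * D t) * exp (- (4 * K) * t)) with
        (D' t * exp (- (4 * K) * t) + D t * (- (4 * K) * exp (- (4 * K) * t))) by ring.
      apply (is_derive_mult_R D (fun t => exp (- (4 * K) * t))); auto.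
      auto_derive; auto. ring. apply Rmult_comm.
    + specialize (BD t ltac:(lra)). generalize (exp_pos (- (4 * K) * t)). intros.
      assert (0 <= (4 * K * D t - D' t) * exp (- (4 * K) * t)); [|lra].
      apply Rmult_le_pos; lra. }
assert (D0 : D 0 = 0) by (unfold D, q1, q2; rewrite EX, EL; ring).
rewrite D0, Rmult_0_l in Fin.
assert (Z : D 1 <= 0).
{ apply Rmult_le_reg_r with (exp (- (4 * K) * 1)). apply exp_pos. lra. }
unfold D in Z. rewrite <- !Rsqr_pow2 in Z.
assert (N := Rle_0_sqr (X1 1 - X2 1)). assert (N' := Rle_0_sqr (q1 1 - q2 1)).
assert (ZX := Rsqr_0_uniq (X1 1 - X2 1) ltac:(lra)).
assert (Zq := Rsqr_0_uniq (q1 1 - q2 1) ltac:(lra)). unfold q1, q2 in Zq.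
split; [lra|].
apply sqrt_inj; [left; apply B1; lra|left; apply B2; lra|lra].
Qed.

End Flow.


(** * Interpolation of a twist map by a Hamiltonian flow *)

Lemma Ck_half_le (j k : nat) (f : R -> R -> R -> R) :
  (j <= k)%nat -> Ck_half k f -> Ck_half j f.
Proof.
revert j f; induction k; intros j f Hj H.
- replace j with 0%nat by lia. exact H.
- destruct j. split; auto. apply H.
  destruct H as [C [fx [fq [ft [P [A [B D]]]]]]]. split; auto.
  exists fx, fq, ft. split; auto. split; [|split]; apply IHk; auto; lia.
Qed.

Lemma Derive_periodic (f : R -> R) (x : R) :
  (forall z, f (z + 1) = f z) -> Derive f (x + 1) = Derive f x.
Proof.
intros H. unfold Derive. f_equal. apply Lim_ext. intros h.
replace (x + 1 + h) with (x + h + 1) by ring. rewrite !H. reflexivity.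
Qed.

(** Built with class [S k], because its derivative enters the Hamiltonian and must have class [k].
    The flat zones are those that the periodization asks for. *)
Definition chi (k : nat) (t : R) : R := step (S k) (/ 4) (3 / 4) t.

Lemma Cs_chi (d : R) (k : nat) : Cs d (S k) (fun _ _ t => chi k t).
Proof. apply (Cs_step d (/ 4) (3 / 4) (S k) (S k) (fun _ _ t => t)); auto. lra. apply Cs_t. Qed.

Lemma chi_derive (k : nat) (t : R) : is_derive (chi k) t (Derive (chi k) t).
Proof.
destruct (Cs_D _ _ _ (Cs_chi 1 k)) as [P _].
apply (partials_t _ _ _ _ _ _ _ (P 0 0 t ltac:(rewrite Rabs_R0; lra))).
Qed.

Lemma Cs_chi' (d : R) (k : nat) : Cs d k (fun _ _ t => Derive (chi k) t).
Proof. destruct (Cs_D _ _ _ (Cs_chi d k)) as [_ [_ [_ H]]]. exact H. Qed.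

Lemma chi_bounds (k : nat) (t : R) : 0 <= chi k t <= 1.
Proof. apply step_bounds; lra. Qed.

Lemma chi_0 (k : nat) (t : R) : t <= / 4 -> chi k t = 0.
Proof. apply step_0. Qed.

Lemma chi_1 (k : nat) (t : R) : 3 / 4 <= t -> chi k t = 1.
Proof. intros; apply step_1; lra. Qed.

Lemma chi'_0 (k : nat) (t : R) : t < / 4 \/ 3 / 4 < t -> Derive (chi k) t = 0.
Proof.
intros [H|H].
- rewrite (Derive_ext_loc _ (fun _ => 0)). apply Derive_const.
  apply (locally_interval _ t m_infty (/ 4)); simpl; auto. intros; apply chi_0; lra.
- rewrite (Derive_ext_loc _ (fun _ => 1)). apply Derive_const.
  apply (locally_interval _ t (3 / 4) p_infty); simpl; auto. intros; apply chi_1; lra.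
Qed.

Lemma sqrt2_bounds : 1 < sqrt 2 < 3 / 2.
Proof.
split.
- rewrite <- sqrt_1 at 1. apply sqrt_lt_1_alt; lra.
- rewrite <- (sqrt_pow2 (3 / 2)) by lra. apply sqrt_lt_1_alt. lra.
Qed.

Lemma sqrt2_sqr : sqrt 2 * sqrt 2 = 2.
Proof. apply sqrt_sqrt; lra. Qed.

Section Interpolation.

Variables (e : R) (k' : nat) (s : R -> R -> R).
Let k := S k'.
Hypothesis He : 0 < e.
Hypothesis Hs : Cs e (S k) (fun X h _ => s X h).
Hypothesis Hper : forall X h, Rabs h < e -> s (X + 1) h = s X h.

(** If a momentum is [h ^ 2 / 2 + chi k t * h ^ 4 * b], then [h ^ 2] times this expression is twice
    the momentum, that is [y ^ 2]. *)
Local Notation quad b x h t := (1 + 2 * h ^ 2 * (chi k t * b x h))%R.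

Let sX (X h : R) := Derive (fun z => s z h) X.
Let sh (X h : R) := Derive (fun z => s X z) h.

Lemma Cs_sX : Cs e k (fun X h _ => sX X h).
Proof. destruct (Cs_D _ _ _ Hs) as (_ & A & _). exact A. Qed.

Lemma Cs_sh : Cs e k (fun X h _ => sh X h).
Proof. destruct (Cs_D _ _ _ Hs) as (_ & _ & A & _). exact A. Qed.

Lemma sX_per (X h : R) : Rabs h < e -> sX (X + 1) h = sX X h.
Proof. intros H. apply (Derive_periodic (fun z => s z h)). auto. Qed.

Lemma sh_per (X h : R) : Rabs h < e -> sh (X + 1) h = sh X h.
Proof.
intros H. apply Derive_ext_loc. generalize (Rabs_lt_locally e h H). apply filter_imp. auto.
Qed.

(** Periodicity in [x] and [0 <= chi <= 1] make the bounds uniform, so one strip serves all [x] and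
    [t]. *)
Lemma chi_normal_inverse (b : R -> R -> R) :
  Cs e k (fun X h _ => b X h) -> (forall X h, Rabs h < e -> b (X + 1) h = b X h) ->
  exists (e' : R) (g : R -> R -> R -> R), 0 < e' < e /\
   (forall x h t, Rabs h < e' -> / 2 <= quad b x h t /\
       / 2 <= sqrt (quad b x h t) <= 2) /\
   (forall x h h' t, Rabs h < e' -> Rabs h' < e' ->
      h * sqrt (quad b x h t) =
      h' * sqrt (quad b x h' t) -> h = h') /\
   (forall x y t, Rabs y < e' / 4 -> Rabs (g x y t) < e' / 2 /\
      g x y t * sqrt (quad b x (g x y t) t) = y) /\
   Cs (e' / 4) k g.
Proof.
intros Cb Pb.
destruct (Cs_D _ _ _ Cb) as (PD & _ & Cq & _).
destruct (periodic_bounded e (e / 2) (fun X h _ => b X h)) as [K1 [K1p B1]].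
{ lra. } { intros; eapply Cs_cont; eauto. } { auto. }
destruct (periodic_bounded e (e / 2) (Dq (fun X h _ => b X h))) as [K2 [K2p B2]].
{ lra. } { intros; eapply Cs_cont; eauto. }
{ intros x q t H. apply Derive_ext_loc. generalize (Rabs_lt_locally e q H). apply filter_imp. auto. }
destruct (sqrt_normal_inverse (e / 2) (K1 + K2) k' (fun X h t => chi k t * b X h))
  as (e' & g & E & H1 & H2 & H3 & H4).
- lra.
- apply (Cs_sub e); [lra|]. apply Cs_mult; auto. apply Cs_pred, Cs_chi.
- intros x h t Hh. destruct (chi_bounds k t). split.
  + rewrite Rabs_mult, (Rabs_pos_eq (chi k t)) by auto.
    specialize (B1 x h ltac:(lra)). generalize (Rabs_pos (b x h)). nra.
  + replace (Dq (fun X h t => chi k t * b X h) x h t) with (chi k t * Dq (fun X h _ => b X h) x h 0)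
      by (symmetry; apply Derive_scal).
    rewrite Rabs_mult, (Rabs_pos_eq (chi k t)) by auto.
    specialize (B2 x h ltac:(lra)). generalize (Rabs_pos (Dq (fun X h _ => b X h) x h 0)). nra.
- exists e', g. split; [lra|]. auto.
Qed.

(** [h ^ 4 * b0] and [h ^ 4 * b1] are the contributions of [h ^ 5 * s] to the initial and final
    momenta. [b0] is written at the starting point [x], [b1] at the end point [X], since each
    equation is solved for [h] with that point fixed. *)
Let b0 (x h : R) := 5 * s (x + h) h + h * sh (x + h) h.
Let b1 (X h : R) := 5 * s X h + h * (sh X h + sX X h).

Lemma Cs_b0 : Cs e k (fun x h _ => b0 x h).
Proof.
assert (A : forall f, Cs e k (fun X h _ => f X h) -> Cs e k (fun x h _ => f (x + h) h)).
{ intros f Hf. apply (Cs_comp e e k (fun X h _ => f X h) (fun x h _ => x + h) (fun _ h _ => h) (fun _ _ t => t)); auto.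
  apply Cs_plus. apply Cs_x. apply Cs_q. apply Cs_q. apply Cs_t. }
apply Cs_plus. apply Cs_scal, A, Cs_pred, Hs. apply Cs_mult. apply Cs_q. apply A, Cs_sh.
Qed.

Lemma Cs_b1 : Cs e k (fun X h _ => b1 X h).
Proof.
apply Cs_plus. apply Cs_scal, Cs_pred, Hs. apply Cs_mult. apply Cs_q.
apply Cs_plus. apply Cs_sh. apply Cs_sX.
Qed.

Lemma b0_per (X h : R) : Rabs h < e -> b0 (X + 1) h = b0 X h.
Proof.
intros H. unfold b0. replace (X + 1 + h) with (X + h + 1) by ring.
rewrite Hper, sh_per; auto.
Qed.

Lemma b1_per (X h : R) : Rabs h < e -> b1 (X + 1) h = b1 X h.
Proof. intros H. unfold b1. rewrite Hper, sh_per, sX_per; auto. Qed.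

(** * The periodic potential of the isotopy *)

Section Potential.

Variables (e1 : R) (g1 : R -> R -> R -> R).
Hypothesis He1 : 0 < e1 < e.
Hypothesis Hb1 : forall x h t, Rabs h < e1 -> / 2 <= quad b1 x h t /\
       / 2 <= sqrt (quad b1 x h t) <= 2.
Hypothesis Hinj1 : forall x h h' t, Rabs h < e1 -> Rabs h' < e1 ->
      h * sqrt (quad b1 x h t) =
      h' * sqrt (quad b1 x h' t) -> h = h'.
Hypothesis Hg1 : forall x y t, Rabs y < e1 / 4 -> Rabs (g1 x y t) < e1 / 2 /\
      g1 x y t * sqrt (quad b1 x (g1 x y t) t) = y.
Hypothesis Cg1 : Cs (e1 / 4) k g1.

Let d1 := e1 / 4.

(* Hamiltonian of the isotopy Gamma_t at the point with base coordinate [X] and [l = y ^ 2 / 2]. *)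
Definition kick (X y t : R) : R := - Derive (chi k) t * (g1 X y t ^ 5 * s X (g1 X y t)).

(** Since [y] is [h] times the square root, [h ^ 5 / y ^ 5] is a power of the radicand, regular at
    [y = 0]; the only derivatives of [s] spent are those in [b1]. *)
Definition kick_quot (X y t : R) : R :=
  - Derive (chi k) t * s X (g1 X y t) /
    sqrt (quad b1 X (g1 X y t) t) ^ 5.

Lemma kick_quot_eq (X y t : R) : Rabs y < d1 -> kick X y t = y ^ 5 * kick_quot X y t.
Proof.
intros Hy. destruct (Hg1 X y t Hy) as [A B].
destruct (Hb1 X (g1 X y t) t ltac:(lra)) as [_ C].
unfold kick, kick_quot. set (h := g1 X y t) in *. set (w := sqrt _) in *.
replace (y ^ 5) with ((h * w) ^ 5) by (rewrite B; reflexivity). field. lra.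
Qed.

Lemma Cs_kick_quot : Cs d1 k kick_quot.
Proof.
assert (A : forall f, Cs e k (fun X h _ => f X h) -> Cs d1 k (fun X y t => f X (g1 X y t))).
{ intros f Hf. apply (Cs_comp d1 e k (fun X h _ => f X h) (fun x _ _ => x) g1 (fun _ _ t => t)); auto.
  intros x q t Hq. destruct (Hg1 x q t Hq). lra. apply Cs_x. apply Cs_t. }
unfold kick_quot. apply Cs_div.
- intros x y t Hy. destruct (Hg1 x y t Hy) as [B _].
  destruct (Hb1 x (g1 x y t) t ltac:(lra)) as [_ C]. apply pow_nonzero. lra.
- apply Cs_mult. apply Cs_opp, Cs_chi'. apply A, Cs_pred, Hs.
- apply Cs_pow, Cs_sqrt.
  + intros x y t Hy. destruct (Hg1 x y t Hy) as [B _].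
    destruct (Hb1 x (g1 x y t) t ltac:(lra)) as [C _]. lra.
  + apply Cs_plus. apply Cs_const. apply Cs_mult. apply Cs_scal, Cs_pow, Cg1.
    apply Cs_mult. apply Cs_pred, Cs_chi. apply A, Cs_b1.
Qed.

(** [g1] stems from a choice, so its periodicity is recovered from injectivity of the normal
    form. *)
Lemma g1_per (X y t : R) : Rabs y < d1 -> g1 (X + 1) y t = g1 X y t.
Proof.
intros Hy. destruct (Hg1 X y t Hy) as [A B]. destruct (Hg1 (X + 1) y t Hy) as [A' B'].
apply (Hinj1 X _ _ t); try lra. rewrite B. rewrite b1_per in B' by lra. exact B'.
Qed.

(* Since [l = q ^ 2 = y ^ 2 / 2], the factor [4 sqrt 2] turns [q ^ 5] into [y ^ 5]. *)
Definition potential0 (x q t : R) : R :=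
  4 * sqrt 2 * kick_quot (x + (1 - t) * (sqrt 2 * q)) (sqrt 2 * q) t *
  step (S k) (- (d1 / 4)) (- (d1 / 8)) (- q).

(** The cut-off in [potential0] is [1] up to [q = d1 / 8] and [0] from [d1 / 4] on, half the width
    [d1 / 2], as [Ck_half_periodize] requires. *)
Definition potential : R -> R -> R -> R := periodize (d1 / 2) potential0.

Lemma scaled_lt (q : R) : Rabs q < d1 / 2 -> Rabs (sqrt 2 * q) < d1.
Proof.
intros H. rewrite Rabs_mult, Rabs_pos_eq by apply sqrt_pos.
generalize sqrt2_bounds (Rabs_pos q). nra.
Qed.

Lemma Cs_potential0 : Cs (d1 / 2) k potential0.
Proof.
apply Cs_mult.
- apply Cs_scal.
  assert (A : Cs (d1 / 2) k (fun x q t => sqrt 2 * q)) by apply Cs_scal, Cs_q.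
  apply (Cs_comp (d1 / 2) d1 k kick_quot (fun x q t => x + (1 - t) * (sqrt 2 * q)) (fun _ q _ => sqrt 2 * q) (fun _ _ t => t)); auto.
  + intros; apply scaled_lt; auto.
  + apply Cs_kick_quot.
  + apply Cs_plus. apply Cs_x. apply Cs_mult; auto. apply Cs_minus. apply Cs_const. apply Cs_t.
  + apply Cs_t.
- apply (Cs_step _ _ _ k (S k) (fun _ q _ => - q)). unfold d1; lra. lia. apply Cs_opp, Cs_q.
Qed.

Lemma potential0_t (x q t : R) : t < / 4 \/ 3 / 4 < t -> potential0 x q t = 0.
Proof.
intros H. unfold potential0, kick_quot. rewrite (chi'_0 k t H). unfold Rdiv. ring.
Qed.

Lemma Ck_half_potential : Ck_half k potential.
Proof.
apply Ck_half_periodize.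
- unfold d1; lra.
- apply Cs_potential0.
- intros x q t Hq. unfold potential0. rewrite step_0 by lra. ring.
- intros; apply potential0_t; auto.
- intros; apply potential0_t; auto.
Qed.

Lemma potential_periodic (x q t : R) : 0 <= q ->
  potential (x + 1) q t = potential x q t /\ potential x q (t + 1) = potential x q t.
Proof.
intros Hq. split; [|apply periodize_periodic].
unfold potential, periodize. destruct Rlt_dec as [L|L]; auto.
unfold potential0. f_equal. f_equal.
replace (x + 1 + (1 - frac_part t) * (sqrt 2 * q)) with (x + (1 - frac_part t) * (sqrt 2 * q) + 1) by ring.
assert (Hy : Rabs (sqrt 2 * q) < d1) by (apply scaled_lt; rewrite Rabs_pos_eq; lra).
set (X := x + _). destruct (Hg1 X (sqrt 2 * q) (frac_part t) Hy) as [A _].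
unfold kick_quot. rewrite g1_per; auto. rewrite Hper, b1_per by lra. reflexivity.
Qed.

Lemma hamiltonian_potential (x l t : R) :
  0 <= t <= 1 -> 0 <= l -> sqrt (2 * l) <= d1 / 8 ->
  hamiltonian potential x l t =
    sqrt (2 * l) ^ 3 / 3 + kick (x + (1 - t) * sqrt (2 * l)) (sqrt (2 * l)) t.
Proof.
intros Ht Hl Hy.
rewrite sqrt_mult in * by lra. set (q := sqrt l) in *.
assert (Hq : 0 <= q) by apply sqrt_pos.
generalize sqrt2_bounds sqrt2_sqr. intros S2 S22.
assert (Hd : 0 < d1) by (unfold d1; lra).
assert (Hq' : q <= d1 / 8) by nra.
assert (E : potential x q t = potential0 x q t).
{ unfold potential, periodize. destruct Rlt_dec as [_|N]; [|lra].
  (* [frac_part 1] is [0], not [1]; the two values agree because [potential0] vanishes at both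
     times. *)
  destruct (Req_dec t 1) as [->|N].
  - rewrite !potential0_t; auto. right; lra. left.
    destruct (base_fp 1). unfold frac_part. replace (Int_part 1) with 1%Z. lra.
    apply Int_part_spec; lra.
  - f_equal. unfold frac_part. replace (Int_part t) with 0%Z. lra.
    apply Int_part_spec; lra. }
unfold hamiltonian. fold q. rewrite E. unfold potential0. rewrite step_1 by lra.
rewrite kick_quot_eq by (rewrite Rabs_pos_eq; nra).
replace ((sqrt 2 * q) ^ 3) with ((sqrt 2 * sqrt 2) * sqrt 2 * q ^ 3) by ring.
replace ((sqrt 2 * q) ^ 5) with ((sqrt 2 * sqrt 2) * (sqrt 2 * sqrt 2) * sqrt 2 * q ^ 5) by ring.
rewrite S22. field.
Qed.


Let Z (X h : R) := h ^ 5 * s X h.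
Let Zh (X h : R) := Derive (fun z => Z X z) h.
Let ZX (X h : R) := Derive (fun z => Z z h) X.

Lemma chain2 (f : R -> R -> R) (j : nat) (a b : R -> R) (w la lb : R) :
  Cs e (S j) (fun X h _ => f X h) -> Rabs (b w) < e ->
  is_derive a w la -> is_derive b w lb ->
  is_derive (fun w => f (a w) (b w)) w
    (Derive (fun z => f z (b w)) (a w) * la + Derive (fun z => f (a w) z) (b w) * lb).
Proof.
intros Hf Hb Da Db. destruct (Cs_D _ _ _ Hf) as (P & A & B & C).
assert (R := is_derive_comp3 _ _ _ _ e a b (fun _ => 0) w la lb 0 P Hb
  (Cs_cont _ _ _ _ _ _ A Hb) (Cs_cont _ _ _ _ _ _ B Hb) (Cs_cont _ _ _ _ _ _ C Hb)
  Da Db (is_derive_const_R 0 w)).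
rewrite Rmult_0_r, Rplus_0_r in R. exact R.
Qed.

Lemma Cs_Z : Cs e (S k) (fun X h _ => Z X h).
Proof. apply Cs_mult; auto. apply Cs_pow, Cs_q. Qed.

Lemma Cs_Zh : Cs e k (fun X h _ => Zh X h).
Proof. destruct (Cs_D _ _ _ Cs_Z) as (_ & _ & A & _). exact A. Qed.

Lemma Cs_ZX : Cs e k (fun X h _ => ZX X h).
Proof. destruct (Cs_D _ _ _ Cs_Z) as (_ & A & _). exact A. Qed.

Lemma Zh_eq (X h : R) : Rabs h < e -> Zh X h = 5 * h ^ 4 * s X h + h ^ 5 * sh X h.
Proof.
intros Hh. apply is_derive_unique.
destruct (Cs_D _ _ _ Hs) as (P & _). assert (Q := partials_q _ _ _ _ _ _ _ (P X h 0 Hh)).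
apply (is_derive_mult_R (fun z => z ^ 5) (fun z => s X z)); auto.
auto_derive; auto. ring. apply Rmult_comm.
Qed.

Lemma ZX_eq (X h : R) : ZX X h = h ^ 5 * sX X h.
Proof. apply Derive_scal. Qed.

(** Symmetry of the second derivatives makes the derivative of [gen1] in [h] at fixed [X] equal to
    that of [gen0] along [X = x + h] at fixed [x]. This common twist factor is the [m] of the later
    proofs. *)
Lemma Z_Schwarz (X h : R) : Rabs h < e ->
  Derive (fun z => ZX X z) h = Derive (fun z => Zh z h) X.
Proof.
intros Hh. symmetry.
destruct (Cs_D _ _ _ Cs_Z) as (P & _). destruct (Cs_D _ _ _ Cs_Zh) as (Ph & Ah & _).
destruct (Cs_D _ _ _ Cs_ZX) as (PX & _ & AX & _).
apply (Schwarz Z X h).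
- exists (mkposreal (e - Rabs h) (proj2 (Rlt_0_minus _ _) Hh)). intros u v _ Hv. simpl in Hv.
  assert (Hv' : Rabs v < e).
  { generalize (Rabs_triang (v - h) h). replace (v - h + h) with v by ring. lra. }
  split; [|split; [|split]].
  + eexists. exact (partials_x _ _ _ _ _ _ _ (P u v 0 Hv')).
  + eexists. exact (partials_q _ _ _ _ _ _ _ (P u v 0 Hv')).
  + eexists. exact (partials_x _ _ _ _ _ _ _ (Ph u v 0 Hv')).
  + eexists. exact (partials_q _ _ _ _ _ _ _ (PX u v 0 Hv')).
- apply (continuity_2d_pt_cont3 (Dx (fun X h _ => Zh X h))). eapply Cs_cont; eauto.
- apply (continuity_2d_pt_cont3 (Dq (fun X h _ => ZX X h))). eapply Cs_cont; eauto.
Qed.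

(* The map generated by [h ^ 3 / 6 + c * h ^ 5 * s X h], where [X = x + h], sends [(x, gen0)] to
   [(X, gen1)]. *)
Definition gen0 (c X h : R) : R := h ^ 2 / 2 + c * Zh X h.
Definition gen1 (c X h : R) : R := h ^ 2 / 2 + c * (Zh X h + ZX X h).

Lemma gen1_normal (X h t : R) : Rabs h < e -> 0 <= quad b1 X h t ->
  gen1 (chi k t) X h = (h * sqrt (quad b1 X h t)) ^ 2 / 2.
Proof.
intros Hh Hp. rewrite Rpow_mult_distr, pow2_sqrt by auto.
unfold gen1. rewrite Zh_eq, ZX_eq by auto. unfold b1. field.
Qed.

Lemma gen0_normal (x h t : R) : Rabs h < e -> 0 <= quad b0 x h t ->
  gen0 (chi k t) (x + h) h = (h * sqrt (quad b0 x h t)) ^ 2 / 2.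
Proof.
intros Hh Hp. rewrite Rpow_mult_distr, pow2_sqrt by auto.
unfold gen0. rewrite Zh_eq by auto. unfold b0. field.
Qed.

Let ZXX (X h : R) := Derive (fun z => ZX z h) X.
Let ZhX (X h : R) := Derive (fun z => Zh z h) X.
Let Zhh (X h : R) := Derive (fun z => Zh X z) h.

Lemma half_square_derive (b : R -> R) (w lb : R) :
  is_derive b w lb -> is_derive (fun w => b w ^ 2 / 2) w (b w * lb).
Proof.
intros Db. replace (b w * lb) with ((INR 2 * lb * b w ^ 1) * / 2) by (simpl; field).
apply (@is_derive_scal_l R_AbsRing R_NormedModule (fun w => b w ^ 2) w _ (/ 2)).
apply is_derive_pow; auto.
Qed.

Lemma gen1_chain (a b c : R -> R) (w la lb lc : R) :
  Rabs (b w) < e -> is_derive a w la -> is_derive b w lb -> is_derive c w lc ->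
  is_derive (fun w => gen1 (c w) (a w) (b w)) w
    (c w * (ZhX (a w) (b w) + ZXX (a w) (b w)) * la +
     (b w + c w * (Zhh (a w) (b w) + ZhX (a w) (b w))) * lb +
     (Zh (a w) (b w) + ZX (a w) (b w)) * lc).
Proof.
intros Hb Da Db Dc.
assert (A := chain2 Zh k' a b w la lb Cs_Zh Hb Da Db).
assert (B := chain2 ZX k' a b w la lb Cs_ZX Hb Da Db).
rewrite (Z_Schwarz (a w) (b w) Hb) in B.
assert (C := is_derive_plus_R _ _ _ _ _ A B).
assert (D := is_derive_mult_R _ _ _ _ _ Dc C Rmult_comm).
assert (F := is_derive_plus_R _ _ _ _ _ (half_square_derive b w lb Db) D).
eapply (@eq_rect R _ (fun l => is_derive _ w l)). exact F.
unfold plus, mult; simpl. unfold ZhX, ZXX, Zhh. ring.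
Qed.

Lemma gen0_chain (a b c : R -> R) (w la lb lc : R) :
  Rabs (b w) < e -> is_derive a w la -> is_derive b w lb -> is_derive c w lc ->
  is_derive (fun w => gen0 (c w) (a w) (b w)) w
    (c w * ZhX (a w) (b w) * la + (b w + c w * Zhh (a w) (b w)) * lb + Zh (a w) (b w) * lc).
Proof.
intros Hb Da Db Dc.
assert (A := chain2 Zh k' a b w la lb Cs_Zh Hb Da Db).
assert (D := is_derive_mult_R _ _ _ _ _ Dc A Rmult_comm).
assert (F := is_derive_plus_R _ _ _ _ _ (half_square_derive b w lb Db) D).
eapply (@eq_rect R _ (fun l => is_derive _ w l)). exact F.
unfold plus, mult; simpl. unfold ZhX, Zhh. ring.
Qed.

Lemma gen1_g1 (X y t : R) : Rabs y < d1 -> gen1 (chi k t) X (g1 X y t) = y ^ 2 / 2.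
Proof.
intros Hy. destruct (Hg1 X y t Hy) as [A B]. destruct (Hb1 X (g1 X y t) t ltac:(lra)) as [C _].
rewrite gen1_normal by lra. rewrite B. reflexivity.
Qed.

(** Implicit differentiation of [gen1_g1]. The factor [m] is left multiplied out, since its
    nonvanishing is not yet known. *)
Lemma g1_derivatives (X y t : R) : Rabs y < d1 ->
  let h := g1 X y t in
  let m := h + chi k t * (Zhh X h + ZhX X h) in
  m * Dx g1 X y t = - (chi k t * (ZhX X h + ZXX X h)) /\ m * Dq g1 X y t = y.
Proof.
intros Hy h m. destruct (Cs_D _ _ _ Cg1) as (P & _).
assert (DX := partials_x _ _ _ _ _ _ _ (P X y t Hy)).
assert (DQ := partials_q _ _ _ _ _ _ _ (P X y t Hy)).
assert (Hh : Rabs (g1 X y t) < e) by (destruct (Hg1 X y t Hy); lra).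
assert (Cst : forall c w : R, is_derive (fun _ : R => c) w 0)
  by (intros; apply is_derive_const_R).
assert (Id : forall w : R, is_derive (fun w : R => w) w 1)
  by (intros; apply is_derive_id_R).
split.
- assert (A := gen1_chain (fun z => z) (fun z => g1 z y t) (fun _ => chi k t) X _ _ _ Hh (Id X) DX (Cst _ X)).
  apply is_derive_unique in A. rewrite (Derive_ext _ (fun _ => y ^ 2 / 2)) in A by (intros; apply gen1_g1; auto).
  rewrite Derive_const in A. cbv beta in A. fold h in A. fold m in A.
  transitivity (0 - chi k t * (ZhX X h + ZXX X h)); [rewrite A|]; ring.
- assert (A := gen1_chain (fun _ => X) (fun z => g1 X z t) (fun _ => chi k t) y _ _ _ Hh (Cst _ y) DQ (Cst _ y)).
  apply is_derive_unique in A. rewrite (Derive_ext_loc _ (fun y => y ^ 2 / 2)) in A.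
  2:{ generalize (Rabs_lt_locally _ _ Hy). apply filter_imp. intros; apply gen1_g1; auto. }
  assert (E : Derive (fun y => y ^ 2 / 2) y = y).
  { apply is_derive_unique. auto_derive; auto. field. }
  rewrite <- E at 2. etransitivity; [|exact (eq_sym A)]. cbv beta. fold h. unfold m. ring.
Qed.

Lemma kick_chain (a b : R -> R) (w la lb t : R) :
  Rabs (b w) < d1 -> is_derive a w la -> is_derive b w lb ->
  let X := a w in let y := b w in let h := g1 X y t in
  is_derive (fun w => kick (a w) (b w) t) w
    (- Derive (chi k) t * (ZX X h * la + Zh X h * (Dx g1 X y t * la + Dq g1 X y t * lb))).
Proof.
intros Hb Da Db X y h. destruct (Cs_D _ _ _ Cg1) as (P & A & B & C).
assert (G := is_derive_comp3 _ _ _ _ d1 a b (fun _ => t) w la lb 0 P Hb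
  (Cs_cont _ _ _ _ _ _ A Hb) (Cs_cont _ _ _ _ _ _ B Hb) (Cs_cont _ _ _ _ _ _ C Hb)
  Da Db (is_derive_const_R t w)).
rewrite Rmult_0_r, Rplus_0_r in G.
assert (Hh : Rabs (g1 (a w) (b w) t) < e) by (destruct (Hg1 (a w) (b w) t Hb); lra).
assert (D := chain2 Z k a (fun w => g1 (a w) (b w) t) w _ _ Cs_Z Hh Da G).
apply (is_derive_scal _ _ (- Derive (chi k) t)) in D. exact D.
Qed.


(** * The explicit solution of Hamilton's equations *)

Section Trajectory.

Variables (e0 : R) (g0 : R -> R -> R -> R).
Hypothesis He0 : 0 < e0 < e.
Hypothesis Hb0 : forall x h t, Rabs h < e0 -> / 2 <= quad b0 x h t /\
       / 2 <= sqrt (quad b0 x h t) <= 2.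
Hypothesis Hg0 : forall x y t, Rabs y < e0 / 4 -> Rabs (g0 x y t) < e0 / 2 /\
      g0 x y t * sqrt (quad b0 x (g0 x y t) t) = y.
Hypothesis Cg0 : Cs (e0 / 4) k g0.

Variables (x y0 : R).
Hypothesis Hy0 : 0 < y0 < e0 / 4.
Hypothesis Hy0' : y0 < e1 / 128.

(* [Gamma_t] sends [(x, y0)] to [(x + h t, y t)]. *)
Let h (t : R) := g0 x y0 t.
Let L (t : R) := gen1 (chi k t) (x + h t) (h t).
Let y (t : R) := sqrt (2 * L t).
(** The free motion of [y ^ 3 / 3] has speed [y] and preserves [y], so undoing it for time [1 - t]
    subtracts [(1 - t) * y t]. *)
Let X (t : R) := x + h t - (1 - t) * y t.

Lemma displacement_bounds (t : R) : 0 < h t <= 2 * y0 /\ h t < e0.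
Proof.
destruct (Hg0 x y0 t ltac:(rewrite Rabs_pos_eq; lra)) as [A B]. fold (h t) in A, B.
destruct (Hb0 x (h t) t ltac:(lra)) as [_ C]. set (w := sqrt _) in *.
apply Rabs_def2 in A.
assert (0 < h t) by nra. split; [|lra]. split; auto. nra.
Qed.

Lemma displacement_gen0 (t : R) : gen0 (chi k t) (x + h t) (h t) = y0 ^ 2 / 2.
Proof.
destruct (Hg0 x y0 t ltac:(rewrite Rabs_pos_eq; lra)) as [A B]. fold (h t) in A, B.
destruct (Hb0 x (h t) t ltac:(lra)) as [C _].
rewrite gen0_normal by lra. rewrite B. reflexivity.
Qed.

(** [h <= 2 * y0] and a root at most [2] give [y <= 4 * y0 < e1 / 32 = d1 / 8]: the bound [e1 / 128]
    keeps the trajectory where the cut-off is [1]. Injectivity then identifies [h] with the solution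
    [g1] of the end-point equation. *)
Lemma momentum_props (t : R) : 0 < y t < d1 / 8 /\ L t = y t ^ 2 / 2 /\ g1 (x + h t) (y t) t = h t.
Proof.
destruct (displacement_bounds t) as [[A B] C].
assert (Hh1 : Rabs (h t) < e1) by (rewrite Rabs_pos_eq; lra).
destruct (Hb1 (x + h t) (h t) t Hh1) as [D E].
assert (F := gen1_normal (x + h t) (h t) t ltac:(lra) ltac:(lra)). fold (L t) in F.
set (w := sqrt _) in *.
assert (G : y t = h t * w).
{ unfold y. rewrite F. replace (2 * ((h t * w) ^ 2 / 2)) with ((h t * w) ^ 2) by field.
  apply sqrt_pow2. apply Rmult_le_pos; lra. }
assert (Y : 0 < y t < d1 / 8) by (rewrite G; unfold d1; nra).
split; [exact Y|]. split; [rewrite G; exact F|].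
destruct (Hg1 (x + h t) (y t) t ltac:(unfold d1 in Y; rewrite Rabs_pos_eq; lra)) as [I J].
apply (Hinj1 (x + h t) _ _ t); auto. lra. rewrite J. exact G.
Qed.

Let h' (t : R) := Dt g0 x y0 t.

Lemma displacement_derive (t : R) : is_derive h t (h' t).
Proof.
destruct (Cs_D _ _ _ Cg0) as (P & _).
exact (partials_t _ _ _ _ _ _ _ (P x y0 t ltac:(rewrite Rabs_pos_eq; lra))).
Qed.

Lemma endpoint_derive (t : R) : is_derive (fun t => x + h t) t (h' t).
Proof.
rewrite <- (Rplus_0_l (h' t)). apply (is_derive_plus_R (fun _ => x) h).
apply is_derive_const_R. apply displacement_derive.
Qed.

Let m (t : R) := h t + chi k t * (Zhh (x + h t) (h t) + ZhX (x + h t) (h t)).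
Let G (t : R) := chi k t * (ZhX (x + h t) (h t) + ZXX (x + h t) (h t)).

(** The initial momentum [y0 ^ 2 / 2] does not change along the isotopy, so its total time
    derivative is zero. *)
Lemma displacement_derive_eq (t : R) : m t * h' t = - (Zh (x + h t) (h t) * Derive (chi k) t).
Proof.
destruct (displacement_bounds t) as [[A B] C].
assert (D := gen0_chain (fun t => x + h t) h (chi k) t _ _ _ ltac:(rewrite Rabs_pos_eq; lra)
  (endpoint_derive t) (displacement_derive t) (chi_derive k t)).
apply is_derive_unique in D.
rewrite (Derive_ext _ (fun _ => y0 ^ 2 / 2)) in D by (intros; apply displacement_gen0).
rewrite Derive_const in D. cbv beta in D.
transitivity (0 - Zh (x + h t) (h t) * Derive (chi k) t); [rewrite D; unfold m|]; ring.
Qed.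

(** The total derivative contains [m t * h' t], which [displacement_derive_eq] cancels against the
    [Zh] part of the explicit time derivative. *)
Lemma action_derive_time (t : R) :
  is_derive L t (G t * h' t + ZX (x + h t) (h t) * Derive (chi k) t).
Proof.
destruct (displacement_bounds t) as [[A B] C].
assert (D := gen1_chain (fun t => x + h t) h (chi k) t _ _ _ ltac:(rewrite Rabs_pos_eq; lra)
  (endpoint_derive t) (displacement_derive t) (chi_derive k t)).
cbv beta in D. fold (m t) (G t) in D. rewrite displacement_derive_eq in D.
replace (G t * h' t + ZX (x + h t) (h t) * Derive (chi k) t) with
 (G t * h' t + - (Zh (x + h t) (h t) * Derive (chi k) t) +
   (Zh (x + h t) (h t) + ZX (x + h t) (h t)) * Derive (chi k) t) by ring.
exact D.
Qed.

Lemma sqrt2_derive (f : R -> R) (t l : R) : 0 < f t -> is_derive f t l ->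
  is_derive (fun t => sqrt (2 * f t)) t (l / sqrt (2 * f t)).
Proof.
intros P H. assert (0 < sqrt (2 * f t)) by (apply sqrt_lt_R0; lra).
replace (l / sqrt (2 * f t)) with ((2 * l) / (2 * sqrt (2 * f t))) by (field; lra).
apply (is_derive_sqrt (fun t => 2 * f t)); [|lra]. apply is_derive_scal. exact H.
Qed.

Lemma action_pos (t : R) : 0 < L t.
Proof. destruct (momentum_props t) as (A & B & _). rewrite B. assert (0 < y t ^ 2) by (apply pow_lt; lra). lra. Qed.

Lemma position_derive (t : R) :
  is_derive X t (h' t + y t - (1 - t) * ((G t * h' t + ZX (x + h t) (h t) * Derive (chi k) t) / y t)).
Proof.
assert (A := sqrt2_derive L t _ (action_pos t) (action_derive_time t)). fold (y t) in A.
assert (B : is_derive (fun t => 1 - t) t (-1)) by (auto_derive; auto; ring).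
assert (C := is_derive_mult_R _ _ _ _ _ B A Rmult_comm).
assert (D := is_derive_minus_R _ _ _ _ _ (endpoint_derive t) C).
eapply (@eq_rect R _ (fun l => is_derive X t l)). exact D.
unfold minus, plus, opp, mult; simpl. unfold y. ring.
Qed.

(** After division by the twist factor [m], both Hamilton equations become rational identities in
    [y] and the derivatives of [Z] and [chi]. *)
Lemma trajectory_solution : hamilton_solution (hamiltonian potential) 1 X L.
Proof.
intros t Ht. destruct (momentum_props t) as (Yb & LY & Gh).
destruct (displacement_bounds t) as [[A B] C].
assert (PL := action_pos t). split; [lra|].
set (gX := Dx g1 (x + h t) (y t) t). set (gy := Dq g1 (x + h t) (y t) t).
assert (Hyt : Rabs (y t) < d1) by (rewrite Rabs_pos_eq; unfold d1 in *; lra).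
destruct (g1_derivatives (x + h t) (y t) t Hyt) as [E1 E2].
rewrite Gh in E1, E2. fold (m t) gX in E1. fold (m t) gy in E2. fold (G t) in E1.
assert (E3 := displacement_derive_eq t).
(* The relation [m * gy = y] with [y > 0] yields this without a separate estimate. *)
assert (Mn : m t <> 0) by (intros Z0; rewrite Z0, Rmult_0_l in E2; lra).
assert (XE : X t + (1 - t) * y t = x + h t) by (unfold X; ring).
set (zX := ZX (x + h t) (h t)). set (zh := Zh (x + h t) (h t)). set (c' := Derive (chi k) t).
(* Derivatives of [y ^ 3 / 3 + kick (x + (1 - t) * y) y t] in [x] and in [l], with
   [dy / dl = 1 / y]. *)
exists (- c' * (zX * 1 + zh * (gX * 1 + gy * 0))),
  (y t ^ 2 * (1 / y t) + - c' * (zX * ((1 - t) * (1 / y t)) + zh * (gX * ((1 - t) * (1 / y t)) + gy * (1 / y t)))).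
split; [|split; [|split]].
- assert (K := kick_chain (fun z => z + (1 - t) * y t) (fun _ => y t) (X t) 1 0 t Hyt).
  cbv beta zeta in K. rewrite XE in K. fold gX gy in K. rewrite Gh in K. fold zX zh c' in K.
  assert (K1 := K ltac:(auto_derive; auto; ring) ltac:(apply is_derive_const_R)).
  assert (K2 := is_derive_plus_R _ _ _ _ _
     (is_derive_const_R (y t ^ 3 / 3) (X t)) K1).
  eapply is_derive_ext; [|eapply (@eq_rect R _ (fun l => is_derive _ (X t) l)); [exact K2|]].
  + intros z. symmetry. apply (hamiltonian_potential z (L t) t); auto. lra. fold (y t). lra.
  + apply Rplus_0_l.
- apply is_derive_on_of_is_derive; [lra|].
  assert (S : is_derive (fun l => sqrt (2 * l)) (L t) (1 / y t)).
  { apply (sqrt2_derive (fun l => l)); auto. apply is_derive_id_R. }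
  assert (K := kick_chain (fun l => X t + (1 - t) * sqrt (2 * l)) (fun l => sqrt (2 * l)) (L t)
     ((1 - t) * (1 / y t)) (1 / y t) t Hyt).
  cbv beta zeta in K. fold (y t) in K. rewrite XE in K. fold gX gy in K. rewrite Gh in K. fold zX zh c' in K.
  assert (S1 : is_derive (fun l => X t + (1 - t) * sqrt (2 * l)) (L t) ((1 - t) * (1 / y t))).
  { rewrite <- (Rplus_0_l ((1 - t) * (1 / y t))).
    apply (is_derive_plus_R (fun _ => X t)).
    apply is_derive_const_R.
    apply (is_derive_scal (fun l => sqrt (2 * l))). exact S. }
  assert (K1 := K S1 S).
  assert (S2 : is_derive (fun l => sqrt (2 * l) ^ 3 / 3) (L t) (y t ^ 2 * (1 / y t))).
  { apply (is_derive_comp (fun y => y ^ 3 / 3) (fun l => sqrt (2 * l)) (L t) (y t ^ 2)) in S.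
    rewrite Rmult_comm. exact S. fold (y t). auto_derive; auto. field. }
  assert (K2 := is_derive_plus_R _ _ _ _ _ S2 K1).
  eapply is_derive_ext_loc; [|exact K2].
  (* [l < (d1 / 8) ^ 2 / 2] means [sqrt (2 * l) < d1 / 8], where [hamiltonian_potential] applies. *)
  apply (locally_interval _ (L t) 0 ((d1 / 8) ^ 2 / 2)); simpl; auto.
  + rewrite LY. simpl. unfold d1 in *. nra.
  + intros l Hl1 Hl2. symmetry. apply (hamiltonian_potential (X t) l t); auto. lra.
    rewrite <- (sqrt_pow2 (d1 / 8)) by (unfold d1; lra). apply sqrt_le_1_alt. simpl; lra.
- apply is_derive_on_of_is_derive; [exact Ht|].
  eapply (@eq_rect R _ (fun l => is_derive X t l)). apply position_derive.
  fold zX c'. fold zh c' in E3.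
  replace (h' t) with (- (zh * c') / m t) by (rewrite <- E3; field; auto).
  replace gX with (- G t / m t) by (rewrite <- E1; field; auto).
  replace gy with (y t / m t) by (rewrite <- E2; field; auto).
  field. split; auto; lra.
- apply is_derive_on_of_is_derive; [exact Ht|].
  eapply (@eq_rect R _ (fun l => is_derive L t l)). apply action_derive_time.
  fold zX c'. fold zh c' in E3.
  replace (h' t) with (- (zh * c') / m t) by (rewrite <- E3; field; auto).
  replace gX with (- G t / m t) by (rewrite <- E1; field; auto).
  field; auto.
Qed.

(** At [t = 0] the factor [chi] vanishes and both momenta are [h ^ 2 / 2], so [h = y] and the free
    motion cancels the displacement; at [t = 1] no free motion is left to undo. *)
Lemma trajectory_ends :
  X 0 = x /\ L 0 = y0 ^ 2 / 2 /\ X 1 = x + h 1 /\ L 1 = gen1 1 (x + h 1) (h 1) /\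
  gen0 1 (x + h 1) (h 1) = y0 ^ 2 / 2.
Proof.
assert (G0 := displacement_gen0 0). assert (G1 := displacement_gen0 1).
destruct (momentum_props 0) as (Y0 & YL & _). destruct (displacement_bounds 0) as [[A _] _].
unfold X. unfold L in YL |- *.
rewrite (chi_0 k 0), (chi_1 k 1) in * by lra.
unfold gen0 in G0. unfold gen1 in YL at 1. unfold gen1 at 1. rewrite Rmult_0_l, Rplus_0_r in *.
assert (E : h 0 = y 0).
{ apply Rsqr_inj; unfold Rsqr; simpl in YL; lra. }
rewrite E in *. repeat split; auto; ring.
Qed.

End Trajectory.

End Potential.



Lemma gen_0 (X : R) : gen0 1 X 0 = 0 /\ gen1 1 X 0 = 0.
Proof.
assert (Z0 : Rabs 0 < e) by (rewrite Rabs_R0; lra).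
unfold gen0, gen1. rewrite Zh_eq, ZX_eq by auto. rewrite !pow_i by lia. lra.
Qed.

Lemma gen0_derive (X h : R) : Rabs h < e ->
  is_derive (fun z => z ^ 3 / 6 + z ^ 5 * s X z) h (gen0 1 X h).
Proof.
intros Hh. destruct (Cs_D _ _ _ Cs_Z) as (P & _).
assert (Q := partials_q _ _ _ _ _ _ _ (P X h 0 Hh)).
unfold gen0. rewrite Rmult_1_l. apply is_derive_plus_R.
- auto_derive; auto. field.
- exact Q.
Qed.

(** Moving [X] at fixed [h] moves both ends of the segment, so the derivative is the difference of
    the two momenta. *)
Lemma gen1_derive (X h : R) : Rabs h < e ->
  is_derive (fun z => h ^ 3 / 6 + h ^ 5 * s z h) X (gen1 1 X h - gen0 1 X h).
Proof.
intros Hh. destruct (Cs_D _ _ _ Cs_Z) as (P & _).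
assert (Q := partials_x _ _ _ _ _ _ _ (P X h 0 Hh)).
replace (gen1 1 X h - gen0 1 X h) with (0 + Derive (fun z => h ^ 5 * s z h) X) by (unfold gen1, gen0; ring).
apply is_derive_plus_R.
- apply is_derive_const_R.
- exact Q.
Qed.

(** [1 <= k'] makes [V] of class C^2, as uniqueness of the flow demands; [delta] lets the caller
    confine [h] to the domain of the generating function. *)
Theorem interpolation (delta : R) : (1 <= k')%nat -> 0 < delta ->
  exists (V : R -> R -> R -> R) (l0 : R),
    (forall x q t, 0 <= q -> V (x + 1) q t = V x q t /\ V x q (t + 1) = V x q t) /\
    Ck_half k V /\ 0 < l0 /\
    forall x l, 0 <= l <= l0 -> exists h, 0 <= h < delta /\ (0 < l -> 0 < h) /\ (l = 0 -> h = 0) /\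
      gen0 1 (x + h) h = l /\
      hamilton_flow (hamiltonian V) 1 x l (x + h) (gen1 1 (x + h) h).
Proof.
intros Hk Hdelta.
destruct (chi_normal_inverse b0 Cs_b0 b0_per) as (e0 & g0 & He0 & Hb0 & _ & Hg0 & Cg0).
destruct (chi_normal_inverse b1 Cs_b1 b1_per) as (e1 & g1 & He1 & Hb1 & Hinj1 & Hg1 & Cg1).
assert (CV := Ck_half_potential e1 g1 He1 Hb1 Hg1 Cg1).
set (V := potential e1 g1) in *.
destruct (CV) as [_ [Vx [Vq [Vt [DV [CVx [CVq _]]]]]]].
apply (Ck_half_le 1) in CVx; [|lia]. apply (Ck_half_le 1) in CVq; [|lia].
assert (CV1 : Ck_half 1 V) by (apply (Ck_half_le 1 k); auto; unfold k; lia).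
assert (DV' : forall x q t, 0 <= q -> is_derive (fun z => V z q t) x (Vx x q t) /\
  is_derive_on (fun z => 0 <= z) (fun z => V x z t) q (Vq x q t)).
{ intros x q t Hq. destruct (DV x q t Hq) as (A & B & _). split; assumption. }
(* [h <= 2 * y0 <= 2 * ym], so [delta / 4] gives [h < delta]; the other two bounds meet the strict
   hypotheses on [y0]. *)
set (ym := Rmin (Rmin (e0 / 8) (e1 / 256)) (delta / 4)).
assert (Hym : 0 < ym) by (unfold ym; repeat apply Rmin_pos; lra).
assert (Y1 : ym <= e0 / 8) by (unfold ym; eapply Rle_trans; apply Rmin_l).
assert (Y2 : ym <= e1 / 256) by (unfold ym; eapply Rle_trans; [apply Rmin_l|apply Rmin_r]).
assert (Y3 : ym <= delta / 4) by apply Rmin_r.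
exists V, (ym ^ 2 / 2). split; [|split; [|split]]; auto.
- intros x q t Hq. exact (potential_periodic e1 g1 He1 Hinj1 Hg1 x q t Hq).
- assert (0 < ym ^ 2) by (apply pow_lt; auto). lra.
- intros x l [[Hl|<-] Hl'].
  + set (y0 := sqrt (2 * l)).
    assert (Hy0 : 0 < y0) by (apply sqrt_lt_R0; lra).
    assert (Ey : y0 ^ 2 / 2 = l) by (unfold y0; rewrite pow2_sqrt; lra).
    assert (Hy0' : y0 <= ym).
    { rewrite <- (sqrt_pow2 ym) by lra. apply sqrt_le_1_alt. lra. }
    assert (A0 : 0 < y0 < e0 / 4) by lra.
    assert (A1 : y0 < e1 / 128) by lra.
    assert (Sol := trajectory_solution e1 g1 He1 Hb1 Hinj1 Hg1 Cg1 e0 g0 He0 Hb0 Hg0 Cg0 x y0 A0 A1).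
    assert (Ends := trajectory_ends e1 g1 He1 Hb1 Hinj1 Hg1 e0 g0 He0 Hb0 Hg0 x y0 A0 A1).
    cbv zeta in Sol, Ends. rewrite Ey in Ends.
    destruct (displacement_bounds e0 g0 Hb0 Hg0 x y0 A0 1) as [[B1 B2] _].
    destruct Ends as (E1 & E2 & E3 & E4 & E5).
    exists (g0 x y0 1). split; [lra|]. split; [auto|]. split; [lra|]. split; [exact E5|].
    split.
    * eexists. eexists. split; [exact Sol|]. split; [exact E1|exact E2].
    * intros X L HS HX HL.
      destruct (solution_unique V Vx Vq CV1 CVx CVq DV' _ _ _ _ HS Sol) as [U1 U2].
      rewrite HX; symmetry; exact E1. rewrite HL; symmetry; exact E2.
      rewrite U1, U2. split; [exact E3|exact E4].
  (* At [l = 0] the explicit trajectory degenerates, [y] being zero; the constant curve is the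
     solution. *)
  + exists 0.
    destruct (gen_0 (x + 0)) as [G0 G1].
    split; [lra|]. split; [lra|]. split; [auto|]. split; [exact G0|]. rewrite G1, Rplus_0_r.
    assert (Sol : hamilton_solution (hamiltonian V) 1 (fun _ => x) (fun _ => 0)).
    { apply (hamilton_solution_iff V Vx Vq CV1 DV'). intros t Ht.
      split; [lra|]. rewrite sqrt_0.
      split; (apply is_derive_on_of_is_derive; [exact Ht|]).
      - replace (ham_dl V Vq x 0 t) with 0 by (unfold ham_dl; ring).
        apply is_derive_const_R.
      - replace (- (0 ^ 5 * Vx x 0 t)) with 0 by ring.
        apply is_derive_const_R. }
    split.
    * exists (fun _ => x), (fun _ => 0). auto.
    * intros X L HS HX HL.
      apply (solution_unique V Vx Vq CV1 CVx CVq DV' X L (fun _ => x) (fun _ => 0)); auto.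
Qed.

End Interpolation.


(** * Chord lengths *)

Lemma Cs_comp1 (d : R) (k : nat) (f : R -> R) (g : R -> R -> R -> R) :
  (forall d, Cs d k (fun x _ _ => f x)) -> Cs d k g -> Cs d k (fun x q t => f (g x q t)).
Proof.
intros Hf Hg.
apply (Cs_comp d 1 k (fun x _ _ => f x) g (fun _ _ _ => 0) (fun _ _ _ => 0)); auto.
intros; rewrite Rabs_R0; lra. apply Cs_const. apply Cs_const.
Qed.

(* If [f] has derivative [f'], then [slope f' s u] is the divided difference
   [(f (s + u) - f s) / u], extended by [f' s] at [u = 0]. *)
Definition slope (f' : R -> R) (s u t : R) : R := avg 0 (fun s u _ => f' (s + u)) s u t.

Lemma Cs_shift (d : R) (k : nat) (f : R -> R) :
  (forall d, Cs d k (fun x _ _ => f x)) -> Cs d k (fun s u _ => f (s + u)).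
Proof. intros H. apply Cs_comp1; auto. apply Cs_plus. apply Cs_x. apply Cs_q. Qed.

Lemma Cs_slope (d : R) (k : nat) (f : R -> R) :
  (forall d, Cs d k (fun x _ _ => f x)) -> Cs d k (slope f).
Proof. intros H. exact (Cs_avg d k 0 _ (Cs_shift d k f H)). Qed.

Lemma slope_eq (f f' : R -> R) (s u t : R) :
  (forall d, Cs d 0 (fun x _ _ => f' x)) -> (forall s, is_derive f s (f' s)) ->
  f (s + u) - f s = u * slope f' s u t.
Proof.
intros H D.
assert (Hd : Rabs u < Rabs u + 1) by lra.
rewrite (avg_integrate 0 (fun s u _ => f (s + u) - f s) (fun s u _ => f' (s + u)) (Rabs u + 1) s u t); auto.
- unfold slope. ring.
- intros x q t' Hq. eapply Cs_cont; [|exact Hq]. apply Cs_shift. exact H.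
- intros z _. simpl. rewrite Rmult_1_l.
  replace (f' (s + z)) with (1 * f' (s + z) - 0) by ring.
  apply (is_derive_minus_R (fun z => f (s + z)) (fun _ => f s)).
  + apply (is_derive_comp f (fun z => s + z)); auto. auto_derive; auto.
  + apply is_derive_const_R.
- rewrite Rplus_0_r. ring.
Qed.

Lemma slope_0 (f' : R -> R) (s t : R) : slope f' s 0 t = f' s.
Proof. unfold slope. rewrite avg_0, Rplus_0_r. simpl. field. Qed.

(** A divided difference is symmetric in its two nodes. *)
Lemma slope_sym (f f' : R -> R) (s u t : R) :
  (forall d, Cs d 0 (fun x _ _ => f' x)) -> (forall s, is_derive f s (f' s)) ->
  slope f' (s + u) (- u) t = slope f' s u t.
Proof.
intros H D. destruct (Req_dec u 0) as [->|N].
- rewrite Rplus_0_r, Ropp_0. reflexivity.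
- assert (A := slope_eq f f' s u t H D). assert (B := slope_eq f f' (s + u) (- u) t H D).
  replace (s + u + - u) with s in B by ring.
  apply Rmult_eq_reg_l with u; auto. lra.
Qed.

Lemma avg_per (m : nat) (f : R -> R -> R -> R) (x q t : R) :
  (forall q, f (x + 1) q t = f x q t) -> avg m f (x + 1) q t = avg m f x q t.
Proof. intros H. apply RInt_ext. intros. rewrite H. reflexivity. Qed.

Lemma slope_per (f : R -> R) (s u t : R) :
  (forall s, f (s + 1) = f s) -> slope f (s + 1) u t = slope f s u t.
Proof.
intros H. apply (avg_per 0 (fun s u _ => f (s + u))). intros q. replace (s + 1 + q) with (s + q + 1) by ring. apply H.
Qed.

Section ChordLength.

Variables (k : nat) (x1 x2 a b a' b' : R -> R).
Hypothesis Da : forall s, is_derive x1 s (a s).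
Hypothesis Db : forall s, is_derive x2 s (b s).
Hypothesis Da' : forall s, is_derive a s (a' s).
Hypothesis Db' : forall s, is_derive b s (b' s).
Hypothesis Ca' : forall d, Cs d k (fun s _ _ => a' s).
Hypothesis Cb' : forall d, Cs d k (fun s _ _ => b' s).
Hypothesis Unit : forall s, a s ^ 2 + b s ^ 2 = 1.
Hypothesis Pa' : forall s, a' (s + 1) = a' s.
Hypothesis Pb' : forall s, b' (s + 1) = b' s.

(** [|T(e) - T(e - c)| ^ 2 / c ^ 2] for the unit tangent [T = (a, b)], extended to [c = 0]; the base
    point is the end of the arc. *)
Let Y (e c t : R) := slope a' (e - c) c t ^ 2 + slope b' (e - c) c t ^ 2.
Let P (s u t : R) := avg 2 Y (s + u) u t.

(** [u ^ 4] times it is the squared arc length minus the squared chord. It averages only [a'] and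
    [b'], so it has their class. *)
Definition defect (s u t : R) : R := avg 3 P s u t.

Lemma Cs_Y (d : R) : Cs d k Y.
Proof.
assert (A : forall f, (forall d, Cs d k (fun s _ _ => f s)) -> Cs d k (fun e c t => slope f (e - c) c t)).
{ intros f Hf. apply (Cs_comp d d k (slope f) (fun e c _ => e - c) (fun _ c _ => c) (fun _ _ t => t)); auto.
  apply Cs_slope; auto. apply Cs_minus. apply Cs_x. apply Cs_q. apply Cs_q. apply Cs_t. }
apply Cs_plus; apply Cs_pow, A; auto.
Qed.

Lemma Cs_P (d : R) : Cs d k P.
Proof.
apply (Cs_comp d d k (avg 2 Y) (fun s u _ => s + u) (fun _ u _ => u) (fun _ _ t => t)); auto.
apply (Cs_avg d k 2 Y), Cs_Y. apply Cs_plus. apply Cs_x. apply Cs_q. apply Cs_q. apply Cs_t.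
Qed.

Lemma Cs_defect (d : R) : Cs d k defect.
Proof. exact (Cs_avg d k 3 P (Cs_P d)). Qed.

Lemma Y_per (e c t : R) : Y (e + 1) c t = Y e c t.
Proof.
unfold Y. replace (e + 1 - c) with (e - c + 1) by ring. rewrite !slope_per; auto.
Qed.

Lemma defect_per (s u t : R) : defect (s + 1) u t = defect s u t.
Proof.
apply (avg_per 3 P). intros q. unfold P. replace (s + 1 + q) with (s + q + 1) by ring.
apply (avg_per 2 Y). intros; apply Y_per.
Qed.

Lemma continuous_a' (d : R) : Cs d 0 (fun s _ _ => a' s).
Proof. apply (Cs_le d 0 k); auto. lia. Qed.

Lemma continuous_b' (d : R) : Cs d 0 (fun s _ _ => b' s).
Proof. apply (Cs_le d 0 k); auto. lia. Qed.

(* With the end point [e] fixed, the left-hand side has [u]-derivative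
   [2 - 2 T(e).T(e - u) = |T(e) - T(e - u)|^2], where [T = (a, b)]. *)
Lemma half_defect (e u t : R) :
  2 * u - 2 * ((x1 e - x1 (e - u)) * a e + (x2 e - x2 (e - u)) * b e) = u ^ 3 * avg 2 Y e u t.
Proof.
assert (Hd : Rabs u < Rabs u + 1) by lra.
apply (avg_integrate 2 (fun e u _ => 2 * u - 2 * ((x1 e - x1 (e - u)) * a e + (x2 e - x2 (e - u)) * b e))
  Y (Rabs u + 1) e u t); auto.
- intros; eapply Cs_cont; [apply Cs_Y|eassumption].
- intros z _.
  assert (Sh : is_derive (fun z => e - z) z (-1)) by (auto_derive; auto; ring).
  assert (A := is_derive_comp x1 (fun z => e - z) z _ _ (Da (e - z)) Sh).
  assert (B := is_derive_comp x2 (fun z => e - z) z _ _ (Db (e - z)) Sh).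
  assert (E1 := slope_eq a a' (e - z) z t continuous_a' Da').
  assert (E2 := slope_eq b b' (e - z) z t continuous_b' Db').
  replace (e - z + z) with e in E1, E2 by ring.
  assert (U := Unit e). assert (U' := Unit (e - z)).
  replace (z ^ 2 * Y e z t) with (2 - 2 * (a (e - z) * a e + b (e - z) * b e)).
  + auto_derive.
    * repeat split; auto; eexists; [exact (Da (e + - z))|exact (Db (e + - z))].
    * replace (Derive _ (e + - z)) with (a (e - z)) by (symmetry; apply is_derive_unique, Da).
      replace (Derive _ (e + - z)) with (b (e - z)) by (symmetry; apply is_derive_unique, Db).
      ring.
  + unfold Y.
    replace (z ^ 2 * (slope a' (e - z) z t ^ 2 + slope b' (e - z) z t ^ 2)) with
      ((z * slope a' (e - z) z t) ^ 2 + (z * slope b' (e - z) z t) ^ 2) by ring.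
    rewrite <- E1, <- E2. lra.
- rewrite Rminus_0_r. ring.
Qed.

(** The [u]-derivative of squared arc minus squared chord is the left-hand side of [half_defect]
    with end point [s + u]; a second weighted integration supplies the fourth power. *)
Lemma chord_sqr (s u t : R) :
  (x1 (s + u) - x1 s) ^ 2 + (x2 (s + u) - x2 s) ^ 2 = u ^ 2 * (1 - u ^ 2 * defect s u t).
Proof.
assert (Hd : Rabs u < Rabs u + 1) by lra.
assert (E : u ^ 2 - ((x1 (s + u) - x1 s) ^ 2 + (x2 (s + u) - x2 s) ^ 2) = u ^ 4 * defect s u t).
2: lra.
apply (avg_integrate 3 (fun s u _ => u ^ 2 - ((x1 (s + u) - x1 s) ^ 2 + (x2 (s + u) - x2 s) ^ 2))
  P (Rabs u + 1) s u t); auto.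
- intros; eapply Cs_cont; [apply Cs_P|eassumption].
- intros z _. unfold P. rewrite <- half_defect. replace (s + z - z) with s by ring.
  auto_derive.
  + repeat split; auto; eexists; [exact (Da (s + z))|exact (Db (s + z))].
  + replace (Derive _ (s + z)) with (a (s + z)) by (symmetry; apply is_derive_unique, Da).
    replace (Derive _ (s + z)) with (b (s + z)) by (symmetry; apply is_derive_unique, Db).
    ring.
- rewrite Rplus_0_r. ring.
Qed.

Lemma defect_0 (s t : R) : defect s 0 t = (a' s ^ 2 + b' s ^ 2) / 12.
Proof.
unfold defect. rewrite avg_0. unfold P. rewrite avg_0. unfold Y.
rewrite Rplus_0_r, Rminus_0_r, !slope_0. simpl. field.
Qed.

(** Reversing the arc changes neither the chord nor [u ^ 2]. *)
Lemma defect_sym (s u t : R) : defect (s + u) (- u) t = defect s u t.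
Proof.
destruct (Req_dec u 0) as [->|N].
- rewrite Rplus_0_r, Ropp_0. reflexivity.
- assert (A := chord_sqr s u t). assert (B := chord_sqr (s + u) (- u) t).
  replace (s + u + - u) with s in B by ring.
  assert (U : u ^ 4 * defect (s + u) (- u) t = u ^ 4 * defect s u t) by lra.
  apply Rmult_eq_reg_l with (u ^ 4); auto. apply pow_nonzero; auto.
Qed.

Lemma tangent_orthogonal (s : R) : a s * a' s + b s * b' s = 0.
Proof.
assert (D : is_derive (fun s => a s ^ 2 + b s ^ 2) s (2 * (a s * a' s + b s * b' s))).
{ replace (2 * (a s * a' s + b s * b' s)) with (INR 2 * a' s * a s ^ 1 + INR 2 * b' s * b s ^ 1) by (simpl; ring).
  apply (is_derive_plus_R (fun s => a s ^ 2) (fun s => b s ^ 2));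
  apply is_derive_pow; auto. }
apply is_derive_unique in D.
rewrite (Derive_ext _ (fun _ => 1)), Derive_const in D by auto. lra.
Qed.

(** Lagrange's identity for [T] and [T'], which are orthogonal because [T] has length one. *)
Lemma curvature_sqr (s : R) : a' s ^ 2 + b' s ^ 2 = (a s * b' s - b s * a' s) ^ 2.
Proof.
assert (U := Unit s). assert (O := tangent_orthogonal s).
replace ((a s * b' s - b s * a' s) ^ 2) with
  ((a s ^ 2 + b s ^ 2) * (a' s ^ 2 + b' s ^ 2) - (a s * a' s + b s * b' s) ^ 2) by ring.
rewrite U, O. ring.
Qed.

Let Y2 (s u t : R) := a s * slope b' s u t - b s * slope a' s u t.

(** [u ^ 2] times it is the height of the point at [s + u] over the tangent line at [s]. Its sign
    later decides the sign of the sines of the billiard angles. *)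
Definition sagitta (s u t : R) : R := avg 1 Y2 s u t.

Hypothesis Ca : forall d, Cs d k (fun s _ _ => a s).
Hypothesis Cb : forall d, Cs d k (fun s _ _ => b s).
Hypothesis Pa : forall s, a (s + 1) = a s.
Hypothesis Pb : forall s, b (s + 1) = b s.

Lemma Cs_sagitta (d : R) : Cs d k sagitta.
Proof.
apply (Cs_avg d k 1 Y2), Cs_minus; apply Cs_mult; auto; apply Cs_slope; auto.
Qed.

Lemma sagitta_per (s u t : R) : sagitta (s + 1) u t = sagitta s u t.
Proof. apply (avg_per 1 Y2). intros q. unfold Y2. rewrite !slope_per, Pa, Pb; auto. Qed.

Lemma sagitta_0 (s t : R) : sagitta s 0 t = (a s * b' s - b s * a' s) / 2.
Proof. unfold sagitta. rewrite avg_0. unfold Y2. rewrite !slope_0. simpl. field. Qed.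

Lemma sagitta_eq (s u t : R) :
  a s * (x2 (s + u) - x2 s) - b s * (x1 (s + u) - x1 s) = u ^ 2 * sagitta s u t.
Proof.
assert (Hd : Rabs u < Rabs u + 1) by lra.
apply (avg_integrate 1 (fun s u _ => a s * (x2 (s + u) - x2 s) - b s * (x1 (s + u) - x1 s))
  Y2 (Rabs u + 1) s u t); auto.
- intros; eapply Cs_cont; [|eassumption].
  apply Cs_minus; apply Cs_mult; auto; apply Cs_slope; auto.
- intros z _. unfold Y2.
  replace (z ^ 1 * (a s * slope b' s z t - b s * slope a' s z t)) with
    (a s * (z * slope b' s z t) - b s * (z * slope a' s z t)) by ring.
  rewrite <- (slope_eq a a' s z t continuous_a' Da'), <- (slope_eq b b' s z t continuous_b' Db').
  auto_derive.
  + repeat split; auto; eexists; [exact (Db (s + z))|exact (Da (s + z))].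
  + replace (Derive _ (s + z)) with (b (s + z)) by (symmetry; apply is_derive_unique, Db).
    replace (Derive _ (s + z)) with (a (s + z)) by (symmetry; apply is_derive_unique, Da).
    ring.
- rewrite Rplus_0_r. ring.
Qed.

End ChordLength.


(** * The billiard in Lazutkin coordinates *)

Lemma Rpower_cube (x : R) : 0 < x -> Rpower x (2 / 3) ^ 3 = x ^ 2.
Proof.
intros H. rewrite <- (Rpower_pow 3), <- (Rpower_pow 2) by (auto; apply exp_pos).
rewrite Rpower_mult. f_equal. simpl. field.
Qed.

Section Curve.

Variables (gamma : R -> R * R) (k : nat).

Let x1 (s : R) := fst (gamma s).
Let x2 (s : R) := snd (gamma s).
Let a (s : R) := Derive x1 s.
Let b (s : R) := Derive x2 s.
Let a' (s : R) := Derive a s.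
Let b' (s : R) := Derive b s.

Hypothesis Cx1 : Ck (5 + k) x1.
Hypothesis Cx2 : Ck (5 + k) x2.
Hypothesis Unit : forall s, a s ^ 2 + b s ^ 2 = 1.
Hypothesis Per : forall s, gamma (s + 1) = gamma s.
Hypothesis Curv : forall s, 0 < curvature gamma s.

Lemma curvature_eq (s : R) : curvature gamma s = a s * b' s - b s * a' s.
Proof. reflexivity. Qed.

Lemma x1_derive (s : R) : is_derive x1 s (a s).
Proof. apply (Ck_Derive _ _ Cx1). Qed.

Lemma x2_derive (s : R) : is_derive x2 s (b s).
Proof. apply (Ck_Derive _ _ Cx2). Qed.

Lemma a_derive (s : R) : is_derive a s (a' s).
Proof. apply (Ck_Derive (3 + k)). apply (Ck_Derive _ _ Cx1). Qed.

Lemma b_derive (s : R) : is_derive b s (b' s).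
Proof. apply (Ck_Derive (3 + k)). apply (Ck_Derive _ _ Cx2). Qed.

Lemma Cs_a' (d : R) : Cs d (3 + k) (fun s _ _ => a' s).
Proof. apply Cs_lift. apply (Ck_Derive (3 + k) a). apply (Ck_Derive _ _ Cx1). Qed.

Lemma Cs_b' (d : R) : Cs d (3 + k) (fun s _ _ => b' s).
Proof. apply Cs_lift. apply (Ck_Derive (3 + k) b). apply (Ck_Derive _ _ Cx2). Qed.

Lemma Cs_a (d : R) : Cs d (3 + k) (fun s _ _ => a s).
Proof. apply Cs_pred, Cs_lift. apply (Ck_Derive _ _ Cx1). Qed.

Lemma Cs_b (d : R) : Cs d (3 + k) (fun s _ _ => b s).
Proof. apply Cs_pred, Cs_lift. apply (Ck_Derive _ _ Cx2). Qed.

Lemma a_per (s : R) : a (s + 1) = a s.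
Proof. apply Derive_periodic. intros; unfold x1; rewrite Per; reflexivity. Qed.

Lemma b_per (s : R) : b (s + 1) = b s.
Proof. apply Derive_periodic. intros; unfold x2; rewrite Per; reflexivity. Qed.

Lemma a'_per (s : R) : a' (s + 1) = a' s.
Proof. apply Derive_periodic, a_per. Qed.

Lemma b'_per (s : R) : b' (s + 1) = b' s.
Proof. apply Derive_periodic, b_per. Qed.

Lemma curvature_per (s : R) : curvature gamma (s + 1) = curvature gamma s.
Proof. rewrite !curvature_eq, a_per, b_per, a'_per, b'_per. reflexivity. Qed.

Lemma Cs_curvature (d : R) : Cs d (3 + k) (fun s _ _ => curvature gamma s).
Proof.
apply (Cs_ext _ _ (fun s _ _ => a s * b' s - b s * a' s)). reflexivity.
apply Cs_minus; apply Cs_mult; auto using Cs_a, Cs_b, Cs_a', Cs_b'.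
Qed.

(** * Lazutkin's coordinate on the boundary and its inverse *)

Let w (s : R) := Rpower (rho gamma s) (- (2 / 3)).
Let c1 := Defs.C1 gamma.
Let f (s : R) := c1 * w s.
Let lam := lazutkin_x gamma.

Lemma rho_pos (s : R) : 0 < rho gamma s.
Proof. apply Rinv_0_lt_compat, Curv. Qed.

Lemma w_pos (s : R) : 0 < w s.
Proof. apply exp_pos. Qed.

Lemma w_curvature (s : R) : w s = Rpower (curvature gamma s) (2 / 3).
Proof.
unfold w, rho, Rpower. rewrite ln_Rinv by auto. f_equal. ring.
Qed.

Lemma Cs_w (d : R) : Cs d (3 + k) (fun s _ _ => w s).
Proof.
apply (Cs_ext _ _ (fun s _ _ => Rpower (curvature gamma s) (2 / 3))).
intros; symmetry; apply w_curvature.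
apply Cs_Rpower; auto. apply Cs_curvature.
Qed.

Lemma w_continuous (s : R) : continuous w s.
Proof.
apply (cont3_slice (fun s _ _ => w s) (fun s => s) (fun _ => 0) (fun _ => 0)).
apply (Cs_cont 1 _ _ s 0 0 (Cs_w 1)). rewrite Rabs_R0; lra.
apply continuous_id. apply continuous_const. apply continuous_const.
Qed.

Lemma w_ex_RInt (s s' : R) : ex_RInt w s s'.
Proof. apply (@ex_RInt_continuous R_CompleteNormedModule). intros; apply w_continuous. Qed.

Lemma c1_pos : 0 < c1.
Proof.
apply Rinv_0_lt_compat. apply RInt_gt_0. lra. intros; apply w_pos.
intros; apply w_continuous.
Qed.

Lemma f_pos (s : R) : 0 < f s.
Proof. apply Rmult_lt_0_compat. apply c1_pos. apply w_pos. Qed.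

Lemma Cs_f (d : R) : Cs d (3 + k) (fun s _ _ => f s).
Proof. apply Cs_scal, Cs_w. Qed.

Lemma f_per (s : R) : f (s + 1) = f s.
Proof. unfold f. rewrite !w_curvature, curvature_per. reflexivity. Qed.

(** The exponent [2 / 3] in the density [dx / ds] is made for this relation: it matches the cubic
    term of the chord deficit in [remainder_0]. *)
Lemma f_cube (s : R) : f s ^ 3 = c1 ^ 3 * curvature gamma s ^ 2.
Proof. unfold f. rewrite Rpow_mult_distr, w_curvature, Rpower_cube; auto. Qed.

Lemma lam_derive (s : R) : is_derive lam s (f s).
Proof.
apply is_derive_scal. apply (@is_derive_RInt R_NormedModule w _ 0).
- apply filter_forall. intros z. apply (@RInt_correct R_CompleteNormedModule). apply w_ex_RInt.
- apply w_continuous.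
Qed.

Lemma lam_0 : lam 0 = 0.
Proof. unfold lam, lazutkin_x. rewrite RInt_point. apply Rmult_0_r. Qed.

(** The difference [lam (s + 1) - lam s] has zero derivative, and [c1] is chosen so that its value
    at [0] is [1]. *)
Lemma lam_shift (s : R) : lam (s + 1) = lam s + 1.
Proof.
assert (L1 : lam 1 = 1).
{ unfold lam, lazutkin_x. apply Rinv_l. apply Rgt_not_eq. apply RInt_gt_0. lra.
  intros; apply w_pos. intros; apply w_continuous. }
assert (B := mvt_linear_bound (fun s => lam (s + 1) - lam s) (fun _ => 0) 0 s 0 0).
cbv beta in B. rewrite Rplus_0_l, L1, lam_0 in B.
assert (C : Rabs (lam (s + 1) - lam s - (1 - 0) - 0 * (s - 0)) <= 0 * Rabs (s - 0)).
{ apply B.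
  - intros z _. replace 0 with (1 * f (z + 1) - f z) by (rewrite f_per; ring).
    apply (is_derive_minus_R (fun z => lam (z + 1)) lam).
    + apply (is_derive_comp lam (fun z => z + 1)). apply lam_derive. auto_derive; auto.
    + apply lam_derive.
  - intros. rewrite Rminus_0_r, Rabs_R0. lra. }
generalize (Rabs_pos (lam (s + 1) - lam s - (1 - 0) - 0 * (s - 0))). intros D.
assert (E : Rabs (lam (s + 1) - lam s - (1 - 0) - 0 * (s - 0)) = 0) by lra.
apply Rabs_eq_0 in E. lra.
Qed.

(** Obtained by bounding the periodic function [/ f] from above. *)
Lemma f_lower : exists q, 0 < q /\ forall s, q <= f s.
Proof.
destruct (periodic_bounded 2 1 (fun s _ _ => / f s)) as [K [K0 HK]].
- lra.
- intros x q t Hq. apply (Cs_cont 2 (3 + k)); auto. apply Cs_inv. intros; generalize (f_pos x0); lra.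
  apply Cs_f.
- intros. rewrite f_per. reflexivity.
- exists (/ K). split. apply Rinv_0_lt_compat; auto.
  intros s. specialize (HK s 0 ltac:(rewrite Rabs_R0; lra)).
  assert (F := f_pos s). rewrite Rabs_pos_eq in HK by (left; apply Rinv_0_lt_compat; auto).
  rewrite <- (Rinv_inv (f s)). apply Rinv_le_contravar; auto. apply Rinv_0_lt_compat; auto.
Qed.

Lemma lam_slope (q s s' : R) : (forall s, q <= f s) -> s <= s' -> q * (s' - s) <= lam s' - lam s.
Proof.
intros Hq H. apply (slope_ge lam f); auto. intros; apply lam_derive.
Qed.

Lemma lam_onto (x : R) : exists s, lam s = x.
Proof.
destruct f_lower as [q [Hq F]].
(* [q * M = Rabs x + 1] pushes [lam (- M)] and [lam M] beyond [x] on either side. *)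
set (M := (Rabs x + 1) / q).
assert (HM : 0 < M) by (apply Rdiv_lt_0_compat; auto; generalize (Rabs_pos x); lra).
assert (QM : q * M = Rabs x + 1) by (unfold M; field; lra).
assert (C : forall z, continuity_pt lam z).
{ intros z. apply derivable_continuous_pt. exists (f z). apply is_derive_Reals, lam_derive. }
destruct (IVT_Rbar_incr lam (- M) M (lam (- M)) (lam M) x) as [s [_ [_ E]]].
- apply (is_lim_continuity lam (- M)); auto.
- apply (is_lim_continuity lam M); auto.
- auto.
- simpl; lra.
- assert (A := lam_slope q 0 M F ltac:(lra)). assert (B := lam_slope q (- M) 0 F ltac:(lra)).
  rewrite lam_0 in A, B. simpl.
  generalize (Rle_abs x). intros. assert (- Rabs x <= x) by (generalize (Rle_abs (- x)); rewrite Rabs_Ropp; lra).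
  lra.
- exists s; auto.
Qed.

Definition lam_inv (x : R) : R := proj1_sig (constructive_indefinite_description _ (lam_onto x)).

Lemma lam_inv_r (x : R) : lam (lam_inv x) = x.
Proof. unfold lam_inv. destruct constructive_indefinite_description. auto. Qed.

Lemma lam_inj (s s' : R) : lam s = lam s' -> s = s'.
Proof.
intros E. destruct f_lower as [q [Hq F]].
destruct (Rle_dec s s') as [L|L].
- assert (A := lam_slope q s s' F L). nra.
- assert (A := lam_slope q s' s F ltac:(lra)). nra.
Qed.

Lemma lam_inv_shift (x : R) : lam_inv (x + 1) = lam_inv x + 1.
Proof. apply lam_inj. rewrite lam_shift, !lam_inv_r. reflexivity. Qed.

Lemma lam_inv_lip : exists K, 0 < K /\
  (forall x x', Rabs (lam_inv x' - lam_inv x) <= K * Rabs (x' - x)) /\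
  forall x x', x < x' -> lam_inv x < lam_inv x'.
Proof.
destruct f_lower as [q [Hq F]]. exists (/ q). split. apply Rinv_0_lt_compat; auto.
assert (M : forall x x', x < x' -> 0 < lam_inv x' - lam_inv x <= / q * (x' - x)).
{ intros x x' H. destruct (Rle_dec (lam_inv x') (lam_inv x)) as [L|L].
  - assert (A := lam_slope q _ _ F L). rewrite !lam_inv_r in A. nra.
  - assert (A := lam_slope q (lam_inv x) (lam_inv x') F ltac:(lra)). rewrite !lam_inv_r in A.
    split; [lra|]. apply Rmult_le_reg_l with q; auto. rewrite <- Rmult_assoc, Rinv_r by lra. lra. }
split.
- intros x x'. destruct (Rtotal_order x x') as [L|[->|L]].
  + specialize (M _ _ L). rewrite !Rabs_pos_eq; lra.
  + rewrite !Rminus_diag, Rabs_R0. lra.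
  + specialize (M _ _ L). rewrite (Rabs_minus_sym x' x), Rabs_minus_sym, !Rabs_pos_eq; lra.
- intros x x' H. specialize (M _ _ H). lra.
Qed.

Lemma lam_inv_continuous (x : R) : continuous lam_inv x.
Proof.
destruct lam_inv_lip as [K [HK [L _]]]. apply filterlim_locally. intros eps.
assert (H : 0 < eps / K) by (apply Rdiv_lt_0_compat; auto; apply cond_pos).
exists (mkposreal _ H). intros y Hy. change (Rabs (y - x) < eps / K) in Hy.
change (Rabs (lam_inv y - lam_inv x) < eps). eapply Rle_lt_trans; [apply L|].
apply Rmult_lt_reg_l with (/ K). apply Rinv_0_lt_compat; auto.
rewrite <- Rmult_assoc, Rinv_l, Rmult_1_l by lra. rewrite Rmult_comm. exact Hy.
Qed.

Lemma lam_inv_derive (x : R) : is_derive lam_inv x (/ f (lam_inv x)).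
Proof.
assert (Cf : forall z d, 0 < d -> cont3 (fun _ s _ => f s) z (lam_inv x) 0).
{ intros. apply (cont3_comp1 f).
  - apply (cont3_slice (fun s _ _ => f s) (fun s => s) (fun _ => 0) (fun _ => 0)).
    apply (Cs_cont 1 _ _ _ 0 0 (Cs_f 1)). rewrite Rabs_R0; lra.
    apply continuous_id. apply continuous_const. apply continuous_const.
  - apply cont3_q. }
replace (/ f (lam_inv x)) with ((1 - 0 * 0 - 0 * 0) / f (lam_inv x)) by (field; generalize (f_pos (lam_inv x)); lra).
apply (is_derive_implicit (fun _ s _ => lam s) (fun _ _ _ => 0) (fun _ s _ => f s) (fun _ _ _ => 0)
  (Rabs (lam_inv x) + 1) (fun _ => 0) lam_inv (fun _ => 0) (fun x => x) x 0 0 1); try (apply cont3_const).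
- intros; split; [|split].
  + apply is_derive_const_R.
  + apply lam_derive.
  + apply is_derive_const_R.
- lra.
- apply (Cf 0 1); lra.
- generalize (f_pos (lam_inv x)); lra.
- apply is_derive_const_R.
- apply is_derive_const_R.
- apply is_derive_id_R.
- apply lam_inv_continuous.
- apply filter_forall. apply lam_inv_r.
Qed.

(** Bootstrap on the equation expressing the derivative of [lam_inv] as [/ f (lam_inv x)]. *)
Lemma Cs_lam_inv (d : R) : Cs d (3 + k) (fun x _ _ => lam_inv x).
Proof.
assert (H : forall j d, (j <= 3 + k)%nat -> Cs d j (fun x _ _ => lam_inv x)); [|auto].
induction j; intros d' Hj.
- split; auto. intros. apply (cont3_comp1 lam_inv). apply lam_inv_continuous. apply cont3_x.
- apply (Cs_S _ _ _ (fun x _ _ => / f (lam_inv x)) (fun _ _ _ => 0) (fun _ _ _ => 0)).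
  + intros; split; [|split]. apply lam_inv_derive.
    apply is_derive_const_R.
    apply is_derive_const_R.
  + apply Cs_inv. intros; generalize (f_pos (lam_inv x)); lra.
    apply (Cs_comp1 d' j f (fun x _ _ => lam_inv x)). intros; apply (Cs_le _ j (3 + k)); [lia|apply Cs_f].
    apply IHj. lia.
  + apply Cs_const.
  + apply Cs_const.
Qed.

Lemma Cs_f_0 (d : R) : Cs d 0 (fun s _ _ => f s).
Proof. apply (Cs_le d 0 (3 + k)). lia. apply Cs_f. Qed.

Lemma lam_diff (s u t : R) : lam (s + u) - lam s = u * slope f s u t.
Proof. apply slope_eq. apply Cs_f_0. apply lam_derive. Qed.

Lemma slope_f_pos (s u t : R) : 0 < slope f s u t.
Proof.
destruct (Req_dec u 0) as [->|N]. rewrite slope_0. apply f_pos.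
destruct f_lower as [q [Hq F]].
assert (E := lam_diff s u t).
destruct (Rlt_dec 0 u) as [L|L].
- assert (A := lam_slope q s (s + u) F ltac:(lra)). rewrite E in A.
  assert (q <= slope f s u t); [|lra]. apply Rmult_le_reg_l with u; lra.
- assert (A := lam_slope q (s + u) s F ltac:(lra)).
  assert (q <= slope f s u t); [|lra]. apply Rmult_le_reg_l with (- u); lra.
Qed.

Let Q := defect a' b'.

Lemma Q_small : exists d, 0 < d < 1 /\ (forall s u t, Rabs u < d -> / 2 <= 1 - u ^ 2 * Q s u t).
Proof.
assert (CQ : forall d, Cs d (3 + k) Q) by (intros; apply Cs_defect; [apply Cs_a'|apply Cs_b']).
destruct (periodic_bounded 2 1 Q) as [K [K0 HK]].
- lra.
- intros; eapply Cs_cont; eauto.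
- intros; apply defect_per. apply a'_per. apply b'_per.
- exists (/ (2 * (K + 1))).
  assert (D : 0 < / (2 * (K + 1))) by (apply Rinv_0_lt_compat; lra).
  assert (E : / (2 * (K + 1)) * (2 * (K + 1)) = 1) by (field; lra).
  set (d := / (2 * (K + 1))) in *. split. nra.
  intros s u t Hu. assert (Hu1 : Rabs u <= 1) by nra.
  (* The bound is known at time [0]; [Q s u 0] and [Q s u t] are convertible. *)
  specialize (HK s u Hu1). change (Q s u 0) with (Q s u t) in HK.
  assert (Rabs (u ^ 2 * Q s u t) <= / 2).
  { rewrite Rabs_mult. simpl. rewrite Rmult_1_r, Rabs_mult.
    pose proof (Rabs_pos u). pose proof (Rabs_pos (Q s u t)).
    assert (Rabs u * Rabs u <= d * 1) by (apply Rmult_le_compat; lra).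
    assert (Rabs u * Rabs u * Rabs (Q s u t) <= d * 1 * K) by (apply Rmult_le_compat; try lra; nra).
    nra. }
  apply Rabs_le_between in H. lra.
Qed.

Lemma sagitta_positive : exists d, 0 < d < 1 /\
  forall s u t, Rabs u < d -> 0 < sagitta a b a' b' s u t.
Proof.
set (J := sagitta a b a' b').
assert (CJ : forall d, Cs d (3 + k) J) by (intros; apply Cs_sagitta; [apply Cs_a'|apply Cs_b'|apply Cs_a|apply Cs_b]).
set (R := fun s u t => J s u t / curvature gamma s).
assert (CR : Cs 2 (3 + k) R).
{ apply Cs_div; auto. intros; generalize (Curv x); lra. apply Cs_curvature. }
assert (PR : forall s u t, R (s + 1) u t = R s u t).
{ intros. unfold R. rewrite curvature_per. unfold J. rewrite (sagitta_per a b a' b' a'_per b'_per a_per b_per). reflexivity. }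
destruct (Cs_D _ _ _ CR) as (P & _ & CRq & _).
destruct (periodic_bounded 2 1 (Dq R)) as [K [K0 HK]].
- lra.
- intros; eapply Cs_cont; eauto.
- intros x q t Hq. apply Derive_ext. intros; apply PR.
- exists (/ (4 * (K + 1))).
  assert (D : 0 < / (4 * (K + 1))) by (apply Rinv_0_lt_compat; lra).
  assert (E : / (4 * (K + 1)) * (4 * (K + 1)) = 1) by (field; lra).
  set (d := / (4 * (K + 1))) in *. split. nra.
  intros s u t Hu. assert (Hu1 : Rabs u <= 1) by nra.
  assert (B : Rabs (R s u 0 - R s 0 0 - 0 * (u - 0)) <= K * Rabs (u - 0)).
  { apply (mvt_linear_bound (fun z => R s z 0) (fun z => Dq R s z 0)).
    - intros z Hz. assert (Rabs z < 2).
      { replace z with (z - 0) by ring. apply (between_abs _ u); auto. rewrite Rminus_0_r; lra. }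
      exact (partials_q _ _ _ _ _ _ _ (P s z 0 H)).
    - intros z Hz. rewrite Rminus_0_r. apply HK.
      apply Rabs_le_between in Hu1. apply Rabs_le_between.
      unfold Rmin, Rmax in Hz; destruct Rle_dec; lra. }
  assert (R0 : R s 0 0 = / 2).
  { unfold R, J. rewrite sagitta_0, <- curvature_eq. field. generalize (Curv s); lra. }
  rewrite R0, !Rminus_0_r, Rmult_0_l, Rminus_0_r in B.
  apply Rabs_le_between in B.
  assert (RP : 0 < R s u 0) by nra.
  change (R s u 0) with (J s u t / curvature gamma s) in RP. assert (Cs0 := Curv s).
  replace (J s u t) with (J s u t / curvature gamma s * curvature gamma s) by (field; lra).
  apply Rmult_lt_0_compat; auto.
Qed.

(** * The generating function and its Lazutkin normal form *)

Section GeneratingFunction.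

Variable d0 : R.
Hypothesis Hd0 : 0 < d0 < 1.
Hypothesis HQ : forall s u t, Rabs u < d0 -> / 2 <= 1 - u ^ 2 * Q s u t.

(** Signed, hence regular across [u = 0]; for [0 < u < d0] it is the distance of the end points. *)
Definition chord_length (s u t : R) : R := u * sqrt (1 - u ^ 2 * Q s u t).

(** [(1 - sqrt (1 - z)) / u ^ 2] with [z = u ^ 2 * Q], rationalised so that no division by [u]
    remains. *)
Let E (s u t : R) := Q s u t / (1 + sqrt (1 - u ^ 2 * Q s u t)).

Lemma length_deficit (s u t : R) : Rabs u < d0 -> u - chord_length s u t = u ^ 3 * E s u t.
Proof.
intros Hu. specialize (HQ s u t Hu). unfold chord_length, E.
assert (S := sqrt_pos (1 - u ^ 2 * Q s u t)).
assert (S2 := pow2_sqrt (1 - u ^ 2 * Q s u t) ltac:(lra)).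
set (r := sqrt _) in *.
replace (u ^ 3 * (Q s u t / (1 + r))) with (u * (u ^ 2 * Q s u t) / (1 + r)) by (field; lra).
replace (u ^ 2 * Q s u t) with (1 - r ^ 2) by lra. field. lra.
Qed.

Lemma Cs_E : Cs d0 (3 + k) E.
Proof.
assert (CQ : Cs d0 (3 + k) Q) by (apply Cs_defect; [apply Cs_a'|apply Cs_b']).
apply Cs_div; auto.
- intros x q t _. generalize (sqrt_pos (1 - q ^ 2 * Q x q t)). lra.
- apply Cs_plus. apply Cs_const. apply Cs_sqrt.
  + intros x q t Hq. specialize (HQ x q t Hq). lra.
  + apply Cs_minus. apply Cs_const. apply Cs_mult; auto. apply Cs_pow, Cs_q.
Qed.

(** With [h = u * slope f s u], [u ^ 3 * D] is the generating function [4 * c1 ^ 3 * (u - chord)]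
    minus [h ^ 3 / 6]. *)
Let D (s u t : R) := 4 * c1 ^ 3 * E s u t - slope f s u t ^ 3 / 6.

Lemma Cs_remainder : Cs d0 (3 + k) D.
Proof.
apply Cs_minus. apply Cs_scal, Cs_E.
apply (Cs_mult _ _ (fun s u t => slope f s u t ^ 3) (fun _ _ _ => / 6)).
apply Cs_pow, Cs_slope, Cs_f. apply Cs_const.
Qed.

(** Both terms equal [c1 ^ 3 * curvature ^ 2 / 6] at [u = 0]: the deficit by [defect_0] and the cube
    by [f_cube]. *)
Lemma remainder_0 (s t : R) : D s 0 t = 0.
Proof.
unfold D, E. rewrite slope_0, f_cube. unfold Q. rewrite defect_0.
rewrite (curvature_sqr a b a' b' a_derive b_derive Unit), <- curvature_eq.
rewrite pow_i by lia. rewrite Rmult_0_l, Rminus_0_r, sqrt_1. field.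
Qed.

Lemma remainder_sym (s u t : R) : D (s + u) (- u) t = D s u t.
Proof.
unfold D, E. rewrite (slope_sym lam f s u t Cs_f_0 lam_derive).
assert (S := defect_sym (3 + k) x1 x2 a b a' b' x1_derive x2_derive a_derive b_derive Cs_a' Cs_b' Unit s u t).
fold Q in S. rewrite S. replace ((- u) ^ 2) with (u ^ 2) by ring. reflexivity.
Qed.

(** Differentiating [D (s + u) (- u) = D s u] at [u = 0] gives [D_s - D_u = D_u], and [D_s] vanishes
    there by [remainder_0]. *)
Lemma remainder_derive_0 (s t : R) : Dq D s 0 t = 0.
Proof.
destruct (Cs_D _ _ _ Cs_remainder) as (P & A & B & C).
assert (Z : Rabs 0 < d0) by (rewrite Rabs_R0; lra).
assert (G := is_derive_comp3 D (Dx D) (Dq D) (Dt D) d0 (fun u => s + u) (fun u => - u) (fun _ => t)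
  0 1 (-1) 0 P).
cbv beta in G. rewrite Ropp_0, Rplus_0_r in G.
specialize (G Z (Cs_cont _ _ _ s 0 t A Z) (Cs_cont _ _ _ s 0 t B Z) (Cs_cont _ _ _ s 0 t C Z)
  ltac:(auto_derive; auto) ltac:(auto_derive; auto) (is_derive_const_R t 0)).
apply is_derive_unique in G. rewrite (Derive_ext _ (fun u => D s u t)) in G by (intros; apply remainder_sym).
change (Derive (fun u => D s u t) 0) with (Dq D s 0 t) in G.
replace (Dx D s 0 t) with 0 in G. lra.
symmetry. unfold Dx. rewrite (Derive_ext _ (fun _ => 0)) by (intros; apply remainder_0). apply Derive_const.
Qed.

Lemma remainder_per (s u t : R) : D (s + 1) u t = D s u t.
Proof.
unfold D, E. rewrite (slope_per f) by apply f_per.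
unfold Q. rewrite defect_per; [reflexivity|apply a'_per|apply b'_per].
Qed.

Lemma remainder_quotient : exists D2, Cs d0 (S k) D2 /\
  (forall s u t, Rabs u < d0 -> D s u t = u ^ 2 * D2 s u t) /\
  forall s u t, D2 (s + 1) u t = D2 s u t.
Proof.
destruct (Hadamard d0 (2 + k) D Cs_remainder remainder_0) as [D1 [A [B [C P]]]].
destruct (Hadamard d0 (1 + k) D1 A) as [D2 [A' [B' [_ P']]]].
{ intros; rewrite C; apply remainder_derive_0. }
exists D2. split; auto. split.
- intros s u t Hu. rewrite B, B' by auto. ring.
- intros s u t. apply P'. apply P. intros; apply remainder_per.
Qed.

Section Sigma.

Variables (D2 : R -> R -> R -> R) (e : R).
Hypothesis CD2 : Cs d0 (S k) D2.
Hypothesis ED2 : forall s u t, Rabs u < d0 -> D s u t = u ^ 2 * D2 s u t.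
Hypothesis PD2 : forall s u t, D2 (s + 1) u t = D2 s u t.
Hypothesis Hdisp : forall X h, Rabs h < e -> Rabs (lam_inv X - lam_inv (X - h)) < d0.

(** Written so that [h ^ 5 * sigma = u ^ 5 * D2], since [h = u * slope f s u]; the slope is
    positive, so the quotient is regular. *)
Definition sigma (X h : R) : R :=
  let s := lam_inv (X - h) in let u := lam_inv X - lam_inv (X - h) in
  D2 s u 0 / slope f s u 0 ^ 5.

Lemma Cs_sigma : Cs e (S k) (fun X h _ => sigma X h).
Proof.
assert (CA : Cs e (S k) (fun X _ _ => lam_inv X)) by (apply (Cs_le _ _ (3 + k)); [lia|apply Cs_lam_inv]).
assert (CB : Cs e (S k) (fun X h _ => lam_inv (X - h))).
{ apply (Cs_comp1 e (S k) lam_inv (fun X h _ => X - h)).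
  intros; apply (Cs_le _ _ (3 + k)); [lia|apply Cs_lam_inv].
  apply Cs_minus. apply Cs_x. apply Cs_q. }
assert (CU := Cs_minus _ _ _ _ CA CB).
apply Cs_div.
- intros X h _ Hh. apply pow_nonzero.
  generalize (slope_f_pos (lam_inv (X - h)) (lam_inv X - lam_inv (X - h)) 0). lra.
- apply (Cs_comp e d0 (S k) D2 (fun X h _ => lam_inv (X - h)) (fun X h _ => lam_inv X - lam_inv (X - h)) (fun _ _ _ => 0)); auto.
  apply Cs_const.
- apply Cs_pow.
  apply (Cs_comp e d0 (S k) (slope f) (fun X h _ => lam_inv (X - h)) (fun X h _ => lam_inv X - lam_inv (X - h)) (fun _ _ _ => 0)); auto.
  apply Cs_slope. intros; apply (Cs_le _ _ (3 + k)); [lia|apply Cs_f].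
  apply Cs_const.
Qed.

Lemma sigma_per (X h : R) : sigma (X + 1) h = sigma X h.
Proof.
unfold sigma. replace (X + 1 - h) with (X - h + 1) by ring. rewrite !lam_inv_shift.
replace (lam_inv X + 1 - (lam_inv (X - h) + 1)) with (lam_inv X - lam_inv (X - h)) by ring.
rewrite PD2, (slope_per f) by apply f_per. reflexivity.
Qed.

Lemma generating_function (X h : R) : Rabs h < e ->
  let s := lam_inv (X - h) in let u := lam_inv X - lam_inv (X - h) in
  h ^ 3 / 6 + h ^ 5 * sigma X h = 4 * c1 ^ 3 * (u - chord_length s u 0).
Proof.
intros Hh s u. assert (Hu := Hdisp X h Hh). fold s u in Hu.
rewrite length_deficit by auto.
assert (Hsl := lam_diff s u 0). assert (Psl := slope_f_pos s u 0).
replace (s + u) with (lam_inv X) in Hsl by (unfold u, s; ring).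
unfold s in Hsl at 1. rewrite !lam_inv_r in Hsl.
replace (X - (X - h)) with h in Hsl by ring.
unfold sigma. fold s u. set (sl := slope f s u 0) in *.
assert (DE := ED2 s u 0 Hu). unfold D in DE. fold sl in DE.
transitivity (u ^ 3 * (sl ^ 3 / 6 + u ^ 2 * D2 s u 0)).
- change (lam_inv X - s) with u. fold sl. rewrite Hsl. field. lra.
- rewrite <- DE. field.
Qed.

Definition chord (s s' : R) : R := sqrt ((x1 s' - x1 s) ^ 2 + (x2 s' - x2 s) ^ 2).

Lemma chord_length_pos (s u : R) : 0 < u < d0 ->
  chord_length s u 0 = chord s (s + u) /\ 0 < chord s (s + u).
Proof.
intros Hu. assert (HQu := HQ s u 0 ltac:(rewrite Rabs_pos_eq; lra)).
unfold chord.
rewrite (chord_sqr (3 + k) x1 x2 a b a' b' x1_derive x2_derive a_derive b_derive Cs_a' Cs_b' Unit s u 0).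
rewrite sqrt_mult by (try apply pow2_ge_0; fold Q; lra). rewrite sqrt_pow2 by lra.
split; [reflexivity|]. apply Rmult_lt_0_compat; [lra|]. apply sqrt_lt_R0. fold Q; lra.
Qed.

Let cosv (s s' : R) := (a s * (x1 s' - x1 s) + b s * (x2 s' - x2 s)) / chord s s'.
Let cosv' (s s' : R) := (a s' * (x1 s' - x1 s) + b s' * (x2 s' - x2 s)) / chord s s'.

(** First variation of arc length minus chord. Both ends may move: differentiation in [h] moves the
    start alone, differentiation in [X] moves both. *)
Lemma action_derive (al be : R -> R) (z la lb : R) :
  0 < chord (al z) (be z) -> is_derive al z la -> is_derive be z lb ->
  is_derive (fun z => 4 * c1 ^ 3 * (be z - al z - chord (al z) (be z))) z
    (4 * c1 ^ 3 * ((1 - cosv' (al z) (be z)) * lb - (1 - cosv (al z) (be z)) * la)).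
Proof.
intros Hc HA HB.
assert (W1 := is_derive_minus_R _ _ _ _ _
   (is_derive_comp x1 be z _ _ (x1_derive (be z)) HB) (is_derive_comp x1 al z _ _ (x1_derive (al z)) HA)).
assert (W2 := is_derive_minus_R _ _ _ _ _
   (is_derive_comp x2 be z _ _ (x2_derive (be z)) HB) (is_derive_comp x2 al z _ _ (x2_derive (al z)) HA)).
apply (is_derive_pow _ 2) in W1. apply (is_derive_pow _ 2) in W2.
assert (W := is_derive_plus_R _ _ _ _ _ W1 W2).
assert (NZ : 0 < (x1 (be z) - x1 (al z)) ^ 2 + (x2 (be z) - x2 (al z)) ^ 2).
{ destruct (Rlt_le_dec 0 ((x1 (be z) - x1 (al z)) ^ 2 + (x2 (be z) - x2 (al z)) ^ 2)) as [L|L]; auto.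
  unfold chord in Hc. rewrite sqrt_neg_0 in Hc; lra. }
assert (S := is_derive_sqrt _ z _ W NZ).
assert (U := is_derive_minus_R _ _ _ _ _ HB HA).
assert (T := is_derive_minus_R _ _ _ _ _ U S).
apply (is_derive_scal _ z (4 * c1 ^ 3)) in T.
eapply (@eq_rect R _ (fun l => is_derive (fun z => 4 * c1 ^ 3 * (be z - al z - chord (al z) (be z))) z l)).
exact T.
unfold cosv, cosv'. fold (chord (al z) (be z)).
unfold minus, plus, opp, scal; simpl; unfold mult; simpl.
fold (x1 (be z) - x1 (al z)) (x2 (be z) - x2 (al z)).
match goal with |- context [sqrt ?A] => replace (sqrt A) with (chord (al z) (be z)) by
  (unfold chord; f_equal; simpl; ring) end.
field. lra.
Qed.

(** The [h]-derivative of the generating function gives [gen0], its [X]-derivative the difference of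
    the momenta; the factors [/ f] come from [lam_inv_derive]. *)
Lemma gen_cos (k' : nat) (X h : R) : k = S k' -> 0 < h < e ->
  let s := lam_inv (X - h) in let s' := lam_inv X in
  0 < s' - s < d0 /\
  gen0 sigma 1 X h = 4 * c1 ^ 3 / f s * (1 - cosv s s') /\
  gen1 sigma 1 X h = 4 * c1 ^ 3 / f s' * (1 - cosv' s s').
Proof.
intros Ek Hh s s'.
assert (He : Rabs h < e) by (rewrite Rabs_pos_eq; lra).
assert (Inc : forall z, 0 < z < e -> 0 < lam_inv X - lam_inv (X - z) < d0).
{ intros z Hz. destruct lam_inv_lip as [_ [_ [_ M]]]. specialize (M (X - z) X ltac:(lra)).
  assert (N := Hdisp X z ltac:(rewrite Rabs_pos_eq; lra)). apply Rabs_def2 in N. lra. }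
assert (Hu := Inc h Hh). split; [exact Hu|].
assert (CS : Cs e (S (S k')) (fun X h _ => sigma X h)) by (rewrite <- Ek; apply Cs_sigma).
assert (GF : forall X z, 0 < lam_inv X - lam_inv (X - z) < d0 -> Rabs z < e ->
  z ^ 3 / 6 + z ^ 5 * sigma X z =
  4 * c1 ^ 3 * (lam_inv X - lam_inv (X - z) - chord (lam_inv (X - z)) (lam_inv X))).
{ intros Y z Hz Hz'. rewrite (generating_function Y z Hz'). cbv zeta. f_equal. f_equal.
  destruct (chord_length_pos (lam_inv (Y - z)) _ Hz) as [E1 _]. rewrite E1. f_equal. ring. }
assert (Pc : 0 < chord s s').
{ destruct (chord_length_pos s _ Hu) as [_ E1]. fold s s' in E1.
  replace (s + (s' - s)) with s' in E1 by ring. exact E1. }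
assert (G0 : gen0 sigma 1 X h = 4 * c1 ^ 3 / f s * (1 - cosv s s')).
{ assert (A := gen0_derive e k' sigma CS X h He).
  assert (DA : is_derive (fun z => lam_inv (X - z)) h (- / f s)).
  { replace (- / f s) with (-1 * / f s) by ring.
    apply (is_derive_comp lam_inv (fun z => X - z)). apply lam_inv_derive. auto_derive; auto; ring. }
  assert (B := action_derive (fun z => lam_inv (X - z)) (fun _ => s') h _ 0 Pc DA
    (is_derive_const_R s' h)).
  assert (A' : is_derive (fun z => z ^ 3 / 6 + z ^ 5 * sigma X z) h
    (4 * c1 ^ 3 * ((1 - cosv' s s') * 0 - (1 - cosv s s') * - / f s))).
  { eapply is_derive_ext_loc; [|exact B].
    apply (locally_interval _ h 0 e); simpl; try lra. intros z Z1 Z2. symmetry.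
    apply (GF X z). apply Inc; lra. rewrite Rabs_pos_eq; lra. }
  transitivity (4 * c1 ^ 3 * ((1 - cosv' s s') * 0 - (1 - cosv s s') * - / f s)).
  - rewrite <- (is_derive_unique _ _ _ A). apply is_derive_unique. exact A'.
  - field. generalize (f_pos s). lra. }
split; [exact G0|].
assert (A := gen1_derive e k' sigma CS X h He).
assert (DA : is_derive (fun z => lam_inv (z - h)) X (/ f s)).
{ replace (/ f s) with (1 * / f s) by ring.
  apply (is_derive_comp lam_inv (fun z => z - h)). apply lam_inv_derive. auto_derive; auto; ring. }
assert (B := action_derive (fun z => lam_inv (z - h)) lam_inv X _ _ Pc DA (lam_inv_derive X)).
assert (A' : is_derive (fun z => h ^ 3 / 6 + h ^ 5 * sigma z h) X
  (4 * c1 ^ 3 * ((1 - cosv' s s') * / f s' - (1 - cosv s s') * / f s))).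
{ eapply is_derive_ext; [|exact B]. intros z. symmetry. apply (GF z h); auto.
  destruct lam_inv_lip as [_ [_ [_ M]]]. specialize (M (z - h) z ltac:(lra)).
  assert (N := Hdisp z h He). apply Rabs_def2 in N. lra. }
assert (G1 : gen1 sigma 1 X h - gen0 sigma 1 X h =
  4 * c1 ^ 3 * ((1 - cosv' s s') * / f s' - (1 - cosv s s') * / f s)).
{ rewrite <- (is_derive_unique _ _ _ A). apply is_derive_unique. exact A'. }
rewrite G0 in G1.
replace (gen1 sigma 1 X h) with (gen1 sigma 1 X h - 4 * c1 ^ 3 / f s * (1 - cosv s s') + 4 * c1 ^ 3 / f s * (1 - cosv s s')) by ring.
rewrite G1. field. generalize (f_pos s) (f_pos s'). lra.
Qed.

End Sigma.

End GeneratingFunction.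

Let cos_out (s s' : R) := (a s * (x1 s' - x1 s) + b s * (x2 s' - x2 s)) / chord s s'.
Let cos_in (s s' : R) := (a s' * (x1 s' - x1 s) + b s' * (x2 s' - x2 s)) / chord s s'.

Lemma generating_data (k' : nat) : k = S k' -> exists (e d : R) (sg : R -> R -> R),
  0 < e /\ 0 < d < 1 /\ Cs e (S k) (fun X h _ => sg X h) /\
  (forall X h, sg (X + 1) h = sg X h) /\
  (forall s u, Rabs u < d -> 0 < sagitta a b a' b' s u 0) /\
  (forall s u, 0 < u < d -> 0 < chord s (s + u)) /\
  forall X h, 0 < h < e -> let s := lam_inv (X - h) in let s' := lam_inv X in
    0 < s' - s < d /\
    gen0 sg 1 X h = 4 * c1 ^ 3 / f s * (1 - cos_out s s') /\
    gen1 sg 1 X h = 4 * c1 ^ 3 / f s' * (1 - cos_in s s').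
Proof.
intros Ek.
destruct Q_small as [dq [Hdq HQ]]. destruct sagitta_positive as [ds [Hds HS]].
set (d := Rmin dq ds).
assert (Hd : 0 < d < 1) by (unfold d; split; [apply Rmin_pos; lra|]; generalize (Rmin_l dq ds); lra).
assert (L1 : d <= dq) by apply Rmin_l. assert (L2 : d <= ds) by apply Rmin_r.
assert (HQ' : forall s u t, Rabs u < d -> / 2 <= 1 - u ^ 2 * Q s u t) by (intros; apply HQ; lra).
destruct (remainder_quotient d Hd HQ') as [D2 [C2 [E2 P2]]].
destruct lam_inv_lip as [K [HK [L _]]].
(* [K] is a Lipschitz constant of [lam_inv], so [Rabs h < d / K] forces [Rabs u < d]. *)
set (e := d / K). assert (He : 0 < e) by (apply Rdiv_lt_0_compat; lra).
assert (Hdisp : forall X h, Rabs h < e -> Rabs (lam_inv X - lam_inv (X - h)) < d).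
{ intros X h Hh. eapply Rle_lt_trans; [apply L|]. replace (X - (X - h)) with h by ring.
  apply Rmult_lt_reg_l with (/ K). apply Rinv_0_lt_compat; auto.
  rewrite <- Rmult_assoc, Rinv_l, Rmult_1_l by lra. rewrite Rmult_comm. exact Hh. }
exists e, d, (sigma D2). split; [exact He|]. split; [exact Hd|].
split; [|split; [|split; [|split]]].
- exact (Cs_sigma d D2 e C2 Hdisp).
- intros; apply (sigma_per D2 P2).
- intros; apply HS; lra.
- intros s u Hu. apply (chord_length_pos d HQ' s u Hu).
- intros X h Hh. exact (gen_cos d Hd HQ' D2 e C2 E2 Hdisp k' X h Ek Hh).
Qed.

(** Half-angle formula together with [rho ^ (2/3) * w = 1]. The factor matches that in [gen_cos], so
    momenta and [l] agree once the cosines do. *)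
Lemma lazutkin_l_eq (s v : R) : lazutkin_l gamma s v = 4 * c1 ^ 3 / f s * (1 - cos v).
Proof.
assert (C := c1_pos). assert (W := w_pos s).
assert (E : Rpower (rho gamma s) (1 / 3) ^ 2 * w s = 1).
{ simpl. rewrite Rmult_1_r. unfold w. rewrite <- !Rpower_plus.
  replace (1 / 3 + 1 / 3 + - (2 / 3)) with 0 by field. apply Rpower_O, rho_pos. }
assert (T : cos v = 1 - 2 * sin (v / 2) * sin (v / 2)).
{ rewrite <- cos_2a_sin. f_equal. field. }
unfold lazutkin_l, lazutkin_y. fold c1. rewrite T. unfold f.
set (r := Rpower _ _) in *. set (n := sin (v / 2)).
replace ((4 * c1 * r * n) ^ 2 / 2) with (8 * c1 ^ 2 * n ^ 2 / w s * (r ^ 2 * w s)) by (field; lra).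
rewrite E. field. lra.
Qed.

Lemma eqT_shift (g : R -> R) (s s' : R) : (forall s, g (s + 1) = g s) -> eqT s s' -> g s = g s'.
Proof. intros H [n ->]. apply periodic_IZR. exact H. Qed.

(** [lam s - s] is 1-periodic, so [lam] commutes with integer translations. *)
Lemma lam_eqT (s s' : R) : eqT s s' <-> eqT (lam s) (lam s').
Proof.
assert (H : forall s n, lam (s + IZR n) = lam s + IZR n).
{ intros t n. assert (P := periodic_IZR (fun s => lam s - s) n t).
  cbv beta in P. enough (lam (t + IZR n) - (t + IZR n) = lam t - t) by lra.
  apply P. intros z. rewrite lam_shift. ring. }
split.
- intros [n ->]. exists n. apply H.
- intros [n E]. exists n. apply lam_inj. rewrite H. exact E.
Qed.

Lemma gamma_eqT (s s' : R) : eqT s s' -> gamma s = gamma s'.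
Proof.
intros E. apply injective_projections.
- apply (eqT_shift x1); auto. intros; unfold x1; rewrite Per; reflexivity.
- apply (eqT_shift x2); auto. intros; unfold x2; rewrite Per; reflexivity.
Qed.

Lemma direction_eq (s v : R) :
  direction gamma s v = (cos v * a s - sin v * b s, sin v * a s + cos v * b s).
Proof. reflexivity. Qed.

Lemma direction_eqT (s s' v : R) : eqT s s' -> direction gamma s v = direction gamma s' v.
Proof.
intros E. rewrite !direction_eq.
rewrite (eqT_shift a s s' a_per E), (eqT_shift b s s' b_per E). reflexivity.
Qed.

Lemma lazutkin_l_eqT (s s' v : R) : eqT s s' -> lazutkin_l gamma s v = lazutkin_l gamma s' v.
Proof. intros E. rewrite !lazutkin_l_eq, (eqT_shift f s s' f_per E). reflexivity. Qed.

Lemma lazutkin_l_inj (s v v' : R) : 0 <= v <= PI -> 0 <= v' <= PI ->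
  lazutkin_l gamma s v = lazutkin_l gamma s v' -> v = v'.
Proof.
intros Hv Hv' E. rewrite !lazutkin_l_eq in E.
assert (P : 0 < 4 * c1 ^ 3 / f s).
{ apply Rdiv_lt_0_compat; [|apply f_pos]. apply Rmult_lt_0_compat; [lra|]. apply pow_lt, c1_pos. }
apply Rmult_eq_reg_l in E; [|lra].
rewrite <- (acos_cos v), <- (acos_cos v') by auto. f_equal. lra.
Qed.

Lemma lazutkin_l_0 (s : R) : lazutkin_l gamma s 0 = 0.
Proof. rewrite lazutkin_l_eq, cos_0. ring. Qed.

(** * Chords as billiard trajectories *)

Section Table.

Variable Omega : R * R -> Prop.
Hypothesis Convex : strictly_convex_domain Omega.
Hypothesis Bd : forall p, boundary Omega p <-> exists s, gamma s = p.
Hypothesis Inj : forall s s', gamma s = gamma s' <-> eqT s s'.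

(** Otherwise [Omega], being open, would be a neighbourhood of a boundary point disjoint from the
    complement. *)
Lemma gamma_not_inside (s : R) : ~ Omega (gamma s).
Proof.
intros H. destruct Convex as [O _].
destruct (proj2 (Bd (gamma s)) (ex_intro _ s eq_refl)) as [_ C].
destruct (C Omega (O _ H)) as [q [A B]]. auto.
Qed.

Lemma chord_inside (s s' t : R) : gamma s <> gamma s' -> 0 < t < 1 ->
  Omega (plus (scal (1 - t) (gamma s)) (scal t (gamma s'))).
Proof.
intros N Ht. destruct Convex as [_ [_ [_ C]]]. apply C; auto.
- apply (proj2 (Bd (gamma s)) (ex_intro _ s eq_refl)).
- apply (proj2 (Bd (gamma s')) (ex_intro _ s' eq_refl)).
Qed.

Lemma direction_cos (s v : R) :
  cos v = a s * fst (direction gamma s v) + b s * snd (direction gamma s v).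
Proof.
rewrite direction_eq. simpl.
assert (U := Unit s).
replace (a s * (cos v * a s - sin v * b s) + b s * (sin v * a s + cos v * b s)) with
  (cos v * (a s ^ 2 + b s ^ 2)) by ring. rewrite U. ring.
Qed.

(** Angles in [[0, PI]] are determined by their cosines, but the directions involve the sines as
    well; the positive sagittas at both ends give these the signs for which [v] and [- v'] point
    along the chord. *)
Lemma billiard_chord (s u : R) : 0 < u < 1 -> 0 < chord s (s + u) ->
  0 < sagitta a b a' b' s u 0 -> 0 < sagitta a b a' b' (s + u) (- u) 0 ->
  let v := acos (cos_out s (s + u)) in let v' := acos (cos_in s (s + u)) in
  billiard Omega gamma s v (s + u) v' /\ 0 < v /\
  cos v = cos_out s (s + u) /\ cos v' = cos_in s (s + u).
Proof.
intros Hu Hc S S' v v'.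
assert (E := sagitta_eq (3 + k) x1 x2 a b a' b' x1_derive x2_derive a_derive b_derive Cs_a' Cs_b' Cs_a Cs_b s u 0).
assert (E' := sagitta_eq (3 + k) x1 x2 a b a' b' x1_derive x2_derive a_derive b_derive Cs_a' Cs_b' Cs_a Cs_b (s + u) (- u) 0).
replace (s + u + - u) with s in E' by ring.
assert (U2 : 0 < u ^ 2) by (apply pow_lt; lra).
assert (U := Unit s). assert (U' := Unit (s + u)).
set (s' := s + u) in *. set (r := chord s s') in *.
assert (R2 : r ^ 2 = (x1 s' - x1 s) ^ 2 + (x2 s' - x2 s) ^ 2).
{ unfold r, chord. apply pow2_sqrt. apply Rplus_le_le_0_compat; apply pow2_ge_0. }
set (w1 := x1 s' - x1 s) in *. set (w2 := x2 s' - x2 s) in *.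
(* Lagrange's identity for the unit vector [(p, q)] and the chord: the squares of their normalized
   inner and cross products add up to [1]. A nonzero cross product excludes the degenerate
   angles. *)
assert (Ci : forall p q, p ^ 2 + q ^ 2 = 1 -> 0 < Rabs (p * w2 - q * w1) ->
   let c := (p * w1 + q * w2) / r in
   -1 < c < 1 /\ cos (acos c) = c /\ sin (acos c) = Rabs (p * w2 - q * w1) / r).
{ intros p q Hpq Hs c.
  assert (I : c ^ 2 + (Rabs (p * w2 - q * w1) / r) ^ 2 = 1).
  { replace ((Rabs (p * w2 - q * w1) / r) ^ 2) with ((Rabs (p * w2 - q * w1)) ^ 2 / r ^ 2) by (field; lra).
    rewrite pow2_abs. unfold c.
    replace (((p * w1 + q * w2) / r) ^ 2) with ((p * w1 + q * w2) ^ 2 / r ^ 2) by (field; lra).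
    rewrite <- Rdiv_plus_distr.
    replace ((p * w1 + q * w2) ^ 2 + (p * w2 - q * w1) ^ 2) with ((p ^ 2 + q ^ 2) * (w1 ^ 2 + w2 ^ 2)) by ring.
    rewrite Hpq, Rmult_1_l, <- R2. field. lra. }
  assert (P : 0 < Rabs (p * w2 - q * w1) / r) by (apply Rdiv_lt_0_compat; auto).
  set (z := Rabs (p * w2 - q * w1) / r) in *.
  assert (Z2 : 0 < z ^ 2) by (apply pow_lt; auto).
  assert (B : -1 < c < 1) by nra.
  split; [exact B|]. split. apply cos_acos; lra.
  rewrite sin_acos by lra. rewrite <- (sqrt_pow2 z) by lra. f_equal. rewrite Rsqr_pow2. lra. }
assert (S1 : a s * w2 - b s * w1 = u ^ 2 * sagitta a b a' b' s u 0) by exact E.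
(* Seen from [s'] the chord is traversed backwards, so its cross product with the tangent is
   negative; hence the direction has angle [- v']. *)
assert (S2 : a s' * w2 - b s' * w1 = - (u ^ 2 * sagitta a b a' b' s' (- u) 0)).
{ replace ((- u) ^ 2) with (u ^ 2) in E' by ring. rewrite <- E'. unfold w1, w2. ring. }
assert (Q1 : 0 < u ^ 2 * sagitta a b a' b' s u 0) by (apply Rmult_lt_0_compat; auto).
assert (Q2 : 0 < u ^ 2 * sagitta a b a' b' s' (- u) 0) by (apply Rmult_lt_0_compat; auto).
destruct (Ci (a s) (b s) U) as (B1 & C1 & N1). { rewrite Rabs_pos_eq; lra. }
destruct (Ci (a s') (b s') U') as (B2 & C2 & N2). { rewrite Rabs_left1; lra. }
change ((a s * w1 + b s * w2) / r) with (cos_out s s') in B1, C1, N1.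
change ((a s' * w1 + b s' * w2) / r) with (cos_in s s') in B2, C2, N2.
fold v in C1, N1. fold v' in C2, N2.
rewrite Rabs_pos_eq in N1 by lra. rewrite Rabs_left1 in N2 by lra.
assert (V := acos_bound_lt _ B1). assert (V' := acos_bound_lt _ B2). fold v in V. fold v' in V'.
assert (D1 : direction gamma s v = (w1 / r, w2 / r)).
{ rewrite direction_eq.
  rewrite C1, N1. unfold cos_out. fold s' w1 w2 r.
  f_equal; apply Rmult_eq_reg_r with r; try lra.
  - replace (w1 / r * r) with (w1 * (a s ^ 2 + b s ^ 2)) by (rewrite U; field; lra). field; lra.
  - replace (w2 / r * r) with (w2 * (a s ^ 2 + b s ^ 2)) by (rewrite U; field; lra). field; lra. }
assert (D2 : direction gamma s' (- v') = (w1 / r, w2 / r)).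
{ rewrite direction_eq.
  rewrite cos_neg, sin_neg, C2, N2. unfold cos_in. fold s' w1 w2 r.
  f_equal; apply Rmult_eq_reg_r with r; try lra.
  - replace (w1 / r * r) with (w1 * (a s' ^ 2 + b s' ^ 2)) by (rewrite U'; field; lra). field; lra.
  - replace (w2 / r * r) with (w2 * (a s' ^ 2 + b s' ^ 2)) by (rewrite U'; field; lra). field; lra. }
assert (Ne : gamma s <> gamma s').
{ intros Eq. assert (w1 = 0) by (unfold w1, x1; rewrite Eq; ring).
  assert (w2 = 0) by (unfold w2, x2; rewrite Eq; ring).
  rewrite H, H0 in R2. assert (0 < r ^ 2) by (apply pow_lt; auto). lra. }
split; [|split; [lra|split; assumption]].
split; [lra|]. split; [lra|]. right. split; [lra|].
exists r. split; [exact Hc|]. split; [|split].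
- intros t Ht. rewrite D1.
  assert (I := chord_inside s s' (t / r) Ne).
  replace (plus (gamma s) (scal t (w1 / r, w2 / r))) with
    (plus (scal (1 - t / r) (gamma s)) (scal (t / r) (gamma s'))).
  + apply I. split. apply Rdiv_lt_0_compat; lra.
    apply Rmult_lt_reg_r with r; auto. replace (t / r * r) with t by (field; lra). lra.
  + unfold w1, w2, x1, x2. destruct (gamma s) as [p1 p2]. destruct (gamma s') as [q1 q2].
    unfold plus, scal; simpl. unfold prod_plus, prod_scal, plus, scal; simpl. unfold mult; simpl.
    f_equal; field; lra.
- rewrite D1. unfold w1, w2, x1, x2. destruct (gamma s) as [p1 p2]. destruct (gamma s') as [q1 q2].
  unfold plus, scal; simpl. unfold prod_plus, prod_scal, plus, scal; simpl. unfold mult; simpl.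
  f_equal; field; lra.
- rewrite D1, D2. reflexivity.
Qed.

(** Both trajectories follow the same ray, and a shorter one would end at a boundary point that the
    longer one places inside [Omega]; so the lengths agree. The reflected angle is then read off
    from its cosine. *)
Lemma billiard_unique (s t v s1 v1 s2 v2 : R) : eqT s t ->
  billiard Omega gamma s v s1 v1 -> billiard Omega gamma t v s2 v2 -> eqT s1 s2 /\ v1 = v2.
Proof.
intros Est (_ & Hv1 & H1) (_ & Hv2 & H2).
destruct H1 as [(V1 & E1 & W1)|(V1 & d1 & P1 & I1 & G1 & R1)];
destruct H2 as [(V2 & E2 & W2)|(V2 & d2 & P2 & I2 & G2 & R2)]; try lra.
- split; [|congruence]. destruct E1 as [n1 ->], E2 as [n2 ->], Est as [n ->].
  exists (n + n1 - n2)%Z. rewrite minus_IZR, plus_IZR. ring.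
- rewrite <- (gamma_eqT s t Est), <- (direction_eqT s t v Est) in *.
  assert (Ed : d1 = d2).
  { destruct (Rtotal_order d1 d2) as [L|[L|L]]; auto; exfalso.
    - apply (gamma_not_inside s1). rewrite G1. apply I2; lra.
    - apply (gamma_not_inside s2). rewrite G2. apply I1; lra. }
  assert (Es : eqT s1 s2) by (apply Inj; rewrite G1, G2, Ed; reflexivity).
  split; [exact Es|].
  assert (C1 := direction_cos s1 (- v1)). assert (C2 := direction_cos s2 (- v2)).
  rewrite <- R1 in C1. rewrite <- R2 in C2. rewrite cos_neg in C1, C2.
  rewrite <- (eqT_shift a s1 s2 a_per Es), <- (eqT_shift b s1 s2 b_per Es), <- C1 in C2.
  rewrite <- (acos_cos v1), <- (acos_cos v2) by auto. congruence.
Qed.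

End Table.

End Curve.

(** * Identification of the billiard map with the time-one map *)

Lemma eqT_refl (x : R) : eqT x x.
Proof. exists 0%Z. ring. Qed.

Lemma eqT_sym (x y : R) : eqT x y -> eqT y x.
Proof. intros [n ->]. exists (- n)%Z. rewrite opp_IZR. ring. Qed.

Lemma eqT_trans (x y z : R) : eqT x y -> eqT y z -> eqT x z.
Proof. intros [n ->] [m ->]. exists (m + n)%Z. rewrite plus_IZR. ring. Qed.

Theorem theorem1p4 :
  exists r0 : nat, (6 <= r0)%nat /\
  forall r : nat, (r0 <= r)%nat ->
  forall (Omega : R * R -> Prop) (gamma : R -> R * R),
    strictly_convex_domain Omega ->
    arclength_boundary r Omega gamma ->
    exists (V : R -> R -> R -> R) (l0 : R),
      (forall x q t : R, 0 <= q ->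
         V (x + 1) q t = V x q t /\ V x q (t + 1) = V x q t) /\
      Ck_half (r - 5) V /\
      0 < l0 /\
      forall x l : R, 0 <= l <= l0 ->
        exists x' l' : R,
          hamilton_flow (hamiltonian V) 1 x l x' l' /\
          (forall x'' l'' : R,
             Phi Omega gamma x l x'' l'' <-> eqT x'' x' /\ l'' = l').
Proof.
exists 7%nat. split; [lia|]. intros r Hr Omega gamma Conv (C1 & C2 & Unit & Inj & Bd & Curv).
set (k := (r - 5)%nat). assert (Ek : k = S (S (r - 7))) by (unfold k; lia).
replace r with (5 + k)%nat in C1, C2 by (unfold k; lia).
assert (Per : forall s, gamma (s + 1) = gamma s).
{ intros s. apply Inj. exists 1%Z. reflexivity. }
destruct (generating_data gamma k C1 C2 Unit Per Curv _ Ek)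
  as (e & d & sg & He & Hd & Csg & Psg & Sag & Chord & Gen).
rewrite Ek in Csg.
(* Taking [delta := e] keeps [h] in the range where [Gen] reads the momenta as cosines. *)
destruct (interpolation e (S (r - 7)) sg He Csg (fun X h _ => Psg X h) e ltac:(lia) He)
  as (V & l0 & PV & CV & Hl0 & Flow).
exists V, l0. split; [exact PV|]. split; [rewrite Ek; exact CV|]. split; [exact Hl0|].
intros x l Hl. destruct (Flow x l Hl) as (h & Hh & Hpos & Hzero & G0 & HF).
exists (x + h), (gen1 sg 1 (x + h) h). split; [exact HF|].
set (A := lam_inv gamma k C1 C2 Per Curv) in *.
assert (AR : forall x, lazutkin_x gamma (A x) = x) by (intros; apply lam_inv_r).
destruct (Req_dec l 0) as [L0|L0].
- assert (Zh := Hzero L0). clear G0. subst h l.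
  destruct (gen_0 e _ sg He Csg (x + 0)) as [_ G1]. rewrite G1. rewrite Rplus_0_r.
  intros x'' l''. split.
  + intros (s & v & s' & v' & B & Ex & El & Ex' & El').
    assert (Hv := proj1 B).
    (* At [l = 0] injectivity of [l] in [v] leaves only the branch of [billiard] that fixes the
       point. *)
    assert (V0 : v = 0).
    { apply (lazutkin_l_inj gamma k C1 C2 Curv s); auto; [lra|].
      rewrite <- El. symmetry. apply (lazutkin_l_0 gamma k C1 C2 Curv). }
    destruct B as (_ & _ & [(_ & Es & V')|(P & _)]); [|lra].
    subst v'. split; [|rewrite El'; apply (lazutkin_l_0 gamma k C1 C2 Curv)].
    apply (eqT_trans _ _ _ Ex'). apply eqT_sym. apply (eqT_trans _ _ _ Ex). apply eqT_sym.
    apply (proj1 (lam_eqT gamma k C1 C2 Per Curv _ _)). exact Es.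
  + intros [Ex ->]. exists (A x), 0, (A x), 0.
    assert (Z := PI_RGT_0).
    rewrite (lazutkin_l_0 gamma k C1 C2 Curv), AR.
    split; [|split; [apply eqT_refl|split; [reflexivity|split; [exact Ex|reflexivity]]]].
    split; [lra|]. split; [lra|]. left. split; [reflexivity|]. split; [apply eqT_refl|reflexivity].
- assert (Ph : 0 < h) by (apply Hpos; lra).
  destruct (Gen (x + h) h ltac:(lra)) as (Hu & E0 & E1).
  fold A in Hu, E0, E1. replace (x + h - h) with x in Hu, E0, E1 by ring.
  set (s := A x) in *. set (s' := A (x + h)) in *. set (u := s' - s) in *.
  assert (Es' : s' = s + u) by (unfold u; ring).
  destruct (billiard_chord gamma k C1 C2 Unit Omega Conv Bd s u ltac:(lra) (Chord s u Hu)
     (Sag s u ltac:(rewrite Rabs_pos_eq; lra))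
     (Sag (s + u) (- u) ltac:(rewrite Rabs_Ropp, Rabs_pos_eq; lra)))
     as (B & Pv & Cv & Cv').
  rewrite <- Es' in B, Pv, Cv, Cv'.
  set (v := acos _) in B, Pv, Cv. set (v' := acos _) in B, Cv'.
  assert (Lv : lazutkin_l gamma s v = l).
  { rewrite (lazutkin_l_eq gamma k C1 C2 Curv), Cv, <- G0. symmetry. exact E0. }
  assert (Lv' : lazutkin_l gamma s' v' = gen1 sg 1 (x + h) h).
  { rewrite (lazutkin_l_eq gamma k C1 C2 Curv), Cv'. symmetry. exact E1. }
  intros x'' l''. split.
  + intros (t & w & t' & w' & B' & Ex & El & Ex' & El').
    (* The coordinates [(x, l)] determine the base point modulo 1 and the angle, so every witness of
       [Phi] starts on the same trajectory. *)
    assert (Et : eqT t s).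
    { apply (proj2 (lam_eqT gamma k C1 C2 Per Curv _ _)). unfold s. rewrite AR. apply eqT_sym. exact Ex. }
    assert (Ew : w = v).
    { apply (lazutkin_l_inj gamma k C1 C2 Curv s). apply B'. apply B.
      rewrite Lv, El. symmetry. apply (lazutkin_l_eqT gamma k C1 C2 Per Curv). exact Et. }
    subst w.
    destruct (billiard_unique gamma Unit Per Omega Conv Bd Inj t s v t' w' s' v' Et B' B) as [Et' ->].
    split.
    * apply (eqT_trans _ _ _ Ex'). rewrite <- (AR (x + h)).
      apply (proj1 (lam_eqT gamma k C1 C2 Per Curv _ _)). exact Et'.
    * rewrite El', <- Lv'. apply (lazutkin_l_eqT gamma k C1 C2 Per Curv). exact Et'.
  + intros [Ex ->]. exists s, v, s', v'. split; [exact B|].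
    split; [unfold s; rewrite AR; apply eqT_refl|]. split; [symmetry; exact Lv|].
    split; [unfold s'; rewrite AR; exact Ex|]. symmetry; exact Lv'.
Qed.
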